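(* Let $k$ be a perfect field, let $n\ge 1$, and let $d_1,\ldots,d_n$ be positive integers with $\sum_{i=1}^n d_i\equiv n+1 \pmod 2$. Let $f_1,\ldots,f_n$ be hypersurfaces of $\mathbb{P}^n_k$ of degrees $d_1,\ldots,d_n$ that intersect transversely (at every common point). For an intersection point $p$ of $f_1,\ldots,f_n$ with residue field $k(p)$, let $J(p)\in k(p)^\times$ be the signed volume of the parallelepiped determined by the gradient vectors of $f_1,\ldots,f_n$ at $p$. Then, summing over the intersection points (closed points) of $f_1,\ldots,f_n$, we have in $\operatorname{GW}(k)$ $$\sum_{p}\operatorname{Tr}_{k(p)/k}\langle J(p)\rangle=\frac{d_1\cdots d_n}{2}\cdot\mathbb{H}.$$
   Context: $\mathbb{P}^n_k=\operatorname{Proj}k[x_0,\ldots,x_n]$. A hypersurface of degree $d_i$ is the vanishing locus of a nonzero homogeneous polynomial of degree $d_i$, also denoted $f_i$. Transversality: $f_1,\ldots,f_n$ intersect transversely at a common closed point $p$ if each $f_i$ is smooth at $p$ and $\operatorname{codim}(\bigcap_i T_pf_i)=\sum_i\operatorname{codim}T_pf_i$, codimensions being taken in $T_p\mathbb{P}^n\cong k(p)^n$. Grothendieck–Witt group: $\operatorname{GW}(k)$ is the group completion of the monoid (under direct sum) of isomorphism classes of non-degenerate symmetric bilinear forms over $k$. For $a\in k^\times$, $\langle a\rangle$ is the class of $(x,y)\mapsto axy$, and $\mathbb{H}=\langle 1\rangle+\langle -1\rangle$. For a finite (separable) extension $L/k$, $\operatorname{Tr}_{L/k}:\operatorname{GW}(L)\to\operatorname{GW}(k)$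 is post-composition of a form with the field trace $L\to k$. The parity condition forces some $d_i$ to be even, so $\frac{d_1\cdots d_n}{2}$ is an integer. Definition of $J(p)$: for $0\le\ell\le n$ let $U_\ell=\{x_\ell\neq0\}\subset\mathbb{P}^n$ with coordinates $\tilde\varphi_\ell:U_\ell\to\mathbb{A}^n$, where $\tilde\varphi_0([p_0:\cdots:p_n])=(\frac{p_1}{p_0},\ldots,\frac{p_n}{p_0})$ and, for $\ell\ge1$, $\tilde\varphi_\ell([p_0:\cdots:p_n])=((-1)^\ell\frac{p_0}{p_\ell},\frac{p_1}{p_\ell},\ldots,\frac{p_{\ell-1}}{p_\ell},\frac{p_{\ell+1}}{p_\ell},\ldots,\frac{p_n}{p_\ell})$. Let $y_j$ ($j\ne\ell$, in increasing order) be the coordinates on $\mathbb{A}^n$, and put $f_i^0=f_i(1,y_1,\ldots,y_n)$ and, for $\ell\geq 1$, $f_i^\ell=f_i((-1)^\ell y_0,y_1,\ldots,y_{\ell-1},1,y_{\ell+1},\ldots,y_n)$. Let $J_\ell=\det(\partial f_i^\ell/\partial y_j)_{1\le i\le n,\,j\ne\ell}$; its value $J_\ell(p):=J_\ell(\tilde\varphi_\ell(p))\in k(p)$ is the signed volume of the parallelepiped spanned by the gradients of the $f_i^\ell$ at $\tilde\varphi_\ell(p)$. For $p\in U_\ell$, set $J(p)=J_\ell(p)$; under the parity hypothesis the class $\langle J(p)\rangle\in\operatorname{GW}(k(p))$ does not depend on the choice of $\ell$ with $p\in U_\ell$. *)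

(* Defs.v *)
From HB Require Import structures.
From mathcomp Require Import all_boot all_order all_algebra all_field.
From mathcomp Require Import mpoly.
From mathcomp Require Import boolp.

Set Implicit Arguments.
Unset Strict Implicit.
Unset Printing Implicit Defensive.

Import GRing.Theory.
Local Open Scope ring_scope.
Local Open Scope quotient_scope.

Definition perfect_field (k : fieldType) : Prop :=
  forall L : fieldExtType k, separable 1 {:L}.

Section Groth.
Variable M : nmodType.

(* (a, b) stands for the formal difference a - b; the extra summand e is
   needed because M need not be cancellative. *)
Definition groth_eq : rel (M * M) :=
  fun x y => `[< exists e : M, x.1 + y.2 + e = y.1 + x.2 + e >].

Lemma groth_eq_refl : reflexive groth_eq.
Proof. by move=> x; apply/asboolP; exists 0. Qed.

Lemma groth_eq_sym : ssrbool.symmetric groth_eq.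
Proof. by move=> x y; apply/asboolP/asboolP => -[e he]; exists e. Qed.

Lemma groth_eq_trans : transitive groth_eq.
Proof.
move=> y x z /asboolP[e he] /asboolP[g hg]; apply/asboolP.
exists (y.1 + y.2 + e + g).
transitivity ((x.1 + y.2 + e) + (y.1 + z.2 + g)).
  by rewrite [LHS](AC (2*(2*1*1)) ((1*4*5)*(3*2*6))).
by rewrite he hg [RHS](AC (2*(2*1*1)) ((3*2*5)*(1*4*6))).
Qed.

Canonical groth_equiv :=
  EquivRel groth_eq groth_eq_refl groth_eq_sym groth_eq_trans.

Definition groth := {eq_quot groth_eq}.
HB.instance Definition _ := Choice.on groth.
HB.instance Definition _ : EqQuotient _ groth_eq groth := EqQuotient.on groth.

Definition groth_sub (x : M * M) : groth := \pi_groth x.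
Definition groth_in (a : M) : groth := groth_sub (a, 0).

Lemma groth_subE (x y : M * M) :
  groth_sub x = groth_sub y <->
  exists e : M, x.1 + y.2 + e = y.1 + x.2 + e.
Proof.
rewrite /groth_sub; split=> [/eqmodP/asboolP //|h].
by apply/eqmodP/asboolP.
Qed.

Definition groth_add (u v : groth) : groth :=
  groth_sub ((repr u).1 + (repr v).1, (repr u).2 + (repr v).2).
Definition groth_opp (u : groth) : groth := groth_sub ((repr u).2, (repr u).1).

Lemma groth_repr (x : M * M) :
  exists e : M, (repr (groth_sub x)).1 + x.2 + e
              = x.1 + (repr (groth_sub x)).2 + e.
Proof. by apply/groth_subE; rewrite {1}/groth_sub reprK. Qed.

Lemma groth_addE (x y : M * M) :
  groth_add (groth_sub x) (groth_sub y) = groth_sub (x.1 + y.1, x.2 + y.2).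
Proof.
have [e he] := groth_repr x; have [g hg] := groth_repr y.
move: he hg; rewrite /groth_add.
move: (repr (groth_sub x)) (repr (groth_sub y)) => x' y' he hg.
apply/groth_subE => /=; exists (e + g).
transitivity ((x'.1 + x.2 + e) + (y'.1 + y.2 + g)).
  by rewrite [LHS](AC ((2*2)*2) ((1*3*5)*(2*4*6))).
by rewrite he hg [RHS](AC ((2*2)*2) ((1*3*5)*(2*4*6))).
Qed.

Lemma groth_oppE (x : M * M) : groth_opp (groth_sub x) = groth_sub (x.2, x.1).
Proof.
have [e he] := groth_repr x; move: he; rewrite /groth_opp.
move: (repr (groth_sub x)) => x' he; apply/groth_subE => /=; exists e.
by rewrite (addrC x'.2) (addrC x.2).
Qed.

Lemma groth_addA : associative groth_add.
Proof.
elim/quotW=> x; elim/quotW=> y; elim/quotW=> z.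
by rewrite -!/(groth_sub _) !groth_addE /= !addrA.
Qed.

Lemma groth_addC : commutative groth_add.
Proof.
elim/quotW=> x; elim/quotW=> y; rewrite -!/(groth_sub _) !groth_addE.
by rewrite [y.1 + _]addrC [y.2 + _]addrC.
Qed.

Lemma groth_add0 : left_id (groth_in 0) groth_add.
Proof.
by elim/quotW=> -[a b]; rewrite -!/(groth_sub _) groth_addE /= !add0r.
Qed.

Lemma groth_addN : left_inverse (groth_in 0) groth_opp groth_add.
Proof.
elim/quotW=> -[a b]; rewrite -!/(groth_sub _) groth_oppE groth_addE /=.
by apply/groth_subE; exists 0 => /=; rewrite !addr0 add0r addrC.
Qed.

HB.instance Definition _ :=
  GRing.isZmodule.Build groth groth_addA groth_addC groth_add0 groth_addN.

Lemma groth_inD (a b : M) : groth_in (a + b) = groth_in a + groth_in b.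
Proof. by rewrite [RHS]groth_addE /= addr0. Qed.

Lemma groth_subB (x : M * M) : groth_sub x = groth_in x.1 - groth_in x.2.
Proof.
by rewrite [- _]groth_oppE [RHS]groth_addE /= addr0 add0r; case: x.
Qed.

Lemma groth_in_eq (a b : M) :
  groth_in a = groth_in b <-> exists e : M, a + e = b + e.
Proof. by split=> [/groth_subE|h]; last apply/groth_subE; rewrite /= !addr0. Qed.

End Groth.

Section GrothMap.
Variables (M N : nmodType) (h : M -> N).

Definition groth_map (u : groth M) : groth N :=
  groth_in (h (repr u).1) - groth_in (h (repr u).2).

Hypothesis hD : {morph h : x y / x + y}.

Lemma groth_map_sub (a b : M) :
  groth_map (groth_in a - groth_in b) = groth_in (h a) - groth_in (h b).
Proof.
have -> : groth_in a - groth_in b = groth_sub (a, b) by rewrite groth_subB.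
have [e] := groth_repr (a, b); rewrite /groth_map.
move: (repr _) => x /= /(congr1 (fun z => groth_in (h z))).
rewrite !hD !groth_inD => /addIr he.
by apply/eqP; rewrite subr_eq addrAC eq_sym subr_eq -he.
Qed.

End GrothMap.

(* A non-degenerate symmetric bilinear form on a finite-dimensional k-vector
   space is represented by its Gram matrix in some basis, so that isometry is
   congruence. Quantifying over abstract vector spaces instead would put the
   type of forms in a universe too large for it to be a choiceType. *)
Definition sform_axiom (k : fieldType) (A : {n : nat & 'M[k]_n}) : bool :=
  ((tagged A)^T == tagged A) && (tagged A \in unitmx).

Record sform (k : fieldType) := SForm {
  sform_val : {n : nat & 'M[k]_n};
  _ : sform_axiom sform_val }.

HB.instance Definition _ (k : fieldType) := [isSub for @sform_val k].
HB.instance Definition _ (k : fieldType) := [Choice of sform k by <:].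

Definition sdim (k : fieldType) (A : sform k) : nat := tag (val A).
Definition smx (k : fieldType) (A : sform k) : 'M[k]_(sdim A) := tagged (val A).

Section SForm.
Variable k : fieldType.
Implicit Types A B C D : sform k.

Lemma smx_sym A : (smx A)^T = smx A.
Proof. by apply/eqP; case/andP: (valP A). Qed.

Lemma smx_unit A : smx A \in unitmx.
Proof. by case/andP: (valP A). Qed.

(* Base change along P, a linear isomorphism with inverse Q. *)
Definition isometric A B : Prop :=
  exists (P : 'M[k]_(sdim A, sdim B)) (Q : 'M[k]_(sdim B, sdim A)),
    [/\ P *m Q = 1%:M, Q *m P = 1%:M & P *m smx B *m P^T = smx A].

Lemma isometric_refl A : isometric A A.
Proof. by exists 1%:M, 1%:M; rewrite trmx1 !mulmx1 mul1mx. Qed.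

Lemma isometric_sym A B : isometric A B -> isometric B A.
Proof.
move=> [P [Q [PQ QP h]]]; exists Q, P; split=> //.
rewrite -h !mulmxA QP mul1mx -mulmxA -trmx_mul QP trmx1.
by rewrite mulmx1.
Qed.

Lemma isometric_trans B A C : isometric A B -> isometric B C -> isometric A C.
Proof.
move=> [P [Q [PQ QP h]]] [R [S [RS SR g]]].
exists (P *m R), (S *m Q); split.
- by rewrite mulmxA -(mulmxA P) RS mulmx1.
- by rewrite mulmxA -(mulmxA S) QP mulmx1.
- by rewrite trmx_mul -h -g !mulmxA.
Qed.

Fact sform0_subproof : sform_axiom (Tagged (fun n => 'M[k]_n) (0 : 'M[k]_0)).
Proof.
by rewrite /sform_axiom /= trmx0 eqxx /= unitmxE det_mx00 unitr1.
Qed.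
Definition sform0 : sform k := SForm sform0_subproof.

Fact sform_add_subproof A B :
  sform_axiom (Tagged (fun n => 'M[k]_n) (block_mx (smx A) 0 0 (smx B))).
Proof.
rewrite /sform_axiom /= tr_block_mx !trmx0 !smx_sym eqxx /=.
by rewrite unitmxE det_ublock unitrM -!unitmxE !smx_unit.
Qed.
Definition sform_add A B : sform k := SForm (sform_add_subproof A B).

Lemma isometric_add A B C D :
  isometric A B -> isometric C D ->
  isometric (sform_add A C) (sform_add B D).
Proof.
move=> [P [Q [PQ QP h]]] [R [S [RS SR g]]].
exists (block_mx P 0 0 R), (block_mx Q 0 0 S).
rewrite tr_block_mx /smx /= !mulmx_block.
rewrite !trmx0 !mul0mx !mulmx0 !addr0 !add0r PQ QP RS SR h g !mul0mx.
by rewrite -!scalar_mx_block.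
Qed.

(* Isometry of two forms whose Gram matrices agree up to a relabelling of the
   basis vectors. *)
Lemma isometric_reindex A B (s : 'I_(sdim A) -> 'I_(sdim B)) t :
  cancel s t -> cancel t s ->
  (forall i j, smx A i j = smx B (s i) (s j)) -> isometric A B.
Proof.
move=> sK tK h.
have key m n p (u : 'I_m -> 'I_n) (N : 'M[k]_(n, p)) :
    (\matrix_(i, j) (j == u i)%:R) *m N = \matrix_(i, j) N (u i) j.
  apply/matrixP=> i j; rewrite !mxE (bigD1 (u i)) //= !mxE eqxx mul1r.
  by rewrite big1 ?addr0 // => l /negPf ul; rewrite !mxE ul mul0r.
exists (\matrix_(i, j) (j == s i)%:R), (\matrix_(i, j) (j == t i)%:R); split.
- by rewrite key; apply/matrixP=> i j; rewrite !mxE sK eq_sym.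
- by rewrite key; apply/matrixP=> i j; rewrite !mxE tK eq_sym.
rewrite key; apply: trmx_inj; rewrite trmx_mul trmxK key.
by apply/matrixP=> i j; rewrite !mxE h.
Qed.

Lemma isometric_addC A B : isometric (sform_add A B) (sform_add B A).
Proof.
pose s m n (i : 'I_(m + n)) : 'I_(n + m) :=
  match split i with inl a => rshift n a | inr b => lshift m b end.
have sK m n : cancel (s m n) (s n m).
  move=> i; rewrite /s -{2}(splitK i); case: (split i) => a /=.
    by rewrite (unsplitK (inr a)).
  by rewrite (unsplitK (inl a)).
apply: (@isometric_reindex (sform_add A B) (sform_add B A)
  (s (sdim A) (sdim B)) (s (sdim B) (sdim A))); [exact: sK | exact: sK |].
move=> i j; rewrite /smx /= /s -{1}(splitK i) -{1}(splitK j).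
case: (split i) => a; case: (split j) => b /=;
 by rewrite ?block_mxEul ?block_mxEur ?block_mxEdl ?block_mxEdr ?mxE.
Qed.

Lemma isometric_addA A B C :
  isometric (sform_add A (sform_add B C)) (sform_add (sform_add A B) C).
Proof.
have e := addnA (sdim A) (sdim B) (sdim C).
apply: (@isometric_reindex (sform_add A (sform_add B C))
  (sform_add (sform_add A B) C) (cast_ord e) (cast_ord (esym e))).
- exact: cast_ordK.
- exact: cast_ordKV.
move=> i j; rewrite /smx /=.
rewrite -[X in block_mx _ X _ _ i j]row_mx0 -[X in block_mx _ _ X _ i j]col_mx0.
rewrite block_mxA castmxE row_mx0 col_mx0.
by congr (block_mx _ _ _ _ _ _); apply: val_inj.
Qed.

Lemma isometric_add0 A : isometric (sform_add sform0 A) A.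
Proof.
pose s (i : 'I_(0 + sdim A)) : 'I_(sdim A) := i.
pose t (i : 'I_(sdim A)) : 'I_(0 + sdim A) := i.
apply: (@isometric_reindex (sform_add sform0 A) A s t) => //.
move=> i j; rewrite -[smx (sform_add _ _)]/(block_mx (smx sform0) 0 0 (smx A)).
have r (l : 'I_(0 + sdim A)) : l = rshift 0 (s l) by apply: val_inj.
by rewrite {1}(r i) {1}(r j) block_mxEdr.
Qed.

Lemma isometric_dim0 A B : sdim A = 0%N -> sdim B = 0%N -> isometric A B.
Proof.
move=> a0 b0.
have no (C : sform k) : sdim C = 0%N -> 'I_(sdim C) -> False.
  by move=> c0 [i]; rewrite c0.
exists 0, 0; split; apply/matrixP=> i j; case: (no _ _ i) => //.
Qed.

Definition isometricb : rel (sform k) := fun A B => `[< isometric A B >].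

Fact isometricb_refl : reflexive isometricb.
Proof. by move=> A; apply/asboolP/isometric_refl. Qed.
Fact isometricb_sym : ssrbool.symmetric isometricb.
Proof. by move=> A B; apply/asboolP/asboolP => /isometric_sym. Qed.
Fact isometricb_trans : transitive isometricb.
Proof.
move=> B A C /asboolP AB /asboolP BC.
exact/asboolP/(isometric_trans AB BC).
Qed.

Canonical isometricb_equiv :=
  EquivRel isometricb isometricb_refl isometricb_sym isometricb_trans.

Definition isoClass := {eq_quot isometricb}.
HB.instance Definition _ := Choice.on isoClass.
HB.instance Definition _ : EqQuotient _ isometricb isoClass :=
  EqQuotient.on isoClass.

Definition iso_class A : isoClass := \pi_isoClass A.

Lemma iso_classE A B : iso_class A = iso_class B <-> isometric A B.
Proof.
rewrite /iso_class; split=> [/eqmodP/asboolP //|h].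
by apply/eqmodP/asboolP.
Qed.

Lemma isometric_repr A : isometric (repr (iso_class A)) A.
Proof. by apply/iso_classE; rewrite {1}/iso_class reprK. Qed.

Definition isoClass_add (u v : isoClass) : isoClass :=
  iso_class (sform_add (repr u) (repr v)).

Lemma isoClass_addE A B :
  isoClass_add (iso_class A) (iso_class B) = iso_class (sform_add A B).
Proof. by apply/iso_classE/isometric_add; exact: isometric_repr. Qed.

Fact isoClass_addA : associative isoClass_add.
Proof.
elim/quotW=> A; elim/quotW=> B; elim/quotW=> C.
rewrite -!/(iso_class _) !isoClass_addE.
exact/iso_classE/isometric_addA.
Qed.

Fact isoClass_addC : commutative isoClass_add.
Proof.
elim/quotW=> A; elim/quotW=> B; rewrite -!/(iso_class _) !isoClass_addE.
exact/iso_classE/isometric_addC.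
Qed.

Fact isoClass_add0 : left_id (iso_class sform0) isoClass_add.
Proof.
elim/quotW=> A; rewrite -!/(iso_class _) isoClass_addE.
exact/iso_classE/isometric_add0.
Qed.

HB.instance Definition _ :=
  GRing.isNmodule.Build isoClass isoClass_addA isoClass_addC isoClass_add0.

Lemma iso_classD A B :
  iso_class (sform_add A B) = iso_class A + iso_class B.
Proof. by rewrite [RHS]isoClass_addE. Qed.

(* The form on k^n with Gram matrix A, or the zero space if A is not symmetric
   and invertible. *)
Definition sform_of n (A : 'M[k]_n) : sform k :=
  insubd sform0 (Tagged (fun n => 'M[k]_n) A).

End SForm.

Definition GW (k : fieldType) : zmodType := groth (isoClass k).

Definition gw_class (k : fieldType) (A : sform k) : GW k :=
  groth_in (iso_class A).

(* The class of (x, y) |-> a * x * y; it is 0 by convention if a = 0. *)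
Definition gw_unit (k : fieldType) (a : k) : GW k :=
  gw_class (sform_of (a%:M : 'M[k]_1)).

Definition hyperbolic (k : fieldType) : GW k := gw_unit 1 + gw_unit (-1).

Section Transfer.
Variables (k : fieldType) (L : fieldExtType k).

Local Notation d := (\dim {:L}).
Local Notation e := (vbasis {:L}).

Definition mul_matrix (a : L) : 'M[k]_d :=
  \matrix_(i < d, j < d) coord e j (a * e`_i).

Definition field_trace (a : L) : k := \tr (mul_matrix a).

(* If A is the Gram matrix of a form B on the L-space V = L^m, with standard
   basis (v_i), this is the Gram matrix of Tr o B on the k-space V in the basis
   (e_a v_i): block (i, j) has (a, b) entry Tr(B(e_a v_i, e_b v_j)). *)
Definition trace_mx m (A : 'M[L]_m) : 'M[k]_(\sum_(i < m) d) :=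
  \mxblock_(i < m, j < m) \matrix_(a < d, b < d) field_trace (A i j * e`_a * e`_b).

(* Tr o B is non-degenerate if L / k is separable, so the default value of
   sform_of is not used in that case. *)
Definition transfer_form (A : sform L) : sform k := sform_of (trace_mx (smx A)).


Definition trace_gram : 'M[k]_d := \matrix_(a < d, b < d) field_trace (e`_a * e`_b).

Definition scal_mx m n (P : 'M[L]_(m, n)) : 'M[k]_(\sum_(i < m) d, \sum_(j < n) d) :=
  \mxblock_(i < m, j < n) mul_matrix (P i j).

Lemma mul_matrixE a (i : 'I_d) : a * e`_i = \sum_j mul_matrix a i j *: e`_j.
Proof.
rewrite [LHS](coord_vbasis (memvf _)).
by apply: eq_bigr => j _; rewrite mxE.
Qed.

Lemma mul_matrixD a b : mul_matrix (a + b) = mul_matrix a + mul_matrix b.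
Proof. by apply/matrixP=> i j; rewrite !mxE mulrDl linearD. Qed.

Lemma mul_matrixZ c a : mul_matrix (c *: a) = c *: mul_matrix a.
Proof. by apply/matrixP=> i j; rewrite !mxE -scalerAl linearZ. Qed.

Lemma mul_matrix_sum (I : Type) (r : seq I) (P : pred I) (F : I -> L) :
  mul_matrix (\sum_(i <- r | P i) F i) = \sum_(i <- r | P i) mul_matrix (F i).
Proof.
apply: (big_morph mul_matrix mul_matrixD).
by rewrite -[0 in LHS](scale0r 0) mul_matrixZ scale0r.
Qed.

Lemma mul_matrix1 : mul_matrix 1 = 1%:M.
Proof.
by apply/matrixP=> i j; rewrite !mxE mul1r coord_free // (basis_free (vbasisP _)).
Qed.

Lemma mul_matrix0 : mul_matrix 0 = 0.
Proof. by rewrite -[0 in LHS](scale0r 0) mul_matrixZ scale0r. Qed.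

Lemma mul_matrixM a b : mul_matrix (a * b) = mul_matrix a *m mul_matrix b.
Proof.
apply/matrixP=> i j; rewrite !mxE [a * b]mulrC -mulrA mul_matrixE.
rewrite mulr_sumr linear_sum; apply: eq_bigr => c _ /=.
by rewrite -scalerAr linearZ !mxE.
Qed.

Lemma field_traceD a b : field_trace (a + b) = field_trace a + field_trace b.
Proof. by rewrite /field_trace mul_matrixD linearD. Qed.

Lemma field_traceZ c a : field_trace (c *: a) = c * field_trace a.
Proof. by rewrite /field_trace mul_matrixZ linearZ. Qed.

Lemma field_trace_sum (I : Type) (r : seq I) (P : pred I) (F : I -> L) :
  field_trace (\sum_(i <- r | P i) F i) = \sum_(i <- r | P i) field_trace (F i).
Proof. by rewrite /field_trace mul_matrix_sum linear_sum. Qed.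

Lemma mul_matrix_gram a :
  mul_matrix a *m trace_gram = \matrix_(i, j) field_trace (a * e`_i * e`_j).
Proof.
apply/matrixP=> i j; rewrite [LHS]mxE [RHS]mxE (mul_matrixE a i) mulr_suml.
rewrite field_trace_sum; apply: eq_bigr => c _.
by rewrite -scalerAl field_traceZ [trace_gram _ _]mxE.
Qed.

Lemma trace_gram_tr : trace_gram^T = trace_gram.
Proof. by apply/matrixP=> i j; rewrite !mxE mulrC. Qed.

Lemma gram_mul_matrix a :
  trace_gram *m (mul_matrix a)^T = mul_matrix a *m trace_gram.
Proof.
rewrite -[in LHS]trace_gram_tr -trmx_mul mul_matrix_gram.
by apply/matrixP=> i j; rewrite !mxE mulrAC.
Qed.

Lemma trace_mxE m (A : 'M[L]_m) :
  trace_mx A = scal_mx A *m \mxdiag_(i < m) trace_gram.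
Proof.
rewrite /scal_mx mul_mxblock_mxdiag; apply: eq_mxblock => i j.
by rewrite mul_matrix_gram.
Qed.

Lemma scal_mxM m n p (P : 'M[L]_(m, n)) (Q : 'M[L]_(n, p)) :
  scal_mx (P *m Q) = scal_mx P *m scal_mx Q.
Proof.
rewrite /scal_mx mul_mxblock; apply: eq_mxblock => i j.
by rewrite mxE mul_matrix_sum; apply: eq_bigr => l _; rewrite mul_matrixM.
Qed.

Lemma scal_mx1 m : scal_mx (1%:M : 'M[L]_m) = 1%:M.
Proof.
rewrite -mxdiagZ /mxdiag /scal_mx; apply: eq_mxblock => i j.
by rewrite mxE; case: eqP => _ //=; rewrite ?conform_mx_id ?mul_matrix1 ?mul_matrix0.
Qed.

Lemma gram_scal_mx m n (P : 'M[L]_(m, n)) :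
  \mxdiag_(i < n) trace_gram *m (scal_mx P)^T
  = scal_mx P^T *m \mxdiag_(i < m) trace_gram.
Proof.
rewrite /scal_mx tr_mxblock mul_mxdiag_mxblock mul_mxblock_mxdiag.
by apply: eq_mxblock => i j; rewrite gram_mul_matrix mxE.
Qed.

Lemma trace_mx_congr m n (P : 'M[L]_(m, n)) (B : 'M[L]_n) :
  trace_mx (P *m B *m P^T) = scal_mx P *m trace_mx B *m (scal_mx P)^T.
Proof. by rewrite !trace_mxE !scal_mxM -!mulmxA gram_scal_mx. Qed.

Lemma trace_mx_sym m (A : 'M[L]_m) : A^T = A -> (trace_mx A)^T = trace_mx A.
Proof.
move=> sA; rewrite /trace_mx tr_mxblock; apply: eq_mxblock => i j.
by apply/matrixP=> a b; rewrite !mxE -[in LHS]sA mxE mulrAC.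
Qed.

Lemma trace_mx_unit m (A : 'M[L]_m) :
  trace_gram \in unitmx -> A \in unitmx -> trace_mx A \in unitmx.
Proof.
move=> uT uA; rewrite trace_mxE unitmx_mul; apply/andP; split.
  suff /mulmx1_unit[] : scal_mx A *m scal_mx (invmx A) = 1%:M by [].
  by rewrite -scal_mxM mulmxV // scal_mx1.
suff /mulmx1_unit[] : \mxdiag_(i < m) trace_gram
                   *m \mxdiag_(i < m) invmx trace_gram = 1%:M by [].
rewrite mul_mxdiag_mxblock -mxdiagZ; apply: eq_mxblock => i j.
by case: eqP => _ /=; rewrite ?conform_mx_id ?mulmxV ?mulmx0.
Qed.

Lemma trace_gram_cases :
  trace_gram \in unitmx \/ forall a, field_trace a = 0.
Proof.
have [uT|nT] := boolP (trace_gram \in unitmx); [by left | right=> a].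
have : kermx trace_gram != 0 by rewrite kermx_eq0 row_free_unit.
case/rowV0Pn=> u /sub_kermxP uT0 u0.
pose w := \sum_i u 0 i *: e`_i.
have trw (j : 'I_d) : field_trace (w * e`_j) = 0.
  move/rowP: uT0 => /(_ j); rewrite !mxE => <-.
  rewrite mulr_suml field_trace_sum; apply: eq_bigr => i _.
  by rewrite -scalerAl field_traceZ [trace_gram _ _]mxE.
have w0 : w != 0.
  apply: contraNneq u0 => w0; apply/eqP/rowP=> i; rewrite mxE.
  exact: (elimT freeP (basis_free (vbasisP {:L})) (fun i => u 0 i) w0 i).
rewrite -(mulVKf w0 a) (coord_vbasis (memvf (w^-1 * a))) mulr_sumr.
rewrite field_trace_sum big1 // => i _.
by rewrite -scalerAr field_traceZ trw mulr0.
Qed.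

Lemma smx_of (K : fieldType) n (A : 'M[K]_n) :
  A^T = A -> A \in unitmx ->
  val (sform_of A) = Tagged (fun n => 'M[K]_n) A.
Proof. by move=> sA uA; rewrite insubdK // /in_mem /= /sform_axiom sA eqxx. Qed.

Lemma sdim_transfer0 A :
  (forall a, field_trace a = 0) -> sdim (transfer_form A) = 0%N.
Proof.
have unit0 n : (0 : 'M[k]_n) \in unitmx -> n = 0%N.
  by case: n => // n; rewrite unitmxE det0 unitr0.
move=> tr0; rewrite /sdim /transfer_form /sform_of val_insubd.
case: ifP => //= /andP[_] /=.
have -> : trace_mx (smx A) = 0.
  rewrite -[RHS](@mxblock_const k _ _ _ _ 0); apply: eq_mxblock => i j.
  by apply/matrixP=> a b; rewrite !mxE tr0.
exact: unit0.
Qed.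

Lemma transfer_form_val A : trace_gram \in unitmx ->
  val (transfer_form A) = Tagged (fun n => 'M[k]_n) (trace_mx (smx A)).
Proof.
move=> uT; apply: smx_of; first exact/trace_mx_sym/smx_sym.
exact/trace_mx_unit/smx_unit.
Qed.

Lemma transfer_isometric A B :
  isometric A B -> isometric (transfer_form A) (transfer_form B).
Proof.
case: trace_gram_cases => [uT|tr0] AB; last first.
  by apply: isometric_dim0; exact: sdim_transfer0.
have [P [Q [PQ QP h]]] := AB.
rewrite /isometric /sdim /smx !transfer_form_val //=.
exists (scal_mx P), (scal_mx Q); split.
- by rewrite -scal_mxM PQ scal_mx1.
- by rewrite -scal_mxM QP scal_mx1.
- by rewrite -trace_mx_congr h.
Qed.

Lemma trace_mx_entry m (A : 'M[L]_m) i j (p := tagnat.sig i) (q := tagnat.sig j) :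
  trace_mx A i j
  = field_trace (A (tag p) (tag q) * e`_(tagged p) * e`_(tagged q)).
Proof. by rewrite !mxE. Qed.

Lemma transfer_form_add A B :
  isometric (transfer_form (sform_add A B))
            (sform_add (transfer_form A) (transfer_form B)).
Proof.
case: trace_gram_cases => [uT|tr0]; last first.
  apply: isometric_dim0; first exact: sdim_transfer0.
  by rewrite /sdim /= -!/(sdim _) !sdim_transfer0.
have := transfer_form_val B uT; have := transfer_form_val A uT.
have := transfer_form_val (sform_add A B) uT.
move: (transfer_form (sform_add A B)) (transfer_form A) (transfer_form B).
move=> [vAB pAB] [vA pA] [vB pB] /= eAB eA eB; subst vB vA vAB.
set m := sdim A; set n := sdim B.
pose p_ N := fun _ : 'I_N => d.
pose s (i : 'I_(\sum_(i < m + n) d)) : 'I_(\sum_(i < m) d + \sum_(i < n) d) :=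
  let: existT x a := @tagnat.sig (m + n) (p_ _) i in
  match split x with
  | inl y => lshift _ (@tagnat.rank m (p_ m) (existT _ y a))
  | inr y => rshift _ (@tagnat.rank n (p_ n) (existT _ y a))
  end.
pose t (i : 'I_(\sum_(i < m) d + \sum_(i < n) d)) : 'I_(\sum_(i < m + n) d) :=
  match split i with
  | inl x => let: existT y a := @tagnat.sig _ (p_ m) x in
             @tagnat.rank _ (p_ (m + n)%N) (existT _ (lshift n y) a)
  | inr x => let: existT y a := @tagnat.sig _ (p_ n) x in
             @tagnat.rank _ (p_ (m + n)%N) (existT _ (rshift m y) a)
  end.
have sK : cancel s t.
  move=> i; rewrite /s -{2}(tagnat.sigK i); case: (tagnat.sig i) => x a.
  case: (split x) (splitK x) => y /= ex; rewrite /t.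
    by rewrite (unsplitK (inl _)) tagnat.rankK; case: x / ex a.
  by rewrite (unsplitK (inr _)) tagnat.rankK; case: x / ex a.
have tK : cancel t s.
  move=> i; rewrite /t -{2}(splitK i); case: (split i) => x /=.
    rewrite -{2}(tagnat.sigK x); case: (tagnat.sig x) => y a.
    by rewrite /s tagnat.rankK (unsplitK (inl _)).
  rewrite -{2}(tagnat.sigK x); case: (tagnat.sig x) => y a.
  by rewrite /s tagnat.rankK (unsplitK (inr _)).
apply: (@isometric_reindex _ (SForm pAB) (sform_add (SForm pA) (SForm pB)) s t).
- exact: sK.
- exact: tK.
move=> i j; rewrite /smx /= trace_mx_entry /s.
case: (tagnat.sig i) => x a; case: (tagnat.sig j) => y b /=.
case: (split x) (splitK x) => x' /= <-; case: (split y) (splitK y) => y' /= <-.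
- by rewrite !block_mxEul trace_mx_entry !tagnat.rankK.
- by rewrite !block_mxEur !mxE !mul0r -[0 in LHS](scale0r 0) field_traceZ mul0r.
- by rewrite !block_mxEdl !mxE !mul0r -[0 in LHS](scale0r 0) field_traceZ mul0r.
- by rewrite !block_mxEdr trace_mx_entry !tagnat.rankK.
Qed.

Definition transfer_class (u : isoClass L) : isoClass k :=
  iso_class (transfer_form (repr u)).

Lemma transfer_classE A :
  transfer_class (iso_class A) = iso_class (transfer_form A).
Proof. exact/iso_classE/transfer_isometric/isometric_repr. Qed.

Lemma transfer_classD : {morph transfer_class : u v / u + v}.
Proof.
elim/quotW=> A; elim/quotW=> B; rewrite -!/(iso_class _) -iso_classD.
by rewrite !transfer_classE -iso_classD; apply/iso_classE/transfer_form_add.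
Qed.

Definition transfer (u : GW L) : GW k := groth_map transfer_class u.

Lemma transfer_gw_class A :
  transfer (gw_class A) = gw_class (transfer_form A).
Proof.
have h0 : transfer_class 0 = 0.
  rewrite -[0 in LHS]/(iso_class (sform0 L)) transfer_classE.
  apply/iso_classE/isometric_dim0 => //.
  case: trace_gram_cases => [uT|]; last by move/sdim_transfer0->.
  by rewrite /sdim transfer_form_val //= big_ord0.
have := groth_map_sub transfer_classD (iso_class A) 0.
by rewrite h0 !subr0 transfer_classE.
Qed.

Lemma transferD : {morph transfer : x y / x + y}.
Proof.
move=> x y; elim/quotW: x => -[a b]; elim/quotW: y => -[a' b'].
rewrite -!/(groth_sub _) !groth_subB /= addrACA -opprD -!groth_inD.
rewrite /transfer !(groth_map_sub transfer_classD) !transfer_classD !groth_inD.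
by rewrite opprD addrACA.
Qed.

End Transfer.

Section Proj.
Variables (k : fieldType) (n : nat).

(* idealr_closed includes properness. *)
Record projPoint := ProjPoint {
  pp_ideal :> {pred {mpoly k[n.+1]}};
  pp_idealP : idealr_closed pp_ideal;
  pp_prime : prime_idealr_closed pp_ideal;
  pp_homog : forall d g, g \in pp_ideal -> pihomog mdeg d g \in pp_ideal;
  pp_relevant : exists i : 'I_n.+1, 'X_i \notin pp_ideal }.

(* The closure of {p} in Proj consists of the points q containing p. *)
Definition closed_point (p : projPoint) : Prop :=
  forall q : projPoint, {subset p <= q} -> q =i p.

(* A model of k(p), the field of fractions g / h with g and h homogeneous of the
   same degree and h not in p, modulo those with g in p. It is presented by
   homogeneous coordinates of p in rf_field: the first condition says that
   g / h |-> g(x) / h(x) is a well-defined embedding of k(p) into rf_field,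
   the second that it is onto. *)
Record residueField (p : projPoint) := ResidueField {
  rf_field :> fieldExtType k;
  rf_coord : 'I_n.+1 -> rf_field;
  rf_vanish : forall d g, g \is d.-homog ->
    (g \in p) = (mmap (in_alg rf_field) rf_coord g == 0);
  rf_onto : forall a : rf_field, exists d g h,
    [/\ g \is d.-homog, h \is d.-homog,
        mmap (in_alg rf_field) rf_coord h != 0 &
        a = mmap (in_alg rf_field) rf_coord g
            / mmap (in_alg rf_field) rf_coord h] }.

Definition in_chart (p : projPoint) (l : 'I_n.+1) : Prop := 'X_l \notin p.

(* In the chart U_l, the j-th affine coordinate (j < n) belongs to the
   homogeneous coordinate of index lift l j; for l > 0 the one of index 0
   carries the sign (-1) ^ l. *)
Definition chart_sign (R : pzRingType) (l i : 'I_n.+1) : R :=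
  if i == ord0 then (-1) ^+ l else 1.

Definition chart_coord (p : projPoint) (K : residueField p) (l : 'I_n.+1) :
    'I_n -> K :=
  fun j => chart_sign K l (lift l j) * (rf_coord K (lift l j) / rf_coord K l).

Definition dehomog (l : 'I_n.+1) (g : {mpoly k[n.+1]}) : {mpoly k[n]} :=
  g \mPo [tuple if unlift l i is Some j then chart_sign k l i *: 'X_j else 1
         | i < n.+1].

Definition gradient (p : projPoint) (K : residueField p) (l : 'I_n.+1)
    (g : {mpoly k[n.+1]}) : 'rV[K]_n :=
  \row_(j < n) mmap (in_alg K) (chart_coord K l) (dehomog l g)^`M(j).

Definition jacobian (f : 'I_n -> {mpoly k[n.+1]}) (p : projPoint)
    (K : residueField p) (l : 'I_n.+1) : K :=
  \det (\matrix_(i < n, j < n) gradient K l (f i) 0 j).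

(* T_p g, as the row space of a matrix, in T_p P^n identified with K^n through
   the chart U_l. *)
Definition tangent (p : projPoint) (K : residueField p) (l : 'I_n.+1)
    (g : {mpoly k[n.+1]}) : 'M[K]_n :=
  kermx (gradient K l g)^T.

Definition codim (K : fieldType) (V : 'M[K]_n) : nat := (n - \rank V)%N.

(* The Jacobian criterion over k(p); it agrees with regularity of the
   hypersurface at p when k is perfect. *)
Definition smooth_at (p : projPoint) (K : residueField p) (l : 'I_n.+1)
    (g : {mpoly k[n.+1]}) : Prop :=
  gradient K l g != 0.

Definition transverse_at (f : 'I_n -> {mpoly k[n.+1]}) (p : projPoint)
    (K : residueField p) (l : 'I_n.+1) : Prop :=
  (forall i, smooth_at K l (f i)) /\
  codim (\bigcap_(i < n) tangent K l (f i))%MS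
  = (\sum_(i < n) codim (tangent K l (f i)))%N.

Definition intersection_point (f : 'I_n -> {mpoly k[n.+1]}) (p : projPoint) :
    Prop :=
  closed_point p /\ forall i, f i \in p.

(* Points are identified when their ideals have the same elements. *)
Definition enumerates (N : nat) (pt : 'I_N -> projPoint)
    (P : projPoint -> Prop) : Prop :=
  [/\ forall i, P (pt i),
      forall i j, pt i =i pt j -> i = j
    & forall q, P q -> exists i, q =i pt i].

End Proj.

(* Main.v *)
(* Write [S = k[x_0, ..., x_n]] and [sum (d_i - 1) = 2 m + 1], which is possible
   by the parity condition, and choose a form [h] of large degree [e > m] that
   vanishes at no point of intersection. Then [f_1, ..., f_n, h] is a regular
   sequence, so that the Hilbert function of [A = S / (f_1, ..., f_n)] is given by
   the partial sums of the coefficients of [prod (1 + X + ... + X^(d_i - 1))]: it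
   is eventually [d_1 ... d_n], and half of that in degree [m] by symmetry. By
   transversality a form belongs to the ideal [(f_1, ..., f_n)] once it vanishes at
   all points, so [sum_p [k(p) : k] = d_1 ... d_n].

   Let [Delta(x, y)] be the Bezoutian of [h, f_1, ..., f_n], the determinant of
   their divided differences; it has degree [2 m + e], and [(g(x) - g(y)) Delta]
   lies in the ideal of the [f_i(x) - f_i(y)] and [h(x) - h(y)] for every [g].
   As in the theory of Scheja and Storch, contracting [Delta] with the trace form
   at the points of intersection (forms being made functions by dividing by powers
   of [h]) is multiplication by [J(p)]. For degree reasons the families [(w_p)]
   with [sum_p Tr(w_p g(p)) = 0] for all forms [g] of degree [m] are therefore
   isotropic for [sum_p Tr(J(p) w_p w'_p)]. They form a space of at least half the
   dimension, so that this form is metabolic, and hence equal to a multiple of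
   [H] in the Grothendieck-Witt group. The form is non-degenerate because
   [J(p) <> 0] forces [Tr] to be nonzero. *)
Require Import Defs.
From HB Require Import structures.
From mathcomp Require Import all_boot all_order all_algebra all_field.
From mathcomp Require Import mpoly ssrcomplements.
From mathcomp Require Import boolp.
From mathcomp Require classical_sets.
From mathcomp Require Import zify ring.

Set Implicit Arguments.
Unset Strict Implicit.
Unset Printing Implicit Defensive.

Import GRing.Theory.
Local Open Scope ring_scope.

(** Two generalities shape the argument. The field may be finite, so that no hyperplane need avoid
    the points of intersection; this is why [h] is taken of large degree [e]. Making forms into
    functions at a point [u] would then call for an [e]-th root of [h(u)], so only degrees congruent
    to [m] modulo [e] are kept, where none is needed. The field may also have characteristic 2,
    where a metabolic form need not be hyperbolic; an auxiliary summand, cancelled in the group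
    completion, removes the difference.

    A Bezoutian is also used locally, with a variable ['X_l] in place of [h]: at each point [p] it
    yields a form that is nonzero at [p] and multiplies the ideal of [p] into [(f)] up to powers of
    ['X_l]. From this come both the finiteness of the intersection, which the choice of [h]
    presupposes, and the fact that a form vanishing at all points lies in [(f)]. *)

Local Notation hc := (pihomog mdeg).

(** * Homogeneous components of polynomials *)

Section Components.
Variables (n : nat) (k : fieldType).
Implicit Types (a b g s t u v : {mpoly k[n]}).

Lemma hc_homog d s : hc d s \is d.-homog.
Proof. exact: pihomogP. Qed.

Lemma hc_id d s : s \is d.-homog -> hc d s = s.
Proof. exact: pihomog_dE. Qed.

Lemma hc_neq d e s : s \is e.-homog -> hc d s = if e == d then s else 0.
Proof.
by case: eqP => [->|/eqP ne] hs; [rewrite hc_id | rewrite (pihomog_ne0 ne)].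
Qed.

Lemma hc_sum N s : (msize s <= N)%N -> s = \sum_(d < N) hc d s.
Proof. exact: pihomog_partitionE. Qed.

Lemma hc_ge N s : (msize s <= N)%N -> hc N s = 0.
Proof.
move=> sN; rewrite pihomogE big_seq_cond big1 // => m /andP[ms /eqP md].
by have := msize_mdeg_lt ms; rewrite md ltnNge sN.
Qed.

Lemma hcM_homog e g d t : g \is e.-homog ->
  hc d (t * g) = if (e <= d)%N then hc (d - e) t * g else 0.
Proof.
move=> hg; set N := maxn (msize t) d.+1.
rewrite {1}(@hc_sum N t) ?leq_maxl // mulr_suml raddf_sum /=.
have hM (i : nat) : hc i t * g \is (i + e).-homog by rewrite dhomogM ?hc_homog.
case: leqP => [led|ltd]; last first.
  rewrite big1 // => i _; rewrite (hc_neq _ (hM i)).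
  by case: eqP => // E; move: ltd; rewrite -E ltnNge leq_addl.
have lt : (d - e < N)%N by rewrite (leq_ltn_trans (leq_subr _ _)) ?leq_maxr.
rewrite (bigD1 (Ordinal lt)) //= (hc_neq _ (hM _)) subnK // eqxx big1 ?addr0 //.
move=> i /negP ne; rewrite (hc_neq _ (hM i)); case: eqP => // E.
by case: ne; rewrite -val_eqE /= -E addnK.
Qed.

Lemma hcM N d u v : (d < N)%N ->
  hc d (u * v) = \sum_(i < N) if (i <= d)%N then hc i u * hc (d - i) v else 0.
Proof.
move=> dN; set M := maxn (msize u) N.
rewrite {1}(@hc_sum M u) ?leq_maxl // mulr_suml raddf_sum /=.
rewrite (big_ord_widen_cond M (fun _ => true)
  (fun i : nat => if (i <= d)%N then hc i u * hc (d - i) v else 0)) ?leq_maxr //=.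
rewrite [RHS]big_mkcond /=.
apply: eq_bigr => i _; rewrite mulrC (hcM_homog _ _ (hc_homog i u)).
rewrite mulrC; case: (ltnP i N) => // Ni.
by rewrite leqNgt (leq_trans dN Ni).
Qed.

Lemma mnm_split (m : 'X_{1..n}) N : (N <= mdeg m)%N ->
  exists m1 m2, [/\ mdeg m1 = N, mdeg m2 = (mdeg m - N)%N & m = (m1 + m2)%MM].
Proof.
elim: N => [|N IH] Nm.
  by exists 0%MM, m; rewrite mdeg0 subn0 add0m.
have [m1 [m2 [d1 d2 E]]] := IH (ltnW Nm).
have [i mi0] : exists i, m2 i != 0%N.
  have : (0 < mdeg m2)%N by rewrite d2 subn_gt0.
  rewrite mdegE lt0n sum_nat_eq0 negb_forall => /existsP[i].
  by exists i.
exists (m1 + U_(i))%MM, (m2 - U_(i))%MM.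
have le : (U_(i) <= m2)%MM by rewrite lep1mP.
have E2 : m2 = (U_(i) + (m2 - U_(i)))%MM by rewrite addmC submK.
split; first by rewrite mdegD mdeg1 d1 addn1.
  by rewrite subnS -d2 {2}E2 mdegD mdeg1.
by rewrite -addmA -E2.
Qed.

End Components.

(** * Homogeneous ideals *)

Section HomIdeal.
Variables (n : nat) (k : fieldType).
Local Notation S := {mpoly k[n]}.
Implicit Types (a b c g s t u v : S) (I J : S -> Prop).

(** Predicates in [Prop] let adjoined ideals, colon ideals and unions of chains be defined directly
    and compared by extensionality. The unit ideal is allowed, since adjoining and dividing can
    produce it. *)
Record homideal I : Prop := HomIdeal {
  hi0 : I 0;
  hiD : forall a b, I a -> I b -> I (a + b);
  hiM : forall c a, I a -> I (c * a);
  hiH : forall d a, I a -> I (hc d a) }.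

Section Theory.
Variable I : S -> Prop.
Hypothesis hI : homideal I.

Lemma hiMr c a : I a -> I (a * c).
Proof. by rewrite mulrC; apply: hiM. Qed.

Lemma hiN a : I a -> I (- a).
Proof. by rewrite -mulN1r; apply: hiM. Qed.

Lemma hiB a b : I a -> I b -> I (a - b).
Proof. by move=> ha hb; apply: hiD => //; apply: hiN. Qed.

Lemma hiZ (c : k) a : I a -> I (c *: a).
Proof. by rewrite -mul_mpolyC; apply: hiM. Qed.

Lemma hi_sum (T : Type) (r : seq T) (P : pred T) (F : T -> S) :
  (forall i, P i -> I (F i)) -> I (\sum_(i <- r | P i) F i).
Proof. by move=> h; apply: big_ind => //; [apply: hi0 | apply: hiD]. Qed.

Lemma hiE s : I s <-> forall d, I (hc d s).
Proof.
split=> [hs d|h]; first exact: hiH.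
by rewrite [s](@hc_sum _ _ (msize s)) //; apply: hi_sum.
Qed.

End Theory.

Definition adjoin I g : S -> Prop := fun s => exists t, I (s - t * g).
Definition colon I g : S -> Prop := fun s => I (s * g).
(** Some power of the irrelevant ideal lies in [I]; geometrically, [I] has no zero in projective
    space. *)
Definition cofin I : Prop := exists N, forall s, s \is N.-homog -> I s.

Lemma homog_mon d (m : 'X_{1..n}) : (('X_[m] : S) \is d.-homog) = (mdeg m == d).
Proof. exact: dhomogX. Qed.

Lemma homideal0 : homideal (fun s => s = 0).
Proof.
by split=> [|a b -> ->|c a ->|d a ->] //; rewrite ?addr0 ?mulr0 ?linear0.
Qed.

Lemma adjoin_homideal I e g : homideal I -> g \is e.-homog -> homideal (adjoin I g).
Proof.
move=> hI hg; split=> [|a b [t ht] [u hu]|c a [t ht]|d a [t ht]].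
- by exists 0; rewrite mul0r subrr; apply: hi0.
- by exists (t + u); rewrite mulrDl opprD addrACA; apply: hiD.
- by exists (c * t); rewrite -mulrA -mulrBr; apply: hiM.
exists (if (e <= d)%N then hc (d - e) t else 0).
have -> : (if (e <= d)%N then hc (d - e) t else 0) * g = hc d (t * g).
  by rewrite (hcM_homog _ _ hg); case: ifP => //; rewrite mul0r.
by rewrite -linearB; apply: hiH.
Qed.

Lemma adjoin_sub I g s : homideal I -> I s -> adjoin I g s.
Proof. by move=> hI Is; exists 0; rewrite mul0r subr0. Qed.

Lemma adjoin_gen I g : homideal I -> adjoin I g g.
Proof. by move=> hI; exists 1; rewrite mul1r subrr; apply: hi0. Qed.

Lemma colon_homideal I e g : homideal I -> g \is e.-homog -> homideal (colon I g).
Proof.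
move=> hI hg; split=> [|a b ha hb|c a ha|d a ha]; rewrite /colon.
- by rewrite mul0r; apply: hi0.
- by rewrite mulrDl; apply: hiD.
- by rewrite -mulrA; apply: hiM.
have := hcM_homog (d + e) a hg; rewrite leq_addl addnK => <-.
exact: hiH.
Qed.

Lemma adjoin_comm I a b : adjoin (adjoin I a) b = adjoin (adjoin I b) a.
Proof.
apply: funext => s; apply: propext.
split=> -[t [u h]]; exists u, t; move: h;
  by rewrite [_ - t * _ - u * _]addrAC.
Qed.

Lemma cofin_mono I J : (forall a, I a -> J a) -> cofin I -> cofin J.
Proof. by move=> IJ [N hN]; exists N => s /hN /IJ. Qed.

Lemma monomials_in I N : homideal I ->
  (forall m : 'X_{1..n}, mdeg m = N -> I 'X_[m]) -> 
  forall s, s \is N.-homog -> I s.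
Proof.
move=> hI hm s /dhomogP hs; rewrite [s]mpolyE big_seq.
by apply: hi_sum => // m /hs sm; apply: hiZ => //; apply: hm.
Qed.

Lemma cofin_ge I N M : homideal I -> (forall s, s \is N.-homog -> I s) ->
  (N <= M)%N -> forall s, s \is M.-homog -> I s.
Proof.
move=> hI hN NM; apply: monomials_in => // m dm.
have [|m1 [m2 [d1 d2 ->]]] := @mnm_split _ m N; first by rewrite dm.
by rewrite mpolyXD; apply: hiMr => //; apply: hN; rewrite homog_mon d1.
Qed.

Lemma cofin_pow I g d : homideal I -> g \is d.-homog -> (0 < d)%N -> cofin I ->
  exists r, I (g ^+ r).
Proof.
move=> hI hg d0 [N hN]; exists N; apply: (cofin_ge hI hN _ (dhomogMn _ hg)).
by rewrite leq_pmull.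
Qed.

(* Each of the two ideals contains a power of the irrelevant ideal, hence so
   does their product, which lies in [I + (a * b)]. *)
Lemma cofin_adjoinM I a b d e : homideal I ->
  a \is d.-homog -> b \is e.-homog ->
  cofin (adjoin I a) -> cofin (adjoin I b) -> cofin (adjoin I (a * b)).
Proof.
move=> hI ha hb [N hN] [M hM]; exists (N + M)%N.
have hab := adjoin_homideal hI (dhomogM ha hb).
apply: monomials_in => // m dm.
have [|m1 [m2 [d1 d2 ->]]] := @mnm_split _ m N; first by rewrite dm leq_addr.
rewrite mpolyXD.
have [|t ht] := hN 'X_[m1]; first by rewrite homog_mon d1.
have [|u hu] := hM 'X_[m2]; first by rewrite homog_mon d2 dm addKn.
exists (t * u).
have -> : 'X_[m1] * 'X_[m2] - t * u * (a * b)
  = ('X_[m1] - t * a) * 'X_[m2] + t * a * ('X_[m2] - u * b).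
  rewrite mulrBl mulrBr addrA subrK; congr (_ - _).
  by rewrite -!mulrA; congr (_ * _); rewrite mulrCA.
by apply: hiD => //; [apply: hiMr | apply: hiM].
Qed.

Definition homprime I : Prop :=
  forall a b d e, a \is d.-homog -> b \is e.-homog -> I (a * b) -> I a \/ I b.

(** Let the top components of [u] and [v] outside [I] have degrees [i] and [j]. In degree [i + j] of
    [u * v] every other product has a factor in [I], so the product of these two components is in
    [I] as well. *)
Lemma homprime_prime I : homideal I -> homprime I ->
  forall u v, I (u * v) -> I u \/ I v.
Proof.
move=> hI pI u v Iuv; apply: contrapT => /not_orP[nu nv].
have top w : ~ I w -> exists i, ~ I (hc i w) /\ forall j, (i < j)%N -> I (hc j w).
  move=> nw; have [i0 ni0] : exists i, ~ I (hc i w).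
    by apply: contrapT => /forallNP h; apply/nw/hiE => // i; apply: contrapT.
  have P0 : exists i, `[< ~ I (hc i w) >] by exists i0; apply/asboolP.
  have Pm i : `[< ~ I (hc i w) >] -> (i <= msize w)%N.
    move=> /asboolP ni; rewrite leqNgt; apply/negP => lt; apply: ni.
    by rewrite hc_ge ?(ltnW lt) //; apply: hi0.
  case: (ex_maxnP P0 Pm) => i /asboolP ni mx; exists i; split=> // j ij.
  apply: contrapT => nj; have := mx j; rewrite leqNgt ij => h.
  by have // := h _; have /asboolT /h := nj.
have [i [ni hi]] := top u nu; have [j [nj hj]] := top v nv.
suff : I (hc i u * hc j v).
  by move=> /(pI _ _ _ _ (hc_homog _ _) (hc_homog _ _)) [].
have := hiH hI (i + j) Iuv.
rewrite (hcM u v (ltnSn _)).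
have lt : (i < (i + j).+1)%N by rewrite ltnS leq_addr.
rewrite (bigD1 (Ordinal lt)) //= leq_addr addKn => h.
set x := _ * _ in h *; set y := \sum_(_ < _ | _) _ in h.
have -> : x = x + y - y by rewrite addrK.
apply: hiB => //; apply: hi_sum => // l /negP nl; case: leqP => // lij; last exact: hi0.
case: (ltngtP l i) => li; first 1 last.
- by apply: hiMr => //; apply: hi.
- by case: nl; rewrite -val_eqE /= li.
by apply: hiM => //; apply: hj; rewrite ltn_subRL ltn_add2r.
Qed.

End HomIdeal.

(** * Existence of closed points *)

Section Zorn.
Variables (n : nat) (k : fieldType).
Local Notation S := {mpoly k[n.+1]}.
Implicit Types (a b c g s t u v : S) (I J : S -> Prop).

Lemma pp_homideal (p : projPoint k n) : homideal (fun s => s \in p).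
Proof.
have [p0 p1 pM] := pp_idealP p.
split=> // [a b ha hb|c a ha|d a ha]; last exact: pp_homog.
  by have := pM 1 a b ha hb; rewrite mul1r.
by have := pM c a 0 ha p0; rewrite addr0.
Qed.

Lemma pp_prime_or (p : projPoint k n) u v : u * v \in p -> u \in p \/ v \in p.
Proof. by move=> /(pp_prime (p := p)) /orP. Qed.

Lemma pp_one (p : projPoint k n) : 1 \notin p.
Proof. by have [] := pp_idealP p. Qed.

Lemma pp_pow (p : projPoint k n) u r : u ^+ r \in p -> u \in p.
Proof.
elim: r => [|r IH]; first by rewrite expr0 (negPf (pp_one p)).
by rewrite exprS => /pp_prime_or[].
Qed.

Lemma homogX (i : 'I_n.+1) : ('X_i : S) \is 1.-homog.
Proof. by rewrite homog_mon mdeg1. Qed.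

Lemma pp_not_cofin (p : projPoint k n) : ~ cofin (fun s => s \in p).
Proof.
move=> /(cofin_pow (pp_homideal p) (homogX _)) cf.
by have [i /negP] := pp_relevant p; have [//|r /pp_pow] := cf i.
Qed.

(* A homogeneous ideal maximal among those containing no power of the
   irrelevant ideal is prime. *)
Lemma max_not_cofin_prime I : homideal I -> ~ cofin I ->
  (forall J, homideal J -> ~ cofin J -> (forall s, I s -> J s) ->
    forall s, J s -> I s) -> homprime I.
Proof.
move=> hI nI mx a b d e ha hb Iab; apply: contrapT => /not_orP[na nb].
have adj g f : g \is f.-homog -> ~ I g -> cofin (adjoin I g).
  move=> hg ng; apply: contrapT => nc; apply: ng.
  apply: (mx _ (adjoin_homideal hI hg) nc); last exact: adjoin_gen.
  by move=> s; apply: adjoin_sub.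
apply: nI; have := cofin_adjoinM hI ha hb (adj _ _ ha na) (adj _ _ hb nb).
apply: cofin_mono => s [t ht].
have -> : s = s - t * (a * b) + t * (a * b) by rewrite subrK.
by apply: hiD => //; apply: hiM.
Qed.

Lemma homideal_chain (F : (S -> Prop) -> Prop) I0 :
  F I0 -> (forall I, F I -> homideal I) ->
  (forall I J, F I -> F J -> (forall s, I s -> J s) \/ (forall s, J s -> I s)) ->
  homideal (fun s => exists2 I, F I & I s).
Proof.
move=> F0 hF tot; split=> [|a b [I FI Ia] [J FJ Jb]|c a [I FI Ia]|d a [I FI Ia]].
- by exists I0 => //; exact: hi0 (hF _ F0).
- by case: (tot _ _ FI FJ) => h; [exists J | exists I] => //; apply: hiD; auto.
- by exists I => //; apply: hiM => //; apply: hF.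
- by exists I => //; apply: hiH => //; apply: hF.
Qed.

(** Only finitely many monomials have degree [N]; each lies in a member of the chain, and the
    largest of these members contains them all. *)
Lemma chain_not_cofin (F : (S -> Prop) -> Prop) I0 :
  F I0 -> (forall I, F I -> homideal I) ->
  (forall I J, F I -> F J -> (forall s, I s -> J s) \/ (forall s, J s -> I s)) ->
  (forall I, F I -> ~ cofin I) ->
  ~ cofin (fun s => exists2 I, F I & I s).
Proof.
move=> F0 hF tot nF [N hN].
suff [I FI hI] : exists2 I, F I & forall m : 'X_{1..n.+1}, mdeg m = N -> I 'X_[m].
  by apply: (nF I FI); exists N; apply: monomials_in => //; apply: hF.
have key (r : seq 'X_{1..n.+1}) : all (fun m => mdeg m == N) r ->
    exists2 I, F I & forall m, m \in r -> I 'X_[m].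
  elim: r => [_|m r IH /= /andP[/eqP dm /IH[I FI hI]]]; first by exists I0.
  have [J FJ Jm] := hN 'X_[m] ltac:(by rewrite homog_mon dm).
  case: (tot _ _ FI FJ) => h; [exists J | exists I] => // m'; rewrite inE;
    move=> /predU1P[->|] //; auto.
pose ms := [seq m <- [seq bmnm m | m <- enum {: 'X_{1..n.+1 < N.+1} }] | mdeg m == N].
have [|I FI hI] := key ms; first exact: filter_all.
exists I => // m dm; apply: hI; rewrite mem_filter dm eqxx /=.
have lt : (mdeg m < N.+1)%N by rewrite dm.
by apply/mapP; exists (BMultinom lt); rewrite ?mem_enum.
Qed.

Lemma exists_max_not_cofin I : homideal I -> ~ cofin I ->
  exists M, [/\ homideal M, ~ cofin M, (forall s, I s -> M s) &
    forall J, homideal J -> ~ cofin J -> (forall s, M s -> J s) ->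
      forall s, J s -> M s].
Proof.
move=> hI nI.
pose P (J : S -> Prop) := [/\ homideal J, ~ cofin J & forall s, I s -> J s].
pose P' (J : S -> Prop) := J = (fun=> False) \/ P J.
have PI : P I by split.
have [F FP Ftot|M [PM mx]] := @classical_sets.Zorn_bigcup S P'.
  have [[J0 [FJ0 PJ0]]|no] := pselect (exists J, F J /\ P J); last first.
    left; apply: funext => s; apply: propext; split=> // -[J FJ Js].
    by case: (FP J FJ) => [J0|PJ]; [rewrite J0 in Js | case: no; exists J].
  right.
  pose G (J : S -> Prop) := F J /\ P J.
  have -> : classical_sets.bigcup F (fun X => X) = (fun s => exists2 J, G J & J s).
    apply: funext => s; apply: propext; split=> [[J FJ Js]|[J [FJ PJ] Js]].
      exists J => //; split=> //; case: (FP J FJ) => // JE.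
      by rewrite JE in Js.
    by exists J.
  have hG J : G J -> homideal J by move=> [_ []].
  have tot J K : G J -> G K -> (forall s, J s -> K s) \/ (forall s, K s -> J s).
    by move=> [FJ _] [FK _]; apply: Ftot.
  split.
  - by apply: (homideal_chain (I0 := J0)).
  - by apply: (chain_not_cofin (I0 := J0)) => // J [_ []].
  - by move=> s Is; exists J0 => //; case: PJ0 => _ _; apply.
have {PM} [hM nM IM] : P M.
  case: PM => // M0; exfalso; apply: (mx I); last by right.
  rewrite M0; split=> // h; apply: (h 0); exact: hi0.
exists M; split=> // J hJ nJ MJ s Js; apply: contrapT => nMs.
apply: (mx J); last by right; split=> // t /IM /MJ.
by split=> // h; apply/nMs/h.
Qed.

Lemma homprime_projPoint I : homideal I -> ~ cofin I -> homprime I ->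
  exists p : projPoint k n, forall s, (s \in p) <-> I s.
Proof.
move=> hI nI pI.
pose pr : {pred S} := fun s => `[< I s >].
have prE s : (s \in pr) <-> I s by split=> /asboolP.
have I1 : ~ I 1.
  move=> I1; apply: nI; exists 0%N => s _; rewrite -[s]mulr1; exact: hiM.
have pr_id : idealr_closed pr.
  split; [by apply/prE; apply: hi0 | by apply/negP => /prE|].
  move=> a u v /prE hu /prE hv; apply/prE; apply: hiD => //; exact: hiM.
have pr_pr : prime_idealr_closed pr.
  move=> u v /prE /(homprime_prime hI pI) [] h; apply/orP; [left|right]; exact/prE.
have pr_h d g : g \in pr -> pihomog mdeg d g \in pr.
  by move=> /prE h; apply/prE; apply: hiH.
have pr_r : exists i : 'I_n.+1, 'X_i \notin pr.
  apply: contrapT => /forallNP no; apply: nI; exists 1%N.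
  apply: monomials_in => // m /eqP; rewrite mdeg_eq1 => /existsP[i /eqP ->].
  apply/prE; apply: contrapT => /negP; exact: no.
by exists (ProjPoint pr_id pr_pr pr_h pr_r).
Qed.

Lemma exists_closed_point I : homideal I -> ~ cofin I ->
  exists p : projPoint k n, closed_point p /\ forall s, I s -> s \in p.
Proof.
move=> hI nI; have [M [hM nM IM mx]] := exists_max_not_cofin hI nI.
have [p pE] := homprime_projPoint hM nM (max_not_cofin_prime hM nM mx).
exists p; split=> [q pq s|s /IM /pE //].
apply/idP/idP => [sq|/pq //]; apply/pE.
apply: (mx (fun s => s \in q)) sq; [exact: pp_homideal|exact: pp_not_cofin|].
by move=> t /pE /pq.
Qed.

(** This takes the place of the projective Nullstellensatz; it holds over any field because points
    are prime ideals rather than tuples of coordinates. *)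
Lemma cofinP I : homideal I ->
  (forall p : projPoint k n, closed_point p -> (forall s, I s -> s \in p) -> False) ->
  cofin I.
Proof.
move=> hI h; apply: contrapT => /(exists_closed_point hI) [p [cp Ip]].
exact: h cp Ip.
Qed.

(** A point containing both [p] and [g] would equal [p], as [p] is closed. Inverses and finiteness
    of the residue field both come from here. *)
Lemma closed_adjoin_cofin (p : projPoint k n) e g : closed_point p ->
  g \is e.-homog -> g \notin p -> cofin (adjoin (fun s => s \in p) g).
Proof.
move=> cp hg ng; have hp := pp_homideal p.
apply: (cofinP (adjoin_homideal hp hg)) => q _ hq.
have /cp qp : {subset p <= q} by move=> s sp; apply: hq; apply: adjoin_sub.
by move: ng; rewrite -qp hq //; apply: adjoin_gen.
Qed.

End Zorn.

(** * Hilbert functions and regular sequences *)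

(** A subspace of maximal dimension inside [P] cannot grow when a vector of [P] is added to it. *)
Lemma subspace_vspace (k : fieldType) (V : vectType k) (P : V -> Prop) :
  P 0 -> (forall (c : k) u v, P u -> P v -> P (c *: u + v)) ->
  exists U : {vspace V}, forall v, (v \in U) <-> P v.
Proof.
move=> P0 PL; pose Q (U : {vspace V}) := forall v, v \in U -> P v.
have ex : exists d, `[< exists2 U, Q U & \dim U = d >].
  exists 0%N; apply/asboolP; exists 0%VS; last exact: dimv0.
  by move=> v; rewrite memv0 => /eqP ->.
have bd d : `[< exists2 U, Q U & \dim U = d >] -> (d <= \dim {:V})%N.
  by move=> /asboolP[U _ <-]; apply: dimvS; apply: subvf.
case: (ex_maxnP ex bd) => d /asboolP[U QU dU] mx.
exists U => v; split=> [/QU //|Pv].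
have QU' : Q (U + <[v]>)%VS.
  move=> w /memv_addP[u uU [_ /vlineP[c ->] ->]].
  by rewrite addrC; apply: PL => //; apply: QU.
have := mx (\dim (U + <[v]>)%VS) (asboolT (ex_intro2 _ _ _ QU' erefl)).
rewrite -dU => le.
have /eqP -> : U == (U + <[v]>)%VS by rewrite eqEdim addvSl le.
by apply: (subvP (addvSr _ _)); apply: memv_line.
Qed.

Section Hilbert.
Variables (n : nat) (k : fieldType).
Local Notation S := {mpoly k[n.+1]}.
Local Notation SV d := (dhomog n.+1 k d).
Implicit Types (a b g s t : S) (I J : S -> Prop).

Definition hpart I d : {vspace SV d} :=
  match pselect (exists U : {vspace SV d}, forall v, (v \in U) <-> I (v : S)) with
  | left h => sval (cid h)
  | right _ => 0%VS
  end.

Lemma mem_hpart I (hI : homideal I) d (v : SV d) : (v \in hpart I d) <-> I (v : S).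
Proof.
rewrite /hpart; case: pselect => [h|[]]; first by case: (cid h).
apply: subspace_vspace => [|c u w hu hw]; first by rewrite linear0; apply: hi0.
by rewrite linearP /=; apply: hiD => //; apply: hiZ.
Qed.

Definition hilb I d : nat := (\dim {:SV d} - \dim (hpart I d))%N.

Lemma hilbE I d : (hilb I d + \dim (hpart I d) = \dim {:SV d})%N.
Proof. by rewrite subnK // dimvS // subvf. Qed.

Lemma hpart_sub I J d : homideal I -> homideal J -> (forall s, I s -> J s) ->
  (hpart I d <= hpart J d)%VS.
Proof. by move=> hI hJ IJ; apply/subvP => v /(mem_hpart hI)/IJ/(mem_hpart hJ). Qed.

Definition mkH d s (hs : s \is d.-homog) : SV d := DHomog hs.

Lemma hilb_eq0 I d : homideal I ->
  hilb I d = 0%N <-> (forall s, s \is d.-homog -> I s).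
Proof.
move=> hI; split=> [h s hs|h].
  suff /(mem_hpart hI) : mkH hs \in hpart I d by [].
  have /eqP -> : hpart I d == fullv by rewrite eqEdim subvf /= -(hilbE I d) h add0n.
  exact: memvf.
suff E : hpart I d = fullv by rewrite /hilb E subnn.
apply/eqP; rewrite eqEsubv subvf; apply/subvP => v _.
by apply/(mem_hpart hI); apply/h/dhomog_is_dhomog.
Qed.

Lemma hilb_mono I J d : homideal I -> homideal J -> (forall s, I s -> J s) ->
  (hilb J d <= hilb I d)%N.
Proof. by move=> hI hJ IJ; rewrite leq_sub2l // dimvS // hpart_sub. Qed.

Lemma hilb_eq I J d : homideal I -> homideal J -> (forall s, I s -> J s) ->
  hilb I d = hilb J d -> forall s, s \is d.-homog -> J s -> I s.
Proof.
move=> hI hJ IJ e s hs Js.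
have dE : \dim (hpart I d) = \dim (hpart J d).
  by have := hilbE I d; rewrite -(hilbE J d) e => /addnI.
have /eqP E : hpart I d == hpart J d by rewrite eqEdim hpart_sub //= dE.
suff : mkH hs \in hpart I d by move/(mem_hpart hI).
by rewrite E; apply/(mem_hpart hJ).
Qed.

Section Mult.
Variables (g : S) (e d : nat) (hg : g \is e.-homog).

Fact mulH_proof (v : SV d) : (v : S) * g \is (d + e).-homog.
Proof. by apply: dhomogM => //; apply: dhomog_is_dhomog. Qed.
Definition mulH (v : SV d) : SV (d + e) := mkH (mulH_proof v).

Fact mulH_linear : linear mulH.
Proof.
move=> c u v; apply: val_inj => /=.
by rewrite mulrDl -scalerAl.
Qed.
HB.instance Definition _ := GRing.isLinear.Build k (SV d) (SV (d + e)) _ mulH mulH_linear.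
End Mult.

(** As the preimage of [U], [X] contains the kernel of [f], and its image is the intersection of [U]
    with the image of [f]. *)
Lemma dim_imgD (aT rT : vectType k) (f : 'Hom(aT, rT)) (U : {vspace rT}) (X : {vspace aT}) :
  (forall v, (v \in X) = (f v \in U)) ->
  (\dim (U + limg f) + \dim X = \dim U + \dim {:aT})%N.
Proof.
move=> hX.
have kX : (lker f <= X)%VS by apply/subvP => v; rewrite memv_ker hX => /eqP ->; apply: mem0v.
have E : (U :&: limg f)%VS = (f @: X)%VS.
  apply/vspaceP => w; rewrite memv_cap; apply/andP/idP.
    move=> [wU /memv_imgP[v _ wE]]; rewrite wE; apply: memv_img.
    by rewrite hX -wE.
  move=> /memv_imgP[v vX ->]; rewrite -hX vX; split=> //.
  by apply: memv_img; apply: memvf.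
have h1 := dimv_sum_cap U (limg f).
have h2 := limg_ker_dim f X; have h3 := limg_ker_dim f fullv.
rewrite E in h1; rewrite (capv_idPr kX) in h2.
have kF : (lker f <= fullv)%VS by apply: subvf.
rewrite (capv_idPr kF) in h3.
by rewrite -h2 -h3 addnCA addnA [X in (X + _)%N]addnC -addnA; lia.
Qed.

(** Exactness of [0 -> S/(I : g) -> S/I -> S/(I + (g)) -> 0], where the first map is multiplication
    by [g] and raises degrees by [e]. *)
Lemma hilb_adjoin I g e d : homideal I -> g \is e.-homog ->
  hilb I (d + e) = (hilb (adjoin I g) (d + e) + hilb (colon I g) d)%N.
Proof.
move=> hI hg; have hA := adjoin_homideal hI hg; have hC := colon_homideal hI hg.
have E : hpart (adjoin I g) (d + e) = (hpart I (d + e) + limg (linfun (@mulH g e d hg)))%VS.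
  apply/vspaceP => w; apply/idP/memv_addP.
    move=> /(mem_hpart hA) [t ht].
    have w_h := dhomog_is_dhomog w.
    have := hiH hI (d + e) ht; rewrite linearB /= hc_id //.
    rewrite (hcM_homog _ _ hg) leq_addl addnK => ht'.
    set v := mkH (hc_homog d t).
    exists (w - mulH hg v).
      by apply/(mem_hpart hI); rewrite linearB.
    exists (mulH hg v); last by rewrite subrK.
    by rewrite -lfunE; apply: memv_img; apply: memvf.
  move=> [u /(mem_hpart hI) Iu [_ /memv_imgP[v _ ->] ->]].
  apply/(mem_hpart hA); rewrite lfunE linearD /=.
  by exists v; rewrite addrK.
have := @dim_imgD _ _ (linfun (@mulH g e d hg)) (hpart I (d + e)) (hpart (colon I g) d).
rewrite -E => /(_ _)/wrap[].
  move=> v; rewrite lfunE /=; apply/idP/idP.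
    by move=> /(mem_hpart hC) h; apply/(mem_hpart hI).
  by move=> /(mem_hpart hI) h; apply/(mem_hpart hC).
have := hilbE I (d + e); have := hilbE (adjoin I g) (d + e); have := hilbE (colon I g) d.
move: (hilb _ _) (hilb _ _) (hilb _ _) (\dim _) (\dim _) (\dim _) (\dim _) (\dim _).
lia.
Qed.

Lemma hilb_adjoin_lt I g e d : homideal I -> g \is e.-homog -> (d < e)%N ->
  hilb (adjoin I g) d = hilb I d.
Proof.
move=> hI hg de; rewrite /hilb; congr (_ - \dim _)%N.
have hA := adjoin_homideal hI hg.
apply/vspaceP => w; apply/idP/idP => [/(mem_hpart hA) [t ht]|/(mem_hpart hI) h].
  apply/(mem_hpart hI); have := hiH hI d ht.
  rewrite linearB /= (hcM_homog _ _ hg) leqNgt de /= subr0.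
  by rewrite hc_id //; apply: dhomog_is_dhomog.
by apply/(mem_hpart hA); apply: adjoin_sub.
Qed.

End Hilbert.

(** * Regular sequences of forms *)

Section Regular.
Variables (n : nat) (k : fieldType).
Local Notation S := {mpoly k[n.+1]}.
Implicit Types (a b g s t : S) (I J : S -> Prop) (r : seq S).

Definition nzd I g : Prop := forall s, I (s * g) -> I s.
Definition pform g : Prop := exists2 e, (0 < e)%N & g \is e.-homog.

Fixpoint regular I r : Prop :=
  if r is g :: r' then nzd I g /\ regular (adjoin I g) r' else True.

Definition adjoins I r : S -> Prop := foldl (@adjoin n.+1 k) I r.

Fixpoint forms r : Prop := if r is g :: r' then pform g /\ forms r' else True.

Lemma forms_cat r1 r2 : forms (r1 ++ r2) <-> forms r1 /\ forms r2.
Proof. by elim: r1 => [|g r1 IH] /=; [split=> [|[]] | rewrite IH; tauto]. Qed.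

Lemma pform_adjoin I g : homideal I -> pform g -> homideal (adjoin I g).
Proof. by move=> hI [e _ hg]; apply: adjoin_homideal hg. Qed.

Lemma adjoins_homideal I r : homideal I -> forms r -> homideal (adjoins I r).
Proof.
by elim: r I => [|g r IH] I hI //= [hg hr]; apply: IH => //; apply: pform_adjoin.
Qed.

Lemma adjoins_sub I r s : homideal I -> forms r -> I s -> adjoins I r s.
Proof.
elim: r I => [|g r IH] I hI //= [hg hr] Is.
by apply: IH => //; [apply: pform_adjoin | apply: adjoin_sub].
Qed.

Lemma adjoins_gen I r g : homideal I -> forms r -> g \in r -> adjoins I r g.
Proof.
elim: r I => [|h r IH] I hI //= [hh hr]; have hA := pform_adjoin hI hh.
rewrite inE => /predU1P[->|]; last exact: IH.
by apply: adjoins_sub => //; apply: adjoin_gen.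
Qed.

Lemma adjoins_min I J r : homideal J -> (forall s, I s -> J s) ->
  (forall g, g \in r -> J g) -> forall s, adjoins I r s -> J s.
Proof.
move=> hJ; elim: r I => [|g r IH] I //= IJ hr; apply: IH.
  move=> s [t /IJ h]; rewrite -[s](subrK (t * g)); apply: hiD => //.
  by apply: hiM => //; apply: hr; rewrite mem_head.
by move=> h rh; apply: hr; rewrite inE rh orbT.
Qed.

Lemma adjoins_cat I r1 r2 : adjoins I (r1 ++ r2) = adjoins (adjoins I r1) r2.
Proof. by rewrite /adjoins foldl_cat. Qed.

Lemma regular_cat I r1 r2 :
  regular I (r1 ++ r2) <-> regular I r1 /\ regular (adjoins I r1) r2.
Proof. by elim: r1 I => [|g r IH] I /=; [tauto | rewrite IH; tauto]. Qed.

Lemma adjoins_front I r g : adjoins I (rcons r g) = adjoins (adjoin I g) r.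
Proof.
elim: r I => [|h r IH] I //=; first by rewrite IH adjoin_comm.
Qed.

Lemma nzd_colon I g : homideal I -> nzd I g -> colon I g = I.
Proof.
move=> hI ng; apply: funext => s; apply: propext; split; first exact: ng.
by move=> Is; apply: hiMr.
Qed.

Lemma homog_induct I e g : homideal I -> g \is e.-homog ->
  (forall d s, s \is d.-homog -> I (s * g) -> I s) -> nzd I g.
Proof.
move=> hI hg h s Isg; apply/(hiE hI) => d; apply: (h d); first exact: hc_homog.
by have := hiH hI (d + e) Isg; rewrite (hcM_homog _ _ hg) leq_addl addnK.
Qed.

(** This rests on the grading. If [s * b] is in [I], then [s = t * a] modulo [I] since [b] is
    regular modulo [I + (a)]; as [a] is regular, [t * b] is again in [I], and [t] has smaller
    degree, so induction applies. *)
Lemma regular_swap I a b r : homideal I -> pform a -> pform b ->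
  regular I (a :: b :: r) -> regular I (b :: a :: r).
Proof.
move=> hI [d d0 ha] [e e0 hb] /= [na [nb hr]]; rewrite adjoin_comm; split; last split => //.
  apply: (homog_induct hI hb) => i; elim/ltn_ind: i => i IH s hs Isb.
  have [t Ist] := nb s (adjoin_sub _ hI Isb).
  have := hiH hI i Ist; rewrite linearB /= (hc_id hs) (hcM_homog _ _ ha).
  case: leqP => di Is; last by rewrite subr0 in Is.
  have It : I (hc (i - d) t).
    apply: (IH (i - d)%N); [lia | exact: hc_homog |].
    apply: na; rewrite -[_ * _ * a]opprK -[X in I (- X)]subr0.
    have -> : - (- (hc (i - d) t * b * a) - 0) = s * b - (s - hc (i - d) t * a) * b by ring.
    by apply: hiB => //; apply: hiMr.
  by rewrite -[s](subrK (hc (i - d) t * a)); apply: hiD => //; apply: hiMr.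
move=> s [t Ist]; have /nb [u Iu] : adjoin I a (t * b).
  by exists s; rewrite -opprB; apply: hiN.
exists u; apply: na.
have -> : (s - u * b) * a = s * a - t * b + (t - u * a) * b by ring.
by apply: hiD => //; apply: hiMr.
Qed.

Lemma regular_front I r a r' : homideal I -> pform a -> forms r ->
  regular I (r ++ a :: r') <-> regular I (a :: r ++ r').
Proof.
move=> hI ha; elim: r I hI => [|b r IH] I hI /=; first by [].
move=> [hb hr]; have hIb := pform_adjoin hI hb; split.
  by move=> [nb /(IH _ hIb hr) h]; apply: regular_swap.
by move=> /(regular_swap hI ha hb) [nb h]; split=> //; apply/(IH _ hIb hr).
Qed.

(** Passing through the front of the list moves [a] to the end, where its condition separates from
    the others. *)
Lemma regular_back I r a r' : homideal I -> pform a -> forms r -> forms r' ->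
  regular I (r ++ a :: r') <-> regular I (r ++ r') /\ nzd (adjoins I (r ++ r')) a.
Proof.
move=> hI ha hr hr'; rewrite regular_front //.
have hrr : forms (r ++ r') by apply/forms_cat.
have := regular_front [::] hI ha hrr; rewrite !cats0 => <-.
by rewrite regular_cat /=; tauto.
Qed.

Lemma cofin_hilb I : homideal I -> cofin I ->
  exists N, forall d, (N <= d)%N -> hilb I d = 0%N.
Proof.
by move=> hI [N hN]; exists N => d Nd; apply/hilb_eq0 => //; apply: cofin_ge hN Nd.
Qed.

(* Eventually the Hilbert function of [I] is periodic, as [a] is regular, and
   multiplication by [b] is onto; so it is bijective for dimension reasons. *)
Lemma nzd_exchange I a b : homideal I -> pform a -> pform b ->
  cofin (adjoin I a) -> cofin (adjoin I b) -> nzd I a -> nzd I b.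
Proof.
move=> hI [d d0 ha] [e e0 hb] ca cb na.
have [N hN] := cofin_hilb (adjoin_homideal hI ha) ca.
have [M hM] := cofin_hilb (adjoin_homideal hI hb) cb.
pose H := hilb I.
have Ha D : (maxn N M <= D)%N -> H (D + d)%N = H D.
  move=> hD; rewrite /H (hilb_adjoin _ hI ha) hN ?nzd_colon //.
  by rewrite geq_max in hD; move: hD => /andP[hD _]; lia.
have Hb D : (maxn N M <= D)%N -> H (D + e)%N = hilb (colon I b) D.
  move=> hD; rewrite /H (hilb_adjoin _ hI hb) hM //.
  by rewrite geq_max in hD; move: hD => /andP[_ hD]; lia.
have Hb' D : (maxn N M <= D)%N -> (H (D + e) <= H D)%N.
  move=> hD; rewrite Hb //; apply: hilb_mono => //; first exact: colon_homideal hb.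
  by move=> s Is; apply: hiMr.
have Har D (r : nat) : (maxn N M <= D)%N -> H (D + d * r)%N = H D.
  move=> hD; elim: r => [|r IH]; first by rewrite muln0 addn0.
  by rewrite mulnS [(d + _)%N]addnC addnA Ha ?IH // (leq_trans hD) ?leq_addr.
have Hbr D (r : nat) : (maxn N M <= D)%N -> (H (D + e * r) <= H D)%N.
  move=> hD; elim: r => [|r IH]; first by rewrite muln0 addn0.
  rewrite mulnS [(e + _)%N]addnC addnA (leq_trans _ IH) // Hb' //.
  by rewrite (leq_trans hD) ?leq_addr.
have key D s : (maxn N M <= D)%N -> s \is D.-homog -> I (s * b) -> I s.
  move=> hD hs Isb; apply: (hilb_eq hI (colon_homideal hI hb) _ _ hs Isb).
    by move=> t It; apply: hiMr.
  (* For the converse inequality, [H D = H (D + d * e)], and [D + d * e] is reached from [D + e] by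
     [d - 1] more steps of length [e], none of which increases [H]. *)
  rewrite -Hb //; apply/eqP; rewrite eqn_leq Hb' // andbT -/(H D).
  rewrite -(Har D e) // mulnC -{1}(prednK d0) mulnS addnA.
  by apply: Hbr; rewrite (leq_trans hD) ?leq_addr.
have nar s (r : nat) : I (s * a ^+ r) -> I s.
  by elim: r => [|r IH]; rewrite ?expr0 ?mulr1 // exprSr mulrA => /na /IH.
apply: (homog_induct hI hb) => i s hs Isb.
(* A power of [a] lifts [s] into the stable range of degrees and is cancelled afterwards. *)
apply: (@nar s (maxn N M)); apply: (key (i + d * maxn N M)%N).
- by rewrite (leq_trans _ (leq_addl _ _)) // leq_pmull.
- exact/dhomogM/dhomogMn.
by rewrite mulrAC; apply: hiMr.
Qed.

End Regular.

(** * Closed points *)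

Section Points.
Variables (n : nat) (k : fieldType).
Local Notation S := {mpoly k[n.+1]}.
(* Points are handled through the characteristic functions of their ideals:
   [projPoint] itself lives in too large a universe to be an [eqType]. *)
Local Notation point := (S -> bool).
Implicit Types (a b g s t : S) (I J : S -> Prop) (p q : point) (ps : seq point).

Definition pid (p : projPoint k n) : point := fun s => s \in p.

Definition closedp (p : point) : Prop :=
  exists2 P : projPoint k n, closed_point P & p = pid P.

Lemma pidE (P Q : projPoint k n) : P =i Q -> pid P = pid Q.
Proof. by move=> PQ; apply: funext => s; apply: PQ. Qed.

Lemma cl_homideal p : closedp p -> homideal (fun s => p s).
Proof. by move=> [P _ ->]; exact: pp_homideal. Qed.

Lemma cl_prime p u v : closedp p -> p (u * v) -> p u \/ p v.
Proof. by move=> [P _ ->]; exact: pp_prime_or. Qed.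

Lemma cl_pow p u r : closedp p -> p (u ^+ r) -> p u.
Proof. by move=> [P _ ->]; exact: pp_pow. Qed.

Lemma cl_one p : closedp p -> ~~ p 1.
Proof. by move=> [P _ ->]; exact: pp_one. Qed.

Lemma cl_chart p : closedp p -> exists l : 'I_n.+1, ~~ p 'X_l.
Proof. by move=> [P _ ->]; exact: pp_relevant. Qed.

Lemma cl_max p q : closedp p -> closedp q -> (forall s, p s -> q s) -> p = q.
Proof. by move=> [P cP ->] [Q _ ->] h; apply/pidE => s; rewrite (cP Q). Qed.

Lemma cl_cofin I : homideal I ->
  (forall p, closedp p -> (forall s, I s -> p s) -> False) -> cofin I.
Proof.
by move=> hI h; apply: (cofinP hI) => P cP; apply: (h (pid P)); exists P.
Qed.

Lemma closed_not_sub p q : closedp p -> closedp q -> p != q -> exists d s,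
  [/\ s \is d.-homog, p s & ~~ q s].
Proof.
move=> cp cq pq; apply: contrapT => no; case/negP: pq; apply/eqP.
apply: cl_max => // s sp; apply/(hiE (cl_homideal cq)) => d.
apply: contrapT => /negP nsq; apply: no; exists d, (hc d s).
by split=> //; [exact: hc_homog | exact: (hiH (cl_homideal cp))].
Qed.

(** Multiply, over all [q] in [ps], forms that vanish at [q] but not at [p]; a variable nonzero at
    [p] then raises the degree, so that a single degree can serve for all points. *)
Lemma separating_form p ps : closedp p -> (forall q, q \in ps -> closedp q) ->
  p \notin ps -> exists N, forall M, (N <= M)%N -> exists g,
    [/\ g \is M.-homog, ~~ p g & forall q, q \in ps -> q g].
Proof.
move=> cp cps pps.
have [d [g [hg gp gps]]] : exists d g, [/\ g \is d.-homog, ~~ p g &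
    forall q, q \in ps -> q g].
  elim: ps cps pps => [|q ps IH] cps.
    by exists 0%N, 1; split=> //; [exact: dhomog1 | exact: cl_one].
  rewrite inE negb_or => /andP[pq pps].
  have [|e [g [hg gp gps]]] := IH _ pps.
    by move=> r rps; apply: cps; rewrite inE rps orbT.
  have cq := cps q (mem_head _ _).
  have [|d [s [hs sq sp]]] := closed_not_sub cq cp; first by rewrite eq_sym.
  exists (d + e)%N, (s * g); split; first exact: dhomogM.
    by apply/negP => /(cl_prime cp)[]; apply/negP.
  move=> r rps; have hr := cl_homideal (cps r rps).
  move: rps; rewrite inE => /predU1P[E|rps].
    by apply: (hiMr hr); rewrite E.
  by apply: (hiM hr); exact: gps.
have [l lp] := cl_chart cp.
exists d => M dM; exists (g * 'X_l ^+ (M - d)); split.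
- rewrite -{2}(subnKC dM); apply: dhomogM => //.
  by have := dhomogMn (M - d) (homogX k l); rewrite mul1n.
- by apply/negP => /(cl_prime cp)[|/(cl_pow cp)]; apply/negP.
by move=> q qps; apply: (hiMr (cl_homideal (cps q qps))); exact: gps.
Qed.

Lemma separating_forms ps : (forall q, q \in ps -> closedp q) ->
  exists N, forall M, (N <= M)%N -> forall p, p \in ps -> exists g,
    [/\ g \is M.-homog, ~~ p g & forall q, q \in ps -> q != p -> q g].
Proof.
move=> cps.
suff key (qs : seq point) : {subset qs <= ps} -> exists N, forall M, (N <= M)%N ->
    forall p, p \in qs -> exists g, [/\ g \is M.-homog, ~~ p g &
      forall q, q \in ps -> q != p -> q g] by apply: key.
elim: qs => [|p qs IH] sub; first by exists 0%N.
have [|N hN] := IH; first by move=> r rqs; apply: sub; rewrite inE rqs orbT.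
have [|||N' hN'] := @separating_form p [seq q <- ps | q != p].
- by apply/cps/sub/mem_head.
- by move=> q; rewrite mem_filter => /andP[_ /cps].
- by rewrite mem_filter eqxx.
exists (maxn N N') => M; rewrite geq_max => /andP[NM N'M] r.
rewrite inE => /predU1P[->|]; last exact: hN.
have [g [hg gp gq]] := hN' M N'M; exists g; split=> // q qps qp.
by apply: gq; rewrite mem_filter qp.
Qed.

(** At each point exactly one of the separating forms is nonzero, so their sum vanishes at none. No
    scalar is chosen generically, hence [k] may be finite. *)
Lemma avoiding_form ps : (forall q, q \in ps -> closedp q) ->
  exists N, forall M, (N <= M)%N ->
    exists2 g, g \is M.-homog & forall p, p \in ps -> ~~ p g.
Proof.
move=> cps.
have [|N hN] := @separating_forms (undup ps); first by move=> q; rewrite mem_undup => /cps.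
exists N => M NM.
have [sf hs] : {sf : point -> S | forall p, p \in ps -> [/\ sf p \is M.-homog,
    ~~ p (sf p) & forall q, q \in ps -> q != p -> q (sf p)]}.
  have ex p : exists g, p \in ps -> [/\ g \is M.-homog, ~~ p g &
      forall q, q \in ps -> q != p -> q g].
    have [pps|_] := boolP (p \in ps); last by exists 0.
    have [|g [hg gp gq]] := hN M NM p; first by rewrite mem_undup.
    by exists g => _; split=> // q qps; apply: gq; rewrite mem_undup.
  by exists (fun p => sval (cid (ex p))) => p; exact: (svalP (cid (ex p))).
exists (\sum_(p <- undup ps) sf p).
  by rewrite big_seq; apply: rpred_sum => p; rewrite mem_undup => /hs[].
move=> p pps; have hp := cl_homideal (cps p pps); have [_ np _] := hs p pps.
rewrite (bigD1_seq p) ?undup_uniq ?mem_undup //=.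
apply: contra np => h; rewrite -[sf p](addrK (\sum_(q <- undup ps | q != p) sf q)).
apply: (hiB hp h); rewrite big_seq_cond; apply: (hi_sum hp) => q.
rewrite mem_undup => /andP[qps qp]; have [_ _] := hs q qps; apply=> //.
by rewrite eq_sym.
Qed.

Definition vanish ps : S -> Prop := fun s => forall p, p \in ps -> p s.

Lemma vanish_homideal ps : (forall q, q \in ps -> closedp q) -> homideal (vanish ps).
Proof.
move=> cps; split=> [p pp|a b ha hb p pp|c a ha p pp|d a ha p pp];
  have hp := cl_homideal (cps p pp).
- exact: (hi0 hp).
- by apply: (hiD hp); [exact: ha | exact: hb].
- by apply: (hiM hp); exact: ha.
- by apply: (hiH hp); exact: ha.
Qed.

(** In large degree some form vanishes at the other points and not at the new one, so each point
    imposes at least one more condition. *)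
Lemma hilb_vanish ps : (forall q, q \in ps -> closedp q) -> uniq ps ->
  exists N, forall M, (N <= M)%N -> (size ps <= hilb (vanish ps) M)%N.
Proof.
elim: ps => [|p ps IH] cps /=; first by exists 0%N.
move=> /andP[pps ups].
have cps' q : q \in ps -> closedp q by move=> h; apply: cps; rewrite inE h orbT.
have cp := cps p (mem_head _ _).
have [N hN] := IH cps' ups; have [N' hN'] := separating_form cp cps' pps.
exists (maxn N N') => M; rewrite geq_max => /andP[NM N'M].
apply: (leq_ltn_trans (hN M NM)).
have sub s : vanish (p :: ps) s -> vanish ps s.
  by move=> h q qs; apply: h; rewrite inE qs orbT.
have h1 := vanish_homideal cps; have h2 := vanish_homideal cps'.
rewrite ltn_neqAle hilb_mono // andbT; apply/eqP => /esym E.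
have [g [hg gp gps]] := hN' M N'M; case/negP: gp.
by have := hilb_eq h1 h2 sub E hg gps; apply; rewrite mem_head.
Qed.

Lemma hilb_bounded I b : homideal I -> pform b -> cofin (adjoin I b) ->
  exists B N, forall M, (N <= M)%N -> (hilb I M <= B)%N.
Proof.
move=> hI [e e0 hb] cb; have [N hN] := cofin_hilb (adjoin_homideal hI hb) cb.
(* From degree [N] on, a step of length [e] does not increase the Hilbert function, so its values
   below [N + e] control the later ones; their sum is a crude common bound. *)
exists (\sum_(i < N + e) hilb I i)%N, N => M NM.
have step D : (N <= D)%N -> (hilb I (D + e) <= hilb I D)%N.
  move=> ND; rewrite (hilb_adjoin _ hI hb) hN ?(leq_trans ND) ?leq_addr //.
  rewrite add0n; apply: (hilb_mono _ hI (colon_homideal hI hb)) => s.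
  exact: hiMr.
elim/ltn_ind: M NM => M IH NM; case: (ltnP M (N + e)) => [lt|le].
  by rewrite (bigD1 (Ordinal lt)) //= leq_addr.
have -> : M = (M - e + e)%N by lia.
by apply: (leq_trans (step _ _)); [lia | apply: IH; lia].
Qed.

Lemma max_uniq_list (T : eqType) (P : T -> Prop) B :
  (forall r : seq T, uniq r -> (forall x, x \in r -> P x) -> (size r <= B)%N) ->
  exists r, uniq r /\ forall x, x \in r <-> P x.
Proof.
move=> hB; pose Q m := `[< exists r : seq T, [/\ uniq r, forall x, x \in r -> P x & size r = m] >].
have ex : exists m, Q m by exists 0%N; apply/asboolP; exists [::].
have bd m : Q m -> (m <= B)%N by move=> /asboolP[r [ur hr <-]]; apply: hB.
case: (ex_maxnP ex bd) => m /asboolP[r [ur hr sr]] mx; exists r; split=> // x.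
split=> [/hr //|Px]; apply/negPn/negP => nx.
suff /mx : Q (size r).+1 by rewrite -sr ltnn.
apply/asboolP; exists (x :: r); split=> //=; first by rewrite nx.
by move=> y; rewrite inE => /predU1P[->|/hr].
Qed.

(** The size of any list of such points is at most the Hilbert function of [I] in large degree,
    which is bounded. *)
Lemma finite_closed I b : homideal I -> pform b -> cofin (adjoin I b) ->
  exists ps, uniq ps /\
    (forall p, (p \in ps) <-> closedp p /\ forall s, I s -> p s).
Proof.
move=> hI fb cb; have [B [N hN]] := hilb_bounded hI fb cb.
apply: (@max_uniq_list _ _ B) => ps ups hps.
have cps q : q \in ps -> closedp q by move=> /hps[].
have [M hM] := hilb_vanish cps ups.
apply: leq_trans (hM _ (leq_maxr N M)) (leq_trans _ (hN _ (leq_maxl N M))).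
apply: hilb_mono => //; first exact: vanish_homideal.
by move=> s Is q /hps[_]; apply.
Qed.

Lemma avoid_adjoin_cofin I ps g : homideal I -> pform g ->
  (forall p, closedp p -> (forall s, I s -> p s) -> p \in ps) ->
  (forall p, p \in ps -> ~~ p g) -> cofin (adjoin I g).
Proof.
move=> hI fg hps hg; have hA := pform_adjoin hI fg; apply: (cl_cofin hA) => p cp hp.
have Ip s : I s -> p s by move=> Is; apply: hp; apply: adjoin_sub.
by have := hg p (hps p cp Ip); rewrite hp //; apply: adjoin_gen.
Qed.

(* Steinitz exchange between two systems of parameters through forms that are
   in general position with respect to both. *)
Lemma regular_of_cofin (r : nat) (G X A : seq S) :
  size G = r -> size X = r -> forms G -> forms X -> forms A ->
  let I0 := (fun s : S => s = 0) in
  cofin (adjoins I0 (G ++ A)) -> cofin (adjoins I0 (X ++ A)) ->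
  regular I0 (X ++ A) -> regular I0 (G ++ A).
Proof.
move=> sG sX fG fX fA I0; have h0 : homideal I0 by exact: homideal0.
elim: r G X A sG sX fG fX fA => [|r IH] G X A.
  by move=> /size0nil -> /size0nil ->.
case/lastP: G => [//|G g]; case/lastP: X => [//|X x].
rewrite !size_rcons -!cats1 !forms_cat => -[sG] [sX] [fG [fg _]] [fX [fx _]] fA.
rewrite -!catA /= => cG cX rX.
have fGA : forms (G ++ A) by apply/forms_cat.
have fXA : forms (X ++ A) by apply/forms_cat.
have hG := adjoins_homideal h0 fGA; have hX := adjoins_homideal h0 fXA.
have mv (Z : seq S) z : adjoins I0 (Z ++ z :: A) = adjoin (adjoins I0 (Z ++ A)) z.
  rewrite !adjoins_cat /= -[LHS]/(adjoins (adjoin _ z) A) -adjoins_front.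
  by rewrite -cats1 adjoins_cat.
have [ps [_ hps]] := finite_closed hG fg (ltac:(by rewrite -mv)).
have [qs [_ hqs]] := finite_closed hX fx (ltac:(by rewrite -mv)).
have [|N hN] := @avoiding_form (ps ++ qs).
  by move=> q; rewrite mem_cat => /orP[/hps[]|/hqs[]].
have [a ha na] := hN N.+1 (leqnSn _).
have fa : pform a by exists N.+1.
have caG : cofin (adjoin (adjoins I0 (G ++ A)) a).
  apply: (@avoid_adjoin_cofin _ ps) => //; first by move=> p cp hp; apply/hps.
  by move=> p pps; apply: na; rewrite mem_cat pps.
have caX : cofin (adjoin (adjoins I0 (X ++ A)) a).
  apply: (@avoid_adjoin_cofin _ qs) => //; first by move=> p cp hp; apply/hqs.
  by move=> p pps; apply: na; rewrite mem_cat pps orbT.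
have /(regular_back h0 fx fX fA) [rXA nx] := rX.
(* Here [a] replaces [x]; the induction hypothesis for [a :: A] then replaces the rest of [X] by the
   rest of [G], and finally [g] replaces [a]. *)
have rXa : regular I0 (X ++ a :: A).
  apply/(regular_back h0 fa fX fA); split=> //.
  by apply: (nzd_exchange hX fx fa _ caX nx); rewrite -mv.
have : regular I0 (G ++ a :: A).
  by apply: IH rXa => //; rewrite mv.
move=> /(regular_back h0 fa fG fA) [rGA ng].
apply/(regular_back h0 fg fG fA); split=> //.
by apply: (nzd_exchange hG fa fg caG _ ng); rewrite -mv.
Qed.

End Points.

(** * The Hilbert function of a complete intersection *)

Section Boxes.
Variables (n : nat) (d : 'I_n -> nat).

(** Divided by [1 - X] this is the Hilbert series of the complete intersection; its coefficients
    count by weight the exponent vectors in the box with sides [d i]. *)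
Definition boxpoly : {poly int} := \prod_(i < n) \sum_(j < d i) 'X^j.

Let B := (\max_(i < n) d i).+1.
Let box (phi : {ffun 'I_n -> 'I_B}) := [forall i, (phi i < d i)%N].
Let wt (phi : {ffun 'I_n -> 'I_B}) := (\sum_i phi i)%N.

Let d_le i : (d i <= B)%N.
Proof. by rewrite leqW // (leq_bigmax i). Qed.

Lemma boxpolyE : boxpoly = \sum_(phi | box phi) 'X^(wt phi).
Proof.
rewrite /boxpoly.
transitivity (\prod_(i < n) \sum_(j < B | (j < d i)%N) ('X^j : {poly int})).
  apply: eq_bigr => i _.
  by rewrite (big_ord_widen_cond B (fun _ => true) (fun j : nat => 'X^j)).
rewrite (bigA_distr_big_dep (fun i (j : 'I_B) => (j < d i)%N) (fun i (j : 'I_B) => 'X^j)).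
apply: eq_big => [phi|phi _].
  by apply/familyP/forallP.
rewrite /wt -[RHS]/('X^(\sum_(i < n) phi i)).
by elim/big_ind2: _ => // x a y b -> ->; rewrite exprD.
Qed.

Lemma box_sum N : \sum_(j < N) boxpoly`_j = (#|[pred phi | box phi & (wt phi < N)%N]|)%:Z.
Proof.
rewrite boxpolyE.
under eq_bigr => j _ do rewrite coef_sum.
rewrite exchange_big /= -sum1_card (big_morph Posz PoszD (erefl _)).
rewrite [RHS](eq_bigl (fun phi => box phi && (wt phi < N)%N)) //.
rewrite [RHS]big_mkcondr /=; apply: eq_bigr => phi _.
case: ltnP => wN.
  rewrite (bigD1 (Ordinal wN)) //= coefXn eqxx big1 ?addr0 // => i /negP ni.
  by rewrite coefXn; case: eqP => // E; case: ni; rewrite -val_eqE /= E.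
rewrite big1 // => i _; rewrite coefXn; case: eqP => // E.
by move: (ltn_ord i); rewrite E ltnNge wN.
Qed.

Lemma card_box : #|[pred phi | box phi]| = (\prod_(i < n) d i)%N.
Proof.
have -> : #|[pred phi | box phi]| = #|family (fun i => [pred j : 'I_B | (j < d i)%N])|.
  apply: eq_card => phi; rewrite -[LHS]/(box phi).
  apply/idP/idP => [/forallP h|/familyP h].
    by apply/familyP => i; apply: h.
  by apply/forallP => i; apply: h.
rewrite card_family foldrE big_map big_enum /=.
apply: eq_bigr => i _.
rewrite -sum1_card (eq_bigl (fun j : 'I_B => (j < d i)%N)) //.
by rewrite -(big_ord_widen B (fun=> 1%N) (d_le i)) sum1_card card_ord.
Qed.

Hypothesis d0 : forall i, (0 < d i)%N.
Let sigma := (\sum_(i < n) (d i).-1)%N.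

Lemma box_large N : (sigma < N)%N -> \sum_(j < N) boxpoly`_j = (\prod_(i < n) d i)%N%:Z.
Proof.
move=> sN; rewrite box_sum -card_box; congr (Posz _).
apply: eq_card => phi; rewrite !inE; case: (boolP (box phi)) => //= /forallP hphi.
apply: leq_ltn_trans sN; apply: leq_sum => i _.
by rewrite -ltnS prednK.
Qed.

(* The involution [j_i |-> d_i - 1 - j_i] exchanges the lower half of the box
   with the upper half. *)
Lemma box_half m : sigma = m.*2.+1 ->
  \sum_(j < m.+1) boxpoly`_j *+ 2 = (\prod_(i < n) d i)%N%:Z.
Proof.
move=> sm; rewrite sumrMnl box_sum -card_box.
pose lo := [pred phi | box phi & (wt phi < m.+1)%N].
pose hi := [pred phi | box phi & ~~ (wt phi < m.+1)%N].
pose inv (phi : {ffun 'I_n -> 'I_B}) : {ffun 'I_n -> 'I_B} :=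
  [ffun i => inord ((d i).-1 - phi i)].
have invE phi i : inv phi i = ((d i).-1 - phi i)%N :> nat.
  rewrite ffunE inordK // (leq_ltn_trans (leq_subr _ _)) //.
  by rewrite (leq_trans _ (d_le i)) // prednK.
have box_inv phi : box (inv phi).
  by apply/forallP => i; rewrite invE -{2}(prednK (d0 i)) ltnS leq_subr.
have invK phi : box phi -> inv (inv phi) = phi.
  move=> /forallP hphi; apply/ffunP => i; apply: val_inj.
  by rewrite /= !invE subKn // -ltnS prednK.
have wt_inv phi : box phi -> (wt (inv phi) + wt phi)%N = sigma.
  move=> /forallP hphi; rewrite -big_split /=; apply: eq_bigr => i _.
  by rewrite invE subnK // -ltnS prednK.
have card_eq : #|lo| = #|hi|.
  rewrite -(@card_in_image _ _ inv lo).
    apply: eq_card => phi; apply/imageP/idP => [[psi]|].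
      rewrite !inE => /andP[bpsi wpsi] ->; rewrite box_inv /=.
      by have := wt_inv _ bpsi; lia.
    rewrite !inE => /andP[bphi wphi]; exists (inv phi); last by rewrite invK.
    by rewrite !inE box_inv /=; have := wt_inv _ bphi; lia.
  move=> phi psi /andP[/= b1 _] /andP[/= b2 _] e.
  by rewrite -(invK _ b1) e invK.
have : (#|lo| + #|hi| = #|[pred phi | box phi]|)%N.
  rewrite -(cardID (fun phi => wt phi < m.+1)%N [pred phi | box phi]).
  by congr (_ + _)%N; apply: eq_card => phi; rewrite !inE // andbC.
rewrite -card_eq => <-; rewrite -/lo; lia.
Qed.

End Boxes.

(** * Hilbert series of regular sequences *)

Section CompleteIntersection.
Variables (n : nat) (k : fieldType).
Local Notation S := {mpoly k[n.+1]}.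
Implicit Types (a b g s t : S) (I J : S -> Prop).
Let I0 : S -> Prop := fun s => s = 0.

(** Congruence modulo [X^M]: Hilbert series are handled as truncated power series. *)
Definition eqX (M : nat) (p q : {poly int}) := forall d, (d < M)%N -> p`_d = q`_d.

Lemma eqXM M p q r : eqX M p q -> eqX M (r * p) (r * q).
Proof.
move=> pq d dM; rewrite !coefM; apply: eq_bigr => i _; congr (_ * _).
by apply: pq; rewrite (leq_ltn_trans (leq_subr _ _)).
Qed.

Lemma eqX_trans M q p r : eqX M p q -> eqX M q r -> eqX M p r.
Proof. by move=> pq qr d dM; rewrite pq // qr. Qed.

Definition hpoly I M : {poly int} := \poly_(d < M) (hilb I d)%:Z.

Lemma hpoly_adjoin I g e M : homideal I -> g \is e.-homog -> nzd I g ->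
  eqX M (hpoly (adjoin I g) M) ((1 - 'X^e) * hpoly I M).
Proof.
move=> hI hg ng d dM; rewrite mulrBl mul1r coefB coefXnM !coef_poly dM.
case: ltnP => [de|ed]; first by rewrite (hilb_adjoin_lt hI hg) // subr0.
rewrite (leq_ltn_trans (leq_subr _ _) dM).
have := hilb_adjoin (d - e) hI hg; rewrite subnK // nzd_colon // => ->.
by rewrite PoszD addrK.
Qed.

Lemma hpoly_adjoins I (r : seq S) (ds : seq nat) M : homideal I ->
  size r = size ds -> all2 (fun g e => (0 < e)%N && (g \is e.-homog)) r ds ->
  regular I r ->
  eqX M (hpoly (adjoins I r) M) ((\prod_(e <- ds) (1 - 'X^e)) * hpoly I M).
Proof.
elim: r ds I => [|g r IH] [|e ds] I hI //=; first by rewrite big_nil mul1r.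
move=> [sz] /andP[/andP[e0 hg] hr] [ng rr].
have hA := adjoin_homideal hI hg.
apply: eqX_trans (IH ds _ hA sz hr rr) _.
rewrite big_cons [_ * \prod_(_ <- _) _]mulrC -mulrA; apply: eqXM.
exact: hpoly_adjoin.
Qed.

(** The ideal generated by the variables in [r], described through monomials so that regularity of a
    further variable can be read off from supports. *)
Definition varideal (r : seq 'I_n.+1) : S -> Prop :=
  fun s => forall m, m \in msupp s -> has (fun j => m j != 0%N) r.

Lemma varideal0 : varideal [::] = I0.
Proof.
apply: funext => s; apply: propext; split=> [h|->]; last by move=> m; rewrite msupp0.
by apply/mpolyP => m; rewrite mcoeff0; apply: memN_msupp_eq0; apply/negP => /h.
Qed.

Lemma varideal_cons i r : homideal (varideal r) ->
  adjoin (varideal r) 'X_i = varideal (i :: r).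
Proof.
move=> hr; have hA := adjoin_homideal hr (homogX k i).
apply: funext => s; apply: propext; split=> [[t h] m ms|h].
  rewrite /=; have [//|/negPn mi] := boolP (m i != 0%N).
  suff /h : m \in msupp (s - t * 'X_i) by [].
  rewrite mcoeff_msupp mcoeffB (_ : (t * 'X_i)@_m = 0) ?subr0 -?mcoeff_msupp //.
  apply: memN_msupp_eq0; apply/negP => /msuppM_le /allpairsP[[m1 m2] /= [_ h2 E]].
  by move: h2 mi; rewrite E msuppX inE => /eqP ->; rewrite mnmDE mnm1E eqxx addn1.
rewrite [s]mpolyE big_seq; apply: (hi_sum hA) => m /h /= mh; apply: (hiZ hA).
have [mi|mi] := boolP (m i != 0%N).
  rewrite -(submK (m := U_(i)) (m' := m)) ?lep1mP // mpolyXD.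
  by apply: (hiM hA); apply: adjoin_gen.
move: mh; rewrite (negPf mi) /= => mh; apply: adjoin_sub => // m'.
by rewrite msuppX inE => /eqP ->.
Qed.

Lemma varideal_nzd i r : i \notin r -> nzd (varideal r) 'X_i.
Proof.
move=> ir s h m ms.
have /h /hasP[j jr] : (U_(i) + m)%MM \in msupp (s * 'X_i).
  by rewrite mcoeff_msupp mcoeffMX -mcoeff_msupp.
rewrite mnmDE mnm1E; have [E|_] := eqVneq i j; first by rewrite E jr in ir.
by rewrite add0n => mj; apply/hasP; exists j.
Qed.

Lemma vars_regular r0 r : homideal (varideal r0) -> uniq (r ++ r0) ->
  regular (varideal r0) [seq 'X_i | i <- r] /\
  adjoins (varideal r0) [seq 'X_i | i <- r] = varideal (rev r ++ r0).
Proof.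
elim: r r0 => [|i r IH] r0 hr0 //= /andP[ni u].
have E := varideal_cons i hr0.
have h1 : homideal (varideal (i :: r0)).
  by rewrite -E; apply: adjoin_homideal (homogX k i).
have [|r1 r2] := IH (i :: r0) h1.
  by rewrite -cat1s uniq_catCA /= ni.
rewrite /adjoins /= E -/(adjoins _ _) r2 rev_cons cat_rcons.
split=> //; split=> //; apply: varideal_nzd.
by move: ni; rewrite mem_cat negb_or => /andP[].
Qed.

Let X : seq S := [seq 'X_i | i <- enum 'I_n.+1].

Lemma X_forms : forms X.
Proof.
rewrite /X; elim: (enum _) => //= i r IH; split=> //.
by exists 1%N => //; exact: homogX.
Qed.

Lemma X_ideal : regular I0 X /\ adjoins I0 X = varideal (rev (enum 'I_n.+1)).
Proof.
have := @vars_regular [::] (enum 'I_n.+1); rewrite varideal0 !cats0.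
by apply; [exact: homideal0 | exact: enum_uniq].
Qed.

Lemma X_cofin : forall d s, (0 < d)%N -> s \is d.-homog -> adjoins I0 X s.
Proof.
move=> d s d0 /dhomogP hs; rewrite X_ideal.2 => m /hs md; rewrite has_rev.
move: d0; rewrite -md -[X in (0 < X)%N]/(mdeg m) mdegE lt0n sum_nat_eq0 negb_forall.
move=> /existsP[i mi].
by apply/hasP; exists i; rewrite ?mem_enum.
Qed.

(** No monomials are counted: the variables form a regular sequence, and modulo all of them only the
    constants remain. *)
Lemma hpoly_X M : eqX M 1 ((1 - 'X) ^+ n.+1 * hpoly I0 M).
Proof.
have h0 : homideal I0 by exact: homideal0.
have hX := adjoins_homideal h0 X_forms.
have := @hpoly_adjoins I0 X (nseq n.+1 1%N) M h0.
rewrite big_nseq iter_mulr_1 expr1 => h.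
apply: eqX_trans (h _ _ X_ideal.1); first last.
- rewrite /X -[X in nseq X](size_enum_ord n.+1).
  by elim: (enum _) => //= i r ->; rewrite (homogX k i).
- by rewrite size_map size_enum_ord size_nseq.
move=> d dM; rewrite coef1 coef_poly dM; case: d dM => [|d] dM /=; last first.
  have /(hilb_eq0 _ hX) -> // : forall s, s \is d.+1.-homog -> adjoins I0 X s.
  by move=> s; apply: X_cofin.
congr Posz; apply/eqP; rewrite eqn_leq; apply/andP; split.
  rewrite lt0n; apply/eqP => /(hilb_eq0 _ hX) /(_ 1 (dhomog1 _ _)).
  rewrite X_ideal.2 => /(_ 0%MM); rewrite msupp1 inE eqxx => /(_ isT) /hasP[j _].
  by rewrite mnm0E.
by rewrite (leq_trans (leq_subr _ _)) // dimvf /dim /= bin0.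
Qed.

Variables (f : 'I_n -> S) (d : 'I_n -> nat) (h : S).
Hypothesis d0 : forall i, (0 < d i)%N.
Hypothesis hf : forall i, f i \is (d i).-homog.
Hypothesis fh : pform h.

Definition fideal : S -> Prop := adjoins I0 [seq f i | i <- enum 'I_n].

Lemma f_forms : forms [seq f i | i <- enum 'I_n].
Proof. by elim: (enum _) => //= i r IH; split=> //; exists (d i). Qed.

Lemma fideal_homideal : homideal fideal.
Proof. by apply: adjoins_homideal; [exact: homideal0 | exact: f_forms]. Qed.

Lemma fideal_gen i : fideal (f i).
Proof.
apply: adjoins_gen; [exact: homideal0 | exact: f_forms |].
by apply: map_f; rewrite mem_enum.
Qed.

Lemma fideal_min J : homideal J -> (forall i, J (f i)) -> forall s, fideal s -> J s.
Proof.
move=> hJ hfJ; apply: adjoins_min => // [s ->|g /mapP[i _ ->]] //.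
exact: hi0.
Qed.

Hypothesis cfh : cofin (adjoin fideal h).

(** Like the variables, [f_1, ..., f_n, h] are [n + 1] forms without common zero, so
    [regular_of_cofin] carries regularity over from the variables. *)
Lemma fideal_regular : regular I0 [seq f i | i <- enum 'I_n] /\ nzd fideal h.
Proof.
have fF : forms ([seq f i | i <- enum 'I_n] ++ [:: h]).
  by apply/forms_cat; split; [exact: f_forms | split].
have := @regular_of_cofin _ _ n.+1 ([seq f i | i <- enum 'I_n] ++ [:: h]) X [::].
rewrite !cats0 => /(_ _ _ fF X_forms I) /= H.
have /regular_cat[] // : regular I0 ([seq f i | i <- enum 'I_n] ++ [:: h]).
  apply: H; rewrite ?X_ideal.1 //.
  - by rewrite size_cat size_map size_enum_ord addn1.
  - by rewrite size_map size_enum_ord.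
  - by rewrite adjoins_cat.
  - by exists 1%N => s; apply: X_cofin.
  by have [] := X_ideal.
by move=> r1 [r2 _].
Qed.

(** As [prod (1 - X^(d_i)) = (1 - X)^n * boxpoly] and [S] has Hilbert series [1 / (1 - X)^(n+1)],
    the series of [S / (f)] is [boxpoly / (1 - X)]; division by [1 - X] forms partial sums. *)
Lemma hilb_fideal e : (hilb fideal e)%:Z = \sum_(j < e.+1) (boxpoly d)`_j.
Proof.
pose P := boxpoly d; pose M := e.+1; pose H := hpoly fideal M.
have key : eqX M ((1 - 'X) * H) P.
  have := @hpoly_adjoins I0 [seq f i | i <- enum 'I_n] [seq d i | i <- enum 'I_n] M
    (homideal0 _ _).
  rewrite !size_map big_map big_enum => /(_ erefl _ fideal_regular.1) hp.
  apply: eqX_trans (eqXM _ (hp _)) _.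
    by elim: (enum _) => //= i r ->; rewrite d0 hf.
  have -> : \prod_(i < n) (1 - 'X^(d i)) = (1 - 'X) ^+ n * P.
    rewrite -[n in X in _ = X * _]card_ord -prodr_const -big_split /=.
    apply: eq_bigr => i _; rewrite -opprB -[in RHS]opprB mulNr -subrX1.
    by [].
  rewrite mulrA mulrA -exprS [_ * P]mulrC -mulrA -[X in eqX _ _ X]mulr1.
  by apply: eqXM => j jM; rewrite (hpoly_X jM).
have : forall j, (j < M)%N -> H`_j = \sum_(i < j.+1) P`_i.
  elim=> [|j IH] jM.
    have := key 0%N jM; rewrite big_ord_recl big_ord0 addr0 => <-.
    by rewrite mulrBl mul1r coefB coefXM subr0.
  rewrite big_ord_recr /= -IH ?(ltnW jM) // -(key _ jM).
  by rewrite mulrBl mul1r coefB coefXM addrC subrK.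
by move=> /(_ e (ltnSn _)) <-; rewrite coef_poly ltnSn.
Qed.

End CompleteIntersection.

(** * Evaluation at a point and the Jacobian *)

Lemma mpoly_alg_ind (k : fieldType) n (P : {mpoly k[n]} -> Prop) :
  (forall c, P c%:MP) -> (forall i, P 'X_i) ->
  (forall a b, P a -> P b -> P (a + b)) -> (forall a b, P a -> P b -> P (a * b)) ->
  forall g, P g.
Proof.
move=> PC PX PD PM g; rewrite [g]mpolyE.
have P0 : P 0 by rewrite -mpolyC0.
have P1 : P 1 by rewrite -mpolyC1.
apply: (big_ind P P0 PD) => m _; rewrite -mul_mpolyC; apply: (PM) => //.
rewrite mpolyXE_id; apply: (big_ind P P1 PM) => i _.
by elim: (m i) => [|e IH]; rewrite ?expr0 // exprS; apply: (PM).
Qed.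

Lemma mmap_comp (k : fieldType) (A : comNzRingType) n p (f : {rmorphism k -> A})
  (h : 'I_p -> A) (lq : n.-tuple {mpoly k[p]}) g :
  mmap f h (g \mPo lq) = mmap f (fun i => mmap f h (tnth lq i)) g.
Proof.
elim/mpoly_alg_ind: g => [c|i|a b Ha Hb|a b Ha Hb].
- by rewrite comp_mpolyC !mmapC.
- by rewrite comp_mpolyXU mmapX mmap1U (tnth_nth 0).
- by rewrite !rmorphD /= Ha Hb.
- by rewrite !rmorphM /= Ha Hb.
Qed.

Lemma mmap_eq (k : fieldType) (A : comNzRingType) n (f : {rmorphism k -> A})
  (h h' : 'I_n -> A) g : h =1 h' -> mmap f h g = mmap f h' g.
Proof.
move=> hh; elim/mpoly_alg_ind: g => [c|i|a b Ha Hb|a b Ha Hb].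
- by rewrite !mmapC.
- by rewrite !mmapX !mmap1U.
- by rewrite !rmorphD /= Ha Hb.
- by rewrite !rmorphM /= Ha Hb.
Qed.

Lemma mmap_homogZ (k : fieldType) (A : comNzRingType) n (f : {rmorphism k -> A})
  (h : 'I_n -> A) c d g : g \is d.-homog ->
  mmap f (fun i => c * h i) g = c ^+ d * mmap f h g.
Proof.
move=> /dhomogP hg; rewrite /mmap mulr_sumr big_seq [RHS]big_seq.
apply: eq_bigr => m /hg md; rewrite mulrCA; congr (_ * _).
rewrite /mmap1 (eq_bigr (fun i => c ^+ m i * h i ^+ m i)) => [|i _]; last exact: exprMn.
by rewrite big_split /= prodrXr -mdegE -md.
Qed.

Section Coordinates.
Variables (n : nat) (k : fieldType).
Local Notation S := {mpoly k[n.+1]}.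
Local Notation point := (S -> bool).
Implicit Types (a b g s t : S) (K : fieldExtType k).

Definition ev K (u : 'I_n.+1 -> K) (g : S) : K :=
  mmap (in_alg K) u g.

HB.instance Definition _ K u := GRing.RMorphism.copy (@ev K u) (mmap (in_alg K) u).

Lemma evZ K (u : 'I_n.+1 -> K) c g : ev u (c *: g) = c *: ev u g.
Proof. by rewrite /ev mmapZ /= -scalerAl mul1r. Qed.

Fact ev_scalable K u : scalable (@ev K u).
Proof. by move=> c g; exact: evZ. Qed.
HB.instance Definition _ K u :=
  GRing.isScalable.Build k S K _ (@ev K u) (@ev_scalable K u).

Lemma evX K (u : 'I_n.+1 -> K) i : ev u 'X_i = u i.
Proof. by rewrite /ev mmapX mmap1U. Qed.

(** With its sign this is the cofactor at [(0, l)] once a row 0 is put above the partial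
    derivatives, which is how it arises from Bezoutians. *)
Definition jac (f : 'I_n -> S) K (u : 'I_n.+1 -> K) (l : 'I_n.+1) : K :=
  (-1) ^+ l * \det (\matrix_(i < n, j < n) ev u (f i)^`M(lift l j)).

(** With [u l = 1] evaluation ignores powers of ['X_l], and so is compatible with homogenization. *)
Record coords (p : point) (K : fieldExtType k) (u : 'I_n.+1 -> K) (l : 'I_n.+1) : Prop :=
  Coords {
    co_norm : u l = 1;
    co_vanish : forall d g, g \is d.-homog -> p g = (ev u g == 0);
    co_onto : forall c : K, exists d g h, [/\ g \is d.-homog, h \is d.-homog,
      ev u h != 0 & c = ev u g / ev u h] }.

Section Residue.
Variables (p : projPoint k n) (K : residueField p) (l : 'I_n.+1).
Hypothesis pl : in_chart p l.

Let v := rf_coord K.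
Definition affine : 'I_n.+1 -> K := fun i => v i / v l.

Lemma rf_coord_neq0 : v l != 0.
Proof. by have := rf_vanish K (homogX k l); rewrite -/(ev v _) evX => <-. Qed.

Lemma ev_affine d g : g \is d.-homog -> ev affine g = (v l)^-1 ^+ d * ev v g.
Proof.
move=> hg; rewrite /ev -(mmap_homogZ _ _ _ hg); apply: mmap_eq => i.
by rewrite /affine mulrC.
Qed.

Lemma affine_coords : coords (pid p) affine l.
Proof.
have v0 := rf_coord_neq0; split.
- by rewrite /affine divff.
- move=> d g hg; rewrite /pid (rf_vanish K hg) (ev_affine hg).
  by rewrite mulf_eq0 expf_eq0 invr_eq0 (negPf v0) andbF.
move=> c; have [d [g [h [hg hh h0 ->]]]] := rf_onto c.
exists d, g, h; split=> //.
  by rewrite (ev_affine hh) mulf_neq0 // expf_neq0 // invr_neq0.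
rewrite (ev_affine hh) (ev_affine hg) -mulf_div divff ?mul1r //.
by rewrite expf_neq0 // invr_neq0.
Qed.

Lemma dehomog_deriv g j :
  (dehomog l g)^`M(j) = chart_sign k l (lift l j) *: dehomog l g^`M(lift l j).
Proof.
have UU p' (i : 'I_p') : 'X_[U_(i) - U_(i)] = 1 :> {mpoly k[p']}.
  by rewrite -mpolyX0; congr 'X_[_]; apply/mnmP => x; rewrite mnmBE subnn mnm0E.
rewrite /dehomog; set lq := [tuple _ | i < _].
elim/mpoly_alg_ind: g => [c|i|a b Ha Hb|a b Ha Hb].
- by rewrite comp_mpolyC !mderivC comp_mpoly0 scaler0.
- rewrite comp_mpolyXU -tnth_nth tnth_mktuple mderivX mnm1E.
  case: unliftP => [j' ->|->].
    rewrite mderivZ mderivX mnm1E (inj_eq lift_inj).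
    have [->|ne] := eqVneq j' j; last by rewrite !scale0r comp_mpoly0 !scaler0.
    by rewrite !UU comp_mpolyZ comp_mpoly1.
  rewrite (negPf (neq_lift _ _)) scale0r comp_mpoly0 scaler0.
  by rewrite -mpolyC1 mderivC.
- by rewrite !(mderivD, comp_mpolyD) Ha Hb scalerDr.
rewrite !(mderivM, comp_mpolyD, rmorphM) /= Ha Hb.
by rewrite -scalerAl -scalerAr scalerDr.
Qed.

Lemma chart_sign_sq i : chart_sign k l i * chart_sign k l i = 1.
Proof. by rewrite /chart_sign; case: eqP => _; rewrite ?mul1r // -expr2 sqrr_sign. Qed.

Lemma chart_signE i : chart_sign K l i = in_alg K (chart_sign k l i).
Proof.
by rewrite /chart_sign; case: eqP => _; rewrite ?rmorph1 // rmorphXn rmorphN1.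
Qed.

Lemma ev_dehomog g : mmap (in_alg K) (chart_coord K l) (dehomog l g) = ev affine g.
Proof.
rewrite /dehomog mmap_comp; apply: mmap_eq => i; rewrite tnth_mktuple /affine.
case: unliftP => [j ->|->]; last by rewrite rmorph1 divff ?rf_coord_neq0.
rewrite mmapZ mmapX mmap1U /chart_coord.
by rewrite chart_signE mulrA -rmorphM chart_sign_sq rmorph1 mul1r.
Qed.

Lemma gradientE g j : gradient K l g 0 j =
  chart_sign k l (lift l j) *: ev affine g^`M(lift l j).
Proof. by rewrite mxE dehomog_deriv mmapZ ev_dehomog /= -scalerAl mul1r. Qed.

(* Only the coordinate of index 0 carries a sign, so that a sign [(-1) ^ l]
   comes out of the determinant when [l > 0]. *)
Lemma jacobianE (f : 'I_n -> S) : jacobian f K l = jac f affine l.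
Proof.
pose A := \matrix_(i < n, j < n) ev affine (f i)^`M(lift l j).
pose D : 'rV[K]_n := \row_j chart_sign K l (lift l j).
rewrite /jacobian; have -> : (\matrix_(i, j) gradient K l (f i) 0 j) = A *m diag_mx D.
  apply/matrixP => i j; rewrite mul_mx_diag mxE gradientE !mxE mulrC.
  by rewrite chart_signE mulr_algl.
rewrite det_mulmx det_diag /jac mulrC; congr (_ * _).
have [l0|l0] := eqVneq l ord0.
  rewrite l0 expr0 big1 // => j _; rewrite mxE /chart_sign.
  by rewrite l0 eq_sym (negPf (neq_lift ord0 j)).
have [|j0 j0E _] := unlift_some (h := l) (i := ord0); first by [].
rewrite (bigD1 j0) //= big1 ?mulr1 => [|j jj0].
  by rewrite mxE -j0E /chart_sign eqxx.
by rewrite mxE /chart_sign j0E (inj_eq lift_inj) (negPf jj0).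
Qed.

(** Each tangent space is a hyperplane, so transversality makes their intersection 0; a vector
    killed by the Jacobian matrix would lie in all of them. *)
Lemma transverse_jac (f : 'I_n -> S) : transverse_at f K l -> jac f affine l != 0.
Proof.
move=> [sm cod]; rewrite -jacobianE.
have cod1 i : codim (tangent K l (f i)) = 1%N.
  rewrite /codim /tangent mxrank_ker subKn ?rank_leq_row // mxrank_tr.
  by apply/eqP; rewrite rank_rV sm.
rewrite (eq_bigr (fun=> 1%N)) // in cod; rewrite sum1_card card_ord in cod.
have c0 : (\bigcap_(i < n) tangent K l (f i))%MS = 0.
  apply/eqP; rewrite -mxrank_eq0; move: cod; rewrite /codim.
  by have := rank_leq_col (\bigcap_(i < n) tangent K l (f i))%MS; lia.
rewrite /jacobian; set M := \matrix_(i, j) _; rewrite -det_tr -unitfE -unitmxE.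
rewrite -row_free_unit -kermx_eq0; apply/rowV0P => w /sub_kermxP wM.
apply/eqP; rewrite -submx0 -c0; apply/sub_bigcapmxP => i _; apply/sub_kermxP.
have -> : gradient K l (f i) = row i M by apply/rowP => j; rewrite !mxE.
by rewrite tr_row colE mulmxA wM mul0mx.
Qed.

End Residue.
End Coordinates.

(** * The Bezoutian *)

Section LinearExtension.
Variables (k : fieldType) (N : nat) (V : lmodType k) (phi : 'X_{1..N} -> V).

Definition lext (P : {mpoly k[N]}) : V := \sum_(m <- msupp P) P@_m *: phi m.

Lemma lextE P i : (msize P <= i)%N ->
  lext P = \sum_(m : 'X_{1..N < i}) P@_m *: phi m.
Proof.
move=> le_pi; set I : subFinType _ := 'X_{1..N < i}.
rewrite /lext (big_mksub I) ?msupp_uniq //=; first last.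
  by move=> x /msize_mdeg_lt /leq_trans; apply.
rewrite big_rmcond //= => j /memN_msupp_eq0 ->.
by rewrite scale0r.
Qed.

Lemma lext_is_linear : linear lext.
Proof.
move=> c p q; pose i := maxn (msize (c *: p + q)) (maxn (msize p) (msize q)).
rewrite !(@lextE _ i) ?leq_max ?leqnn ?orbT // scaler_sumr -big_split /=.
by apply: eq_bigr => m _; rewrite linearP /= scalerDl scalerA.
Qed.
HB.instance Definition _ := GRing.isLinear.Build k {mpoly k[N]} V _ lext lext_is_linear.

Lemma lextX m : lext 'X_[m] = phi m.
Proof. by rewrite /lext msuppX big_seq1 mcoeffX eqxx scale1r. Qed.

End LinearExtension.

Lemma eq_lext (k : fieldType) N (V : lmodType k) (phi psi : 'X_{1..N} -> V) P :
  {in msupp P, phi =1 psi} -> lext phi P = lext psi P.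
Proof.
by move=> h; rewrite /lext big_seq [RHS]big_seq; apply: eq_bigr => m /h ->.
Qed.

Lemma lext_comp (k : fieldType) N (V W : lmodType k) (f : {linear V -> W})
  (phi : 'X_{1..N} -> V) P : f (lext phi P) = lext (f \o phi) P.
Proof. by rewrite /lext linear_sum; apply: eq_bigr => m _; rewrite linearZ. Qed.

Lemma lext_id (k : fieldType) N (P : {mpoly k[N]}) : lext (fun m => 'X_[m]) P = P.
Proof. by rewrite [RHS]mpolyE. Qed.

Lemma lext_mmap (k : fieldType) N (A : comAlgType k) (h : 'I_N -> A) P :
  lext (mmap1 h) P = mmap (in_alg A) h P.
Proof. by apply: eq_bigr => m _; rewrite /= mulr_algl. Qed.

Lemma homog_comp (k : fieldType) n p (lq : n.-tuple {mpoly k[p]}) d g :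
  (forall i, tnth lq i \is 1.-homog) -> g \is d.-homog -> g \mPo lq \is d.-homog.
Proof.
move=> hlq /dhomogP hg; rewrite comp_mpolyE big_seq; apply: rpred_sum => m /hg md.
have <- : mdeg m = d := md; apply: rpredZ; rewrite mdegE.
apply: (big_ind2 (fun (x : {mpoly k[p]}) (e : nat) => x \is e.-homog)) => [|x a y b|i _].
- exact: dhomog1.
- exact: dhomogM.
by have := dhomogMn (m i) (hlq i); rewrite mul1n.
Qed.

Lemma hc_comp (k : fieldType) n p (lq : n.-tuple {mpoly k[p]}) d g :
  (forall i, tnth lq i \is 1.-homog) -> hc d (g \mPo lq) = hc d g \mPo lq.
Proof.
move=> hlq; set N := maxn (msize g) d.+1.
have dN : (d < N)%N by rewrite leq_maxr.
rewrite {1}(@hc_sum _ _ N g) ?leq_maxl // [_ \mPo lq]raddf_sum [LHS]raddf_sum /=.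
rewrite (bigD1 (Ordinal dN)) //= big1 => [|i /negP ni].
  by rewrite addr0 hc_id // homog_comp // hc_homog.
rewrite (hc_neq _ (homog_comp hlq (hc_homog i g))).
by case: eqP => // E; case: ni; rewrite -val_eqE /= E.
Qed.

Lemma homog_mderiv (k : fieldType) n d (g : {mpoly k[n]}) i :
  g \is d.-homog -> g^`M(i) \is d.-1.-homog.
Proof.
move=> /dhomogP hg; rewrite [g]mpolyE raddf_sum /= big_seq.
apply: rpred_sum => m /hg md; rewrite linearZ /= mderivX scalerA.
have [->|mi] := eqVneq (m i) 0%N; first by rewrite mulr0 scale0r rpred0.
apply: rpredZ; rewrite dhomogX; apply/eqP.
have E : m = (U_(i) + (m - U_(i)))%MM by rewrite addmC submK // lep1mP.
by rewrite -md -[X in _ = X.-1]/(mdeg m) [in RHS]E mdegD mdeg1.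
Qed.

(** * Divided differences in two sets of variables *)

Section DividedDifferences.
Variables (n : nat) (k : fieldType).
Local Notation q := n.+1.
Local Notation S := {mpoly k[q]}.
Local Notation R2 := {mpoly k[q + q]}.
Implicit Types (g : S) (P Q : R2).

(* The variables of [R2] are two copies [x], [y] of those of [S]: [lx g] is
   [g(x)], [ly g] is [g(y)], and [delta j] is [x_j - y_j]. *)
Definition xs : q.-tuple R2 := [tuple 'X_(lshift q i) | i < q].
Definition ys : q.-tuple R2 := [tuple 'X_(rshift q i) | i < q].
Definition lx g : R2 := g \mPo xs.
Definition ly g : R2 := g \mPo ys.
Definition diag2 : (q + q).-tuple S :=
  [tuple match split i with inl j => 'X_j | inr j => 'X_j end | i < q + q].

HB.instance Definition _ := GRing.RMorphism.copy lx (comp_mpoly xs).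
HB.instance Definition _ := GRing.RMorphism.copy ly (comp_mpoly ys).

HB.instance Definition _ := GRing.Linear.copy lx (comp_mpoly xs).
HB.instance Definition _ := GRing.Linear.copy ly (comp_mpoly ys).

Lemma lxX i : lx 'X_i = 'X_(lshift q i).
Proof. by rewrite /lx comp_mpolyXU -tnth_nth tnth_mktuple. Qed.

Lemma lyX i : ly 'X_i = 'X_(rshift q i).
Proof. by rewrite /ly comp_mpolyXU -tnth_nth tnth_mktuple. Qed.

Lemma split_lshift (i : 'I_q) : split (lshift q i) = inl i.
Proof. exact: (unsplitK (inl i)). Qed.
Lemma split_rshift (i : 'I_q) : split (rshift q i) = inr i.
Proof. exact: (unsplitK (inr i)). Qed.

Lemma diag2_x g : lx g \mPo diag2 = g.
Proof.
elim/mpoly_alg_ind: g => [c|i|a b Ha Hb|a b Ha Hb].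
- by rewrite /lx !comp_mpolyC.
- by rewrite lxX comp_mpolyXU -tnth_nth tnth_mktuple split_lshift.
- by rewrite !raddfD /= Ha Hb.
- by rewrite !rmorphM /= Ha Hb.
Qed.

Lemma diag2_y g : ly g \mPo diag2 = g.
Proof.
elim/mpoly_alg_ind: g => [c|i|a b Ha Hb|a b Ha Hb].
- by rewrite /ly !comp_mpolyC.
- by rewrite lyX comp_mpolyXU -tnth_nth tnth_mktuple split_rshift.
- by rewrite !raddfD /= Ha Hb.
- by rewrite !rmorphM /= Ha Hb.
Qed.

Definition delta (j : 'I_q) : R2 := 'X_(lshift q j) - 'X_(rshift q j).

(** Products are handled by [(ab)(x) - (ab)(y) = (a(x) - a(y)) b(x) + a(y) (b(x) - b(y))], which on
    the diagonal becomes the Leibniz rule. The family [D] is not unique. *)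
Lemma divided_difference g : exists D : 'I_q -> R2,
  lx g - ly g = \sum_j D j * delta j /\ forall j, D j \mPo diag2 = g^`M(j).
Proof.
elim/mpoly_alg_ind: g => [c|i|a b [D [HD dD]] [E [HE dE]]|a b [D [HD dD]] [E [HE dE]]].
- exists (fun=> 0); split=> [|j]; last by rewrite comp_mpoly0 mderivC.
  by rewrite /lx /ly !comp_mpolyC subrr big1 // => j _; rewrite mul0r.
- exists (fun j => (j == i)%:R); split=> [|j].
    rewrite lxX lyX (bigD1 i) //= eqxx mul1r big1 ?addr0 // => j /negPf ->.
    by rewrite mul0r.
  rewrite rmorph_nat mderivX mnm1E eq_sym; case: eqP => [->|_]; last by rewrite scale0r.
  by rewrite scale1r -mpolyX0; congr 'X_[_]; apply/mnmP => x; rewrite mnmBE subnn mnm0E.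
- exists (fun j => D j + E j); split=> [|j].
    rewrite !raddfD /= addrACA HD HE -big_split /=.
    by apply: eq_bigr => j _; rewrite mulrDl.
  by rewrite raddfD /= dD dE mderivD.
exists (fun j => D j * lx b + ly a * E j); split=> [|j].
  have -> : lx (a * b) - ly (a * b) = (lx a - ly a) * lx b + ly a * (lx b - ly b).
    by rewrite !rmorphM /= mulrBl mulrBr addrA subrK.
  rewrite HD HE mulr_suml mulr_sumr -big_split /=.
  by apply: eq_bigr => j _; rewrite mulrDl mulrAC mulrA.
by rewrite raddfD /= !rmorphM /= diag2_x diag2_y dD dE mderivM.
Qed.

Lemma var_homog N (i : 'I_N) : ('X_i : {mpoly k[N]}) \is 1.-homog.
Proof. by rewrite dhomogX /= mdeg1. Qed.
Lemma xs_homog i : tnth xs i \is 1.-homog.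
Proof. by rewrite tnth_mktuple var_homog. Qed.
Lemma ys_homog i : tnth ys i \is 1.-homog.
Proof. by rewrite tnth_mktuple var_homog. Qed.
Lemma diag2_homog i : tnth diag2 i \is 1.-homog.
Proof. by rewrite tnth_mktuple; case: split => j; rewrite var_homog. Qed.
Lemma delta_homog j : delta j \is 1.-homog.
Proof.
by apply: rpredB; rewrite var_homog.
Qed.

Lemma divided_difference_homog d g : (0 < d)%N -> g \is d.-homog ->
  exists D : 'I_q -> R2, [/\ forall j, D j \is d.-1.-homog,
    lx g - ly g = \sum_j D j * delta j & forall j, D j \mPo diag2 = g^`M(j)].
Proof.
move=> d0 hg; have [D [HD dD]] := divided_difference g.
exists (fun j => hc d.-1 (D j)); split=> [j||j]; first exact: hc_homog.
  have : hc d (lx g - ly g) = lx g - ly g.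
    by apply: hc_id; apply: rpredB; apply: homog_comp => // i; [exact: xs_homog|exact: ys_homog].
  rewrite HD raddf_sum /= => <-; apply: eq_bigr => j _.
  by rewrite (hcM_homog _ _ (delta_homog j)) d0 subn1.
rewrite -hc_comp; last exact: diag2_homog.
by rewrite dD hc_id //; apply: homog_mderiv.
Qed.

Section Bezoutian.
Variables (F : 'I_q -> S) (D : 'I_q -> 'I_q -> R2).
Hypothesis HD : forall r, lx (F r) - ly (F r) = \sum_j D r j * delta j.

Definition bez : R2 := \det (\matrix_(r, j) D r j).

(** Cramer's rule: the matrix [D] sends the column of the [delta j] to that of the
    [F_r(x) - F_r(y)]. *)
Lemma bez_delta j : exists A : 'I_q -> R2,
  delta j * bez = \sum_r A r * (lx (F r) - ly (F r)).
Proof.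
set M := \matrix_(r, j) D r j; exists (fun r => (\adj M) j r).
have E : (\adj M *m (M *m \col_i delta i)) j 0 = (\det M *: \col_i delta i) j 0.
  by rewrite mulmxA mul_adj_mx mul_scalar_mx.
rewrite [RHS]mxE [X in _ * X]mxE [LHS]mxE in E.
rewrite mulrC -E; apply: eq_bigr => r _; rewrite HD; congr (_ * _).
by rewrite mxE; apply: eq_bigr => i _; rewrite !mxE.
Qed.

Lemma bez_diff g : exists A : 'I_q -> R2,
  (lx g - ly g) * bez = \sum_r A r * (lx (F r) - ly (F r)).
Proof.
have [E [HE _]] := divided_difference g.
have [A HA] : {A : 'I_q -> 'I_q -> R2 | forall j,
    delta j * bez = \sum_r A j r * (lx (F r) - ly (F r))}.
  by exists (fun j => sval (cid (bez_delta j))) => j; apply: (svalP (cid (bez_delta j))).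
exists (fun r => \sum_j E j * A j r).
rewrite HE mulr_suml; under eq_bigr => j _ do rewrite -mulrA HA mulr_sumr.
rewrite exchange_big /=; apply: eq_bigr => r _; rewrite mulr_suml.
by apply: eq_bigr => j _; rewrite mulrA.
Qed.

Lemma bez_homog (d : 'I_q -> nat) : (forall r j, D r j \is (d r).-homog) ->
  bez \is (\sum_r d r)%N.-homog.
Proof.
move=> hD; apply: rpred_sum => s _.
rewrite -signr_odd; case: odd; rewrite ?mulN1r ?mul1r ?rpredN;
 apply: (big_ind2 (fun (x : R2) (e : nat) => x \is e.-homog)) => [|x a y b|i _];
 rewrite ?mxE ?dhomog1 //; exact: dhomogM.
Qed.

End Bezoutian.

Definition ml (m : 'X_{1..q + q}) : 'X_{1..q} := [multinom m (lshift q i) | i < q].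
Definition mr (m : 'X_{1..q + q}) : 'X_{1..q} := [multinom m (rshift q i) | i < q].

Lemma mlD a b : ml (a + b) = (ml a + ml b)%MM.
Proof. by apply/mnmP => i; rewrite mnmE !mnmDE !mnmE. Qed.
Lemma mrD a b : mr (a + b) = (mr a + mr b)%MM.
Proof. by apply/mnmP => i; rewrite mnmE !mnmDE !mnmE. Qed.
Lemma mdeg_split m : mdeg m = (mdeg (ml m) + mdeg (mr m))%N.
Proof.
by rewrite !mdegE big_split_ord /=; congr (_ + _)%N; apply: eq_bigr => i _; rewrite mnmE.
Qed.

Definition mxl (m : 'X_{1..q}) : 'X_{1..q + q} :=
  [multinom (if split i is inl j then m j else 0%N) | i < q + q].
Definition mxr (m : 'X_{1..q}) : 'X_{1..q + q} :=
  [multinom (if split i is inr j then m j else 0%N) | i < q + q].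

Lemma ml_mxl m : ml (mxl m) = m.
Proof. by apply/mnmP => i; rewrite !mnmE split_lshift. Qed.
Lemma mr_mxl m : mr (mxl m) = 0%MM.
Proof. by apply/mnmP => i; rewrite !mnmE split_rshift. Qed.
Lemma ml_mxr m : ml (mxr m) = 0%MM.
Proof. by apply/mnmP => i; rewrite !mnmE split_lshift. Qed.
Lemma mr_mxr m : mr (mxr m) = m.
Proof. by apply/mnmP => i; rewrite !mnmE split_rshift. Qed.

Lemma lx_mon m : lx 'X_[m] = 'X_[mxl m].
Proof.
rewrite /lx comp_mpolyX mpolyXE_id big_split_ord /= [X in _ = _ * X]big1 ?mulr1.
  by apply: eq_bigr => i _; rewrite tnth_mktuple mnmE split_lshift.
by move=> i _; rewrite mnmE split_rshift expr0.
Qed.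

Lemma ly_mon m : ly 'X_[m] = 'X_[mxr m].
Proof.
rewrite /ly comp_mpolyX mpolyXE_id big_split_ord /= [X in _ = X * _]big1 ?mul1r.
  by apply: eq_bigr => i _; rewrite tnth_mktuple mnmE split_rshift.
by move=> i _; rewrite mnmE split_lshift expr0.
Qed.

Section Bilinear.
Variables (V : lmodType k).
Implicit Types (a : 'X_{1..q} -> V) (b : 'X_{1..q} -> k).

(* [a] and [b] stand for the linear maps sending the monomial of exponent [m]
   to [a m] and [b m]; [act g a] is then the map [s |-> a (g s)]. *)
Definition bil a b : R2 -> V := lext (fun m => b (mr m) *: a (ml m)).
HB.instance Definition _ a b := GRing.Linear.copy (bil a b) (lext (fun m => b (mr m) *: a (ml m))).

Definition act (W : lmodType k) (g : S) (a : 'X_{1..q} -> W) : 'X_{1..q} -> W :=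
  fun m => lext (fun c => a (c + m)%MM) g.

Lemma bil_lx a b g P : bil a b (lx g * P) = bil (act g a) b P.
Proof.
rewrite [P]mpolyE mulr_sumr !linear_sum; apply: eq_bigr => m _ /=.
rewrite -scalerAr !linearZ /=; congr (_ *: _); rewrite [RHS]lextX /act.
rewrite [g in LHS]mpolyE linear_sum mulr_suml linear_sum /= /lext scaler_sumr.
apply: eq_bigr => c _; rewrite linearZ /= -scalerAl linearZ /= lx_mon -mpolyXD.
rewrite [bil a b _]lextX mlD mrD ml_mxl mr_mxl add0m !scalerA mulrC.
by [].
Qed.

Lemma bil_ly a b g P : bil a b (ly g * P) = bil a (act g (b : _ -> k^o)) P.
Proof.
rewrite [P]mpolyE mulr_sumr !linear_sum; apply: eq_bigr => m _ /=.
rewrite -scalerAr !linearZ /=; congr (_ *: _); rewrite [RHS]lextX /act.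
rewrite [g in LHS]mpolyE linear_sum mulr_suml linear_sum /= /lext scaler_suml.
apply: eq_bigr => c _; rewrite linearZ /= -scalerAl linearZ /= ly_mon -mpolyXD.
by rewrite [bil a b _]lextX mlD mrD ml_mxr mr_mxr add0m !scalerA.
Qed.

Lemma bilB a b P Q : bil a b (P - Q) = bil a b P - bil a b Q.
Proof. exact: raddfB. Qed.

Lemma bil_sum a b (T : Type) (r : seq T) (C : pred T) (F : T -> R2) :
  bil a b (\sum_(t <- r | C t) F t) = \sum_(t <- r | C t) bil a b (F t).
Proof. exact: raddf_sum. Qed.

End Bilinear.

Lemma bil_map (V W : lmodType k) (f : {linear V -> W}) a b P :
  f (bil a b P) = bil (f \o a) b P.
Proof. by rewrite /bil lext_comp; apply: eq_lext => m _ /=; rewrite linearZ. Qed.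

(** Splitting along a basis of [K] makes the second argument [k]-valued, as [bil] requires in order
    to take values in polynomials when [V] is [S]. *)
Lemma bil_coord (K : fieldExtType k) (a b : 'X_{1..q} -> K) P :
  lext (fun m => a (ml m) * b (mr m)) P =
  \sum_(i < \dim {:K}) (vbasis {:K})`_i * bil a (fun m => coord (vbasis {:K}) i (b m)) P.
Proof.
rewrite /bil /lext; under [RHS]eq_bigr => i _ do rewrite mulr_sumr.
rewrite exchange_big /=; apply: eq_bigr => m _.
rewrite {1}(coord_vbasis (memvf (b (mr m)))) mulr_sumr scaler_sumr.
apply: eq_bigr => i _; rewrite -!scalerAr; congr (_ *: (_ *: _)).
exact: mulrC.
Qed.

End DividedDifferences.

(** * Homogenization by a variable *)

Section Homogenize.
Variables (n : nat) (k : fieldType) (l : 'I_n.+1).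
Local Notation S := {mpoly k[n.+1]}.
Implicit Types (g s : S).

(** Components of degree above [M] are dropped, so that [homz M] is linear on all polynomials;
    [msize g] is bounded only where nothing may be lost. *)
Definition homz M g : S := \sum_(i < M.+1) hc i g * 'X_l ^+ (M - i).

Fact homz_linear M : linear (homz M).
Proof.
move=> c g s; rewrite /homz scaler_sumr -big_split /=; apply: eq_bigr => i _.
by rewrite linearP /= mulrDl scalerAl.
Qed.
HB.instance Definition _ M := GRing.isLinear.Build k S S _ (homz M) (homz_linear M).

Lemma homz_homog M g : homz M g \is M.-homog.
Proof.
apply: rpred_sum => i _; have iM : (i <= M)%N by rewrite -ltnS.
have := dhomogM (hc_homog i g) (dhomogMn (M - i) (homogX k l)).
by rewrite mul1n subnKC.
Qed.

Lemma homzM M d s g : s \is d.-homog -> homz (M + d) (s * g) = s * homz M g.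
Proof.
move=> hs; rewrite /homz mulr_sumr -addSn addnC big_split_ord /= big1 ?add0r.
  apply: eq_bigr => i _; rewrite mulrC [s * g]mulrC (hcM_homog _ _ hs) leq_addr addKn.
  by rewrite [(M + d)%N]addnC subnDl; ring.
move=> i _; rewrite [s * g]mulrC (hcM_homog _ _ hs) leqNgt ltn_ord /=.
by rewrite mul0r.
Qed.

Lemma homz_add M j g : (msize g <= M.+1)%N -> homz (M + j) g = homz M g * 'X_l ^+ j.
Proof.
move=> gM; rewrite /homz -addSn big_split_ord /= [X in _ + X]big1 ?addr0.
  rewrite mulr_suml; apply: eq_bigr => i _; rewrite -mulrA -exprD.
  by rewrite addnBAC // -ltnS.
by move=> i _; rewrite hc_ge ?mul0r // (leq_trans gM) // leq_addr.
Qed.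

Lemma homz_sub1 M g : (msize g <= M.+1)%N -> homz M.+1 (('X_l - 1) * g) = 0.
Proof.
move=> gM; rewrite mulrBl mul1r linearB /= -(addn1 M) (homzM _ _ (homogX k l)) homz_add //.
by rewrite expr1 mulrC subrr.
Qed.

Lemma ev_homz (K : fieldExtType k) (u : 'I_n.+1 -> K) M g : u l = 1 ->
  (msize g <= M.+1)%N -> ev u (homz M g) = ev u g.
Proof.
move=> ul gM; rewrite [in RHS](hc_sum gM) /homz !raddf_sum /=.
by apply: eq_bigr => i _; rewrite rmorphM rmorphXn /= evX ul expr1n mulr1.
Qed.

End Homogenize.

(** * Forms isolating a point of intersection *)

Section LocalIsolation.
Variables (n : nat) (k : fieldType).
Local Notation q := n.+1.
Local Notation S := {mpoly k[q]}.
Local Notation R2 := {mpoly k[q + q]}.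
Implicit Types (g s h : S).

Definition system (f : 'I_n -> S) h (r : 'I_q) : S :=
  if unlift ord0 r is Some i then f i else h.

Lemma system0 f h : system f h ord0 = h.
Proof. by rewrite /system unlift_none. Qed.
Lemma systemS f h i : system f h (lift ord0 i) = f i.
Proof. by rewrite /system liftK. Qed.

Lemma act_mon s b P : bil (act s (fun m => 'X_[m] : S)) b P
  = s * bil (fun m => 'X_[m] : S) b P.
Proof.
rewrite /bil /lext mulr_sumr; apply: eq_bigr => m _.
rewrite -!scalerAr; congr (_ *: (_ *: _)); rewrite /act -[in RHS](lext_id s) mulr_suml.
by apply: eq_bigr => c _; rewrite mpolyXD scalerAl.
Qed.

Section Point.
Variables (K : fieldExtType k) (u : 'I_q -> K).

Definition umon (m : 'X_{1..q}) : K := mmap1 u m.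

Lemma ev_mon m : ev u 'X_[m] = umon m.
Proof. by rewrite /ev mmapX. Qed.

Lemma umonD a b : umon (a + b) = umon a * umon b.
Proof. by rewrite -!ev_mon mpolyXD rmorphM. Qed.

Lemma ev_lext g : lext umon g = ev u g.
Proof. exact: lext_mmap. Qed.

Lemma act_umon (V : lmodType k) (phi : {linear K -> V}) s m :
  act s (phi \o umon) m = phi (ev u s * umon m).
Proof.
rewrite /act -ev_lext /lext mulr_suml linear_sum; apply: eq_bigr => c _ /=.
by rewrite -scalerAl linearZ /= umonD.
Qed.

Lemma lext_umon2 P : lext (fun m => umon (ml m) * umon (mr m)) P = ev u (P \mPo diag2 n k).
Proof.
pose h2 (i : 'I_(q + q)) : K := match split i with inl j => u j | inr j => u j end.
rewrite /ev mmap_comp (@mmap_eq _ _ _ _ _ h2) => [|i]; last first.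
  rewrite tnth_mktuple /h2; case: (split i) => j; exact: evX.
rewrite -lext_mmap; apply: eq_lext => m _; rewrite /umon /mmap1 big_split_ord /=.
by congr (_ * _); apply: eq_bigr => i _; rewrite /h2 mnmE ?split_lshift ?split_rshift.
Qed.

Lemma det_system_row (M : 'M[K]_q) (l : 'I_q) (c : K) :
  (forall j, M ord0 j = if j == l then c else 0) ->
  \det M = c * ((-1) ^+ l * \det (\matrix_(i < n, j < n) M (lift ord0 i) (lift l j))).
Proof.
move=> hM; rewrite (expand_det_row _ ord0) (bigD1 l) //= big1 ?addr0.
  rewrite hM eqxx /cofactor add0n; congr (_ * (_ * \det _)).
  by apply/matrixP => i j; rewrite !mxE.
by move=> j /negPf jl; rewrite hM jl mul0r.
Qed.

End Point.

Variables (f : 'I_n -> S) (d : 'I_n -> nat).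
Hypothesis d0 : forall i, (0 < d i)%N.
Hypothesis hf : forall i, f i \is (d i).-homog.

Definition sysdeg e (r : 'I_q) : nat := if unlift ord0 r is Some i then d i else e.

Lemma system_bez e h : (0 < e)%N -> h \is e.-homog -> exists D : 'I_q -> 'I_q -> R2,
  [/\ forall r j, D r j \is (sysdeg e r).-1.-homog,
   forall r, lx (system f h r) - ly (system f h r) = \sum_j D r j * delta k j &
   forall r j, D r j \mPo diag2 n k = (system f h r)^`M(j)].
Proof.
move=> e0 hh.
have ex r : exists D : 'I_q -> R2, [/\ forall j, D j \is (sysdeg e r).-1.-homog,
   lx (system f h r) - ly (system f h r) = \sum_j D j * delta k j &
   forall j, D j \mPo diag2 n k = (system f h r)^`M(j)].
  by rewrite /system /sysdeg; case: unliftP => [i _|_]; apply: divided_difference_homog.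
exists (fun r => sval (cid (ex r))).
by split=> r; have [] := svalP (cid (ex r)).
Qed.

(* With [y] specialized at the point [p] the Bezoutian [Delta(x, p)] is
   annihilated by the ideal of [p] modulo [f], and [Delta(p, p) = J(p)]; its
   coordinates over [k] give the forms [G]. *)
Lemma isolating_form (p : S -> bool) (K : fieldExtType k) (u : 'I_q -> K) (l : 'I_q) :
  coords p u l -> (forall i, p (f i)) -> jac f u l != 0 ->
  exists e G, [/\ G \is e.-homog, ~~ p G &
    forall c s, s \is c.-homog -> p s -> exists M, fideal f (s * G * 'X_l ^+ M)].
Proof.
move=> [ul van _] fp J0.
(* The extra form is ['X_l], of value 1 at [u]. Its derivatives form a unit vector, so the Bezoutian
   takes the value [jac f u l] on the diagonal. *)
have [D [_ HD dD]] := system_bez (ltn0Sn 0) (homogX k l).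
pose b (i : 'I_(\dim {:K})) (m : 'X_{1..q}) : k := coord (vbasis {:K}) i (umon u m).
pose Xm : 'X_{1..q} -> S := fun m => 'X_[m].
have bezJ : ev u (bez D \mPo diag2 n k) = jac f u l.
  rewrite /bez -det_map_mx -[ev u _](det_map_mx (ev u)).
  rewrite (@det_system_row _ _ l 1) ?mul1r.
    rewrite /jac; congr (_ * \det _); apply/matrixP => i j.
    by rewrite !mxE /= dD systemS.
  move=> j; rewrite !mxE /= dD system0 mderivX mnm1E eq_sym.
  case: eqP => [->|_]; last by rewrite scale0r rmorph0.
  rewrite scale1r (_ : (U_(l) - U_(l))%MM = 0%MM) ?mpolyX0 ?rmorph1 //.
  by apply/mnmP => x; rewrite mnmBE subnn mnm0E.
(* The nonzero diagonal value is a combination of the values at [u] of these polynomials, one for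
   each basis vector of [K]. *)
have [i Gi] : exists i, ev u (bil Xm (b i) (bez D)) != 0.
  apply: contrapT => /forallNP no; case/negP: J0.
  rewrite -bezJ -lext_umon2 bil_coord; apply/eqP/big1 => i _.
  have E : bil (umon u) (b i) (bez D) = ev u (bil Xm (b i) (bez D)).
    by rewrite bil_map; apply: eq_lext => m _ /=; rewrite ev_mon.
  rewrite -[bil _ _ _]/(bil (umon u) (b i) (bez D)) E.
  by have /negP/negPn/eqP -> := no i; rewrite mulr0.
have bdiff := bez_diff HD.
move: (bez D) bdiff Gi => B bdiff Gi {bezJ}.
have bilx t P : bil Xm (b i) (lx t * P) = t * bil Xm (b i) P.
  by rewrite bil_lx act_mon.
set G := bil _ _ _ in Gi; pose M0 := msize G.
have act0 s m : ev u s = 0 -> act s (b i : _ -> k^o) m = 0.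
  move=> us; have := @act_umon _ u k^o (coord (vbasis {:K}) i) s m.
  by rewrite us mul0r linear0.
have bil0 s P : ev u s = 0 -> bil Xm (b i) (ly s * P) = 0.
  move=> us; rewrite bil_ly /bil /lext big1 // => m _.
  by rewrite act0 // scale0r scaler0.
have bilXl P : bil Xm (b i) (ly 'X_l * P) = bil Xm (b i) P.
  rewrite bil_ly; apply: eq_lext => m _; congr (_ *: _).
  have := @act_umon _ u k^o (coord (vbasis {:K}) i) 'X_l (mr m).
  by rewrite evX ul mul1r.
exists M0, (homz l M0 G); split; first exact: homz_homog.
  by rewrite (van _ _ (homz_homog _ _ _)) ev_homz.
move=> c s hs ps.
have us : ev u s = 0 by apply/eqP; rewrite -(van _ _ hs).
have [A HA] := bdiff s.
pose Q r := bil Xm (b i) (A r).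
(* Contracting [y] with [u] makes [f_j(y)] act as 0 and [y_l] as 1, so [s * G] lies in the ideal of
   the [f_j] and ['X_l - 1]; homogenization then removes ['X_l - 1]. *)
have sG : s * G = \sum_(j < n) f j * Q (lift ord0 j) + ('X_l - 1) * Q ord0.
  have -> : s * G = bil Xm (b i) ((lx s - ly s) * B).
    by rewrite mulrBl bilB bilx (bil0 s B us) subr0.
  rewrite HA.
  rewrite bil_sum big_ord_recl addrC; congr (_ + _).
    apply: eq_bigr => j _; rewrite systemS mulrBr bilB mulrC [A _ * _]mulrC.
    rewrite bilx (bil0 (f j)) ?subr0 //.
    by apply/eqP; rewrite -(van _ _ (hf j)).
  rewrite system0 mulrBr bilB mulrC [A _ * _]mulrC bilXl.
  by rewrite bilx mulrBl mul1r.
pose M := (M0 + msize (Q ord0) + \sum_j d j)%N.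
exists (M.+1 - M0)%N.
have -> : s * homz l M0 G * 'X_l ^+ (M.+1 - M0) = homz l (M.+1 + c) (s * G).
  rewrite (homzM _ _ _ hs) -mulrA -homz_add //; congr (_ * homz _ _ _).
  by rewrite subnKC // /M; lia.
rewrite sG linearD /= (_ : homz l (M.+1 + c) (_ * Q ord0) = 0) ?addr0; last first.
  rewrite addSn homz_sub1 // /M; lia.
have hI := fideal_homideal d0 hf.
rewrite linear_sum /=; apply: (hi_sum hI) => j _.
have dj : (d j <= M.+1 + c)%N.
  by have : (d j <= \sum_j d j)%N by [rewrite (bigD1 j) //= leq_addr]; rewrite /M; lia.
rewrite -{1}(subnK dj) (homzM _ _ _ (hf j)); apply: (hiMr hI).
exact: fideal_gen.
Qed.

End LocalIsolation.

(** * Residue fields *)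

Section QuotientField.
Local Open Scope quotient_scope.
Import VectorInternalTheory.
Variables (k : fieldType) (A : comAlgType k) (I : idealr A).
Hypothesis Imax : forall g, g \notin I -> exists t, 1 - t * g \in I.
Variables (V : vectType k) (phi : {linear V -> A}).
Hypothesis span : forall g, exists v, g - phi v \in I.

Definition quo : Type := {ideal_quot I}.
HB.instance Definition _ := GRing.ComNzRing.copy quo {ideal_quot I}.

Definition quo_pi (a : A) : quo := \pi_{ideal_quot I} a.

Fact quo_pi_zmod : zmod_morphism quo_pi.
Proof. exact: pi_is_zmod_morphism. Qed.
HB.instance Definition _ := GRing.isZmodMorphism.Build A quo quo_pi quo_pi_zmod.
Fact quo_pi_mult : monoid_morphism quo_pi.
Proof. exact: pi_is_monoid_morphism. Qed.
HB.instance Definition _ := GRing.isMonoidMorphism.Build A quo quo_pi quo_pi_mult.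

Lemma quo_piP (x : quo) : exists a, quo_pi a = x.
Proof. by exists (repr x); rewrite /quo_pi reprK. Qed.

Lemma quo_pi_eq0 a : (quo_pi a == 0) = (a \in I).
Proof.
rewrite -[0](rmorph0 quo_pi) -[a in RHS]subr0 Quotient.idealrBE.
by rewrite /quo_pi.
Qed.

Definition quo_scale (c : k) (x : quo) : quo := quo_pi c%:A * x.

Fact quo_scaleA a b v : quo_scale a (quo_scale b v) = quo_scale (a * b) v.
Proof. by rewrite /quo_scale mulrA -rmorphM -scalerAl mul1r scalerA. Qed.
Fact quo_scale1 : left_id 1 quo_scale.
Proof. by move=> v; rewrite /quo_scale scale1r rmorph1 mul1r. Qed.
Fact quo_scaleDr : right_distributive quo_scale +%R.
Proof. by move=> c u v; rewrite /quo_scale mulrDr. Qed.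
Fact quo_scaleDl v : {morph quo_scale^~ v : a b / a + b}.
Proof. by move=> a b; rewrite /quo_scale scalerDl rmorphD mulrDl. Qed.

HB.instance Definition _ := GRing.Zmodule_isLmodule.Build k quo
  quo_scaleA quo_scale1 quo_scaleDr quo_scaleDl.

Fact quo_scaleAl (a : k) (u v : quo) : a *: (u * v) = (a *: u) * v.
Proof. exact: mulrA. Qed.
HB.instance Definition _ := GRing.Lmodule_isLalgebra.Build k quo quo_scaleAl.
HB.instance Definition _ := GRing.Lalgebra_isComAlgebra.Build k quo.

Fact quo_pi_scale : scalable quo_pi.
Proof. by move=> c a; rewrite -[a in LHS]mul1r scalerAl rmorphM. Qed.
HB.instance Definition _ := GRing.isScalable.Build k A quo _ quo_pi quo_pi_scale.

Fact quo_inv_ex (x : quo) : exists y : quo, (x != 0 -> y * x = 1) /\ (x = 0 -> y = 0).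
Proof.
have [->|x0] := eqVneq x 0; first by exists 0; split=> //; rewrite eqxx.
have [a aE] := quo_piP x; have /Imax [t ht] : a \notin I by rewrite -quo_pi_eq0 aE.
exists (quo_pi t); split=> [_|xz]; last by rewrite xz eqxx in x0.
apply/eqP; rewrite eq_sym -subr_eq0 -aE -rmorphM -[1](rmorph1 quo_pi) -rmorphB.
by rewrite quo_pi_eq0.
Qed.
Definition quo_inv x : quo := sval (cid (quo_inv_ex x)).
Fact quo_mulVf x : x != 0 -> quo_inv x * x = 1.
Proof. by rewrite /quo_inv; case: cid => y []. Qed.
Fact quo_inv0 : quo_inv 0 = 0.
Proof. by have [_] := svalP (cid (quo_inv_ex 0)); apply. Qed.
HB.instance Definition _ := GRing.ComNzRing_isField.Build quo quo_mulVf quo_inv0.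

(** Coordinates come from a complement in [V] of the preimage of [I], which maps isomorphically onto
    the quotient. *)
Fact quo_finite : exists n (v2r : quo -> 'rV[k]_n), linear v2r /\ bijective v2r.
Proof.
have [U hU] : exists U : {vspace V}, forall v, (v \in U) <-> phi v \in I.
  apply: subspace_vspace => [|c u v hu hv]; first by rewrite linear0 rpred0.
  rewrite linearP rpredD //= -[phi u]mul1r scalerAl.
  exact: idealMr.
pose W := (U^C)%VS.
pose f (w : subvs_of W) : quo := quo_pi (phi (vsval w)).
have f_lin : linear f by move=> c u v; rewrite /f !linearP.
have f_inj : injective f.
  move=> w w' E; apply/val_inj/eqP; rewrite -subr_eq0 -memv0 -(capv_compl U) memv_cap.
  apply/andP; split; last exact: memvB (subvsP w) (subvsP w').
  apply/hU.
  by rewrite -quo_pi_eq0 linearB rmorphB /= subr_eq0; apply/eqP.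
have f_surj x : exists w, f w = x.
  have [a <-] := quo_piP x; have [v hv] := span a.
  have : v \in (U + W)%VS by rewrite addv_complf memvf.
  case/memv_addP => u /hU uI [w wW vE]; exists (vsproj W w).
  apply/eqP; rewrite eq_sym -subr_eq0 /f vsprojK // -rmorphB quo_pi_eq0.
  have -> : a - phi w = a - phi v + phi u by rewrite vE linearD /= opprD addrA addrAC subrK.
  exact: rpredD.
pose g x := sval (cid (f_surj x)).
have gK : cancel g f by move=> x; rewrite /g; case: cid.
have fK : cancel f g by move=> w; apply: f_inj; rewrite gK.
exists (dim (subvs_of W)), (v2r \o g); split.
  move=> c x y /=; rewrite -linearP; congr v2r.
  by apply: f_inj; rewrite f_lin !gK.
exists (f \o r2v); first by move=> x /=; rewrite v2rK gK.
by move=> x /=; rewrite fK r2vK.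
Qed.

Definition quo_dim := sval (cid quo_finite).
Fact quo_vect : Vector.axiom quo_dim quo.
Proof.
rewrite /quo_dim; case: (cid quo_finite) => m /= /cid[v [lv bv]].
by exists v.
Qed.
HB.instance Definition _ := Lmodule_hasFinDim.Build k quo quo_vect.

Lemma quotient_field : exists (K : fieldExtType k) (pi : {lrmorphism A -> K}),
  (forall x, exists a, pi a = x) /\ forall a, (a \in I) = (pi a == 0).
Proof.
exists quo, quo_pi; split; first exact: quo_piP.
by move=> a; rewrite quo_pi_eq0.
Qed.

End QuotientField.

(** * The residue field of a closed point *)

Section ResidueField.
Variables (n : nat) (k : fieldType) (p : projPoint k n) (l : 'I_n.+1).
Local Notation S := {mpoly k[n.+1]}.
Implicit Types (g s t : S).
Hypothesis cp : closed_point p.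
Hypothesis pl : in_chart p l.

Let hp : homideal (fun s => s \in p) := pp_homideal p.

Lemma pp_mulXn g j : (g * 'X_l ^+ j \in p) = (g \in p).
Proof.
apply/idP/idP => [/pp_prime_or[//|/pp_pow]|]; first by rewrite (negPf pl).
exact: (hiMr hp).
Qed.

Lemma homog_msize_le d g : g \is d.-homog -> (msize g <= d.+1)%N.
Proof.
move=> hg; have [->|g0] := eqVneq g 0; first by rewrite msize0.
by rewrite -(dhomog_uniq g0 (dhomog_msize hg) hg) leqSpred.
Qed.

Lemma homz_id d g : g \is d.-homog -> homz l d g = g.
Proof.
move=> hg; have := @homzM _ _ l 0 d g 1 hg; rewrite add0n mulr1 => ->.
rewrite /homz big_ord_recl big_ord0 addr0 subnn expr0 mulr1 hc_id ?mulr1 //.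
exact: dhomog1.
Qed.

(* The dehomogenization of [p], as an ideal of the ring of all polynomials; it
   contains ['X_l - 1]. *)
Definition dehom_ideal : {pred S} := fun g => homz l (msize g) g \in p.

Lemma dehom_idealE M g : (msize g <= M.+1)%N -> (g \in dehom_ideal) = (homz l M g \in p).
Proof.
move=> gM; rewrite -[LHS]/(homz l (msize g) g \in p).
rewrite -[LHS](pp_mulXn _ M) -[RHS](pp_mulXn _ (msize g)).
by rewrite -!homz_add // addnC.
Qed.

Fact dehom_idealr : idealr_closed dehom_ideal.
Proof.
split.
- by rewrite -[_ \in _]/(homz l _ _ \in p) linear0; apply: (hi0 hp).
- rewrite (@dehom_idealE 0) ?msize1 // homz_id ?pp_one //; exact: dhomog1.
move=> a u v; set M := msize a; set N := (msize u + msize v)%N.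
pose L := maxn (M + N) (msize (a * u + v)).
have mu : (msize u <= N.+1)%N by rewrite /N; lia.
have mv : (msize v <= L.+1)%N by rewrite /L /N; lia.
rewrite (dehom_idealE mu) (dehom_idealE mv) (@dehom_idealE L); last by rewrite leqW // leq_maxr.
move=> hu hv; rewrite linearD /=; apply: (hiD hp) => //.
rewrite [a](@hc_sum _ _ M) // mulr_suml linear_sum /=.
apply: (hi_sum hp) => i _.
have iL : (i <= L)%N by rewrite /L; have := ltn_ord i; lia.
rewrite -(subnK iL) (homzM _ _ _ (hc_homog i a)); apply: (hiM hp).
have -> : (L - i = N + (L - i - N))%N by rewrite /L; have := ltn_ord i; lia.
by rewrite homz_add //; apply: (hiMr hp).
Qed.

Definition dehom : idealr S := HB.pack_for (idealr S) dehom_ideal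
  (isIdealr.Build S dehom_ideal dehom_idealr).

(** The homogenization of [g] is not in [p], so a power of ['X_l] is one of its multiples modulo
    [p]; setting ['X_l] to 1 gives an inverse of [g]. *)
Lemma dehom_max g : g \notin dehom -> exists t, 1 - t * g \in dehom.
Proof.
set M := msize g; rewrite -[_ \notin _]/(homz l M g \notin p) => ng.
have hG := homz_homog l M g.
have [N hN] := closed_adjoin_cofin cp hG ng.
have hA := adjoin_homideal hp hG.
pose L := (N + M)%N.
have [|t ht] := cofin_ge hA hN (leq_addr M N) (s := 'X_l ^+ L).
  by have := dhomogMn L (homogX k l); rewrite mul1n.
have := hiH hp L ht; rewrite linearB /= hc_id; last first.
  by have := dhomogMn L (homogX k l); rewrite mul1n.
rewrite (hcM_homog _ _ hG) leq_addl addnK => ht'.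
exists (hc N t); rewrite -[_ \in _]/(_ \in dehom_ideal).
pose B := msize (1 - hc N t * g).
rewrite (@dehom_idealE (L + B)); last by rewrite /B; lia.
have -> : homz l (L + B) (1 - hc N t * g) = ('X_l ^+ L - hc N t * homz l M g) * 'X_l ^+ B.
  rewrite linearB /= mulrBl; congr (_ - _).
    rewrite homz_add ?msize1 // -{1}[L]add0n homz_add ?msize1 // homz_id ?mul1r //.
    exact: dhomog1.
  have -> : (L + B = (M + B) + N)%N by rewrite /L; lia.
  by rewrite (homzM _ _ _ (hc_homog N t)) homz_add ?mulrA.
exact: (hiMr hp).
Qed.

(** From degree [N] on, every form lies in the ideal generated by [p] and ['X_l], so a form of
    degree [N + j] is ['X_l ^+ j] times one of degree [N] modulo [p]. This makes [k(p)] finite over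
    [k]. *)
Lemma dehom_span : exists N, forall g, exists v : dhomog n.+1 k N,
  g - (v : S) \in dehom.
Proof.
have [N hN] := closed_adjoin_cofin cp (homogX k l) pl.
have hA := adjoin_homideal hp (homogX k l).
exists N => g.
have red j : forall s, s \is (N + j).-homog -> exists2 v, v \is N.-homog & s - v * 'X_l ^+ j \in p.
  elim: j => [|j IH] s hs.
    rewrite addn0 in hs; exists s => //.
    by rewrite expr0 mulr1 subrr; apply: (hi0 hp).
  have [t ht] := cofin_ge hA hN (leq_addr j.+1 N) hs.
  have := hiH hp (N + j.+1) ht; rewrite linearB /= (hc_id hs).
  rewrite (hcM_homog _ _ (homogX k l)) addnS /= subn1 /= => ht'.
  have [v hv Hv] := IH _ (hc_homog (N + j) t); exists v => //.
  rewrite exprSr mulrA.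
  have -> : s - v * 'X_l ^+ j * 'X_l
      = (s - hc (N + j) t * 'X_l) + (hc (N + j) t - v * 'X_l ^+ j) * 'X_l.
    by rewrite mulrBl addrA subrK.
  by apply: (hiD hp) => //; apply: (hiMr hp).
have [v hv Hv] := red (msize g) (homz l (N + msize g) g) (homz_homog _ _ _).
exists (mkH hv); rewrite -[_ \in _]/(_ \in dehom_ideal) /=.
set B := msize (g - v).
rewrite (@dehom_idealE (N + msize g + B)); last by rewrite /B; lia.
have -> : homz l (N + msize g + B) (g - v) =
    (homz l (N + msize g) g - v * 'X_l ^+ msize g) * 'X_l ^+ B.
  rewrite linearB /= mulrBl; congr (_ - _); first by rewrite homz_add //; lia.
  by rewrite -addnA homz_add ?homog_msize_le // homz_id // exprD mulrA.
exact: (hiMr hp).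
Qed.

Lemma residue_exists : inhabited (residueField p).
Proof.
have [N hN] := dehom_span.
pose phi : dhomog n.+1 k N -> S := fun v => v.
have phi_lin : linear phi by move=> c u v; rewrite /phi linearP.
pose phiL := HB.pack_for {linear dhomog n.+1 k N -> S} phi
  (GRing.isLinear.Build k _ _ _ phi phi_lin).
have [K [pi [pis piE]]] := @quotient_field k S dehom dehom_max _ phiL hN.
pose u (i : 'I_n.+1) : K := pi 'X_i.
have evE g : ev u g = pi g.
  elim/mpoly_alg_ind: g => [c|i|a b Ha Hb|a b Ha Hb].
  - rewrite -[c%:MP]mulr1 mul_mpolyC evZ linearZ /= !rmorph1.
    by [].
  - by rewrite evX.
  - by rewrite !rmorphD /= Ha Hb.
  - by rewrite !rmorphM /= Ha Hb.
have ul : u l = 1.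
  apply/eqP; rewrite -subr_eq0 /u -[1](rmorph1 pi) -rmorphB -piE.
  rewrite -[_ \in _]/(_ \in dehom_ideal) (@dehom_idealE (msize ('X_l - 1 : S)).+1);
    last by rewrite !leqW.
  rewrite -['X_l - 1]mulr1 homz_sub1 ?msize1 //; exact: (hi0 hp).
have van d g : g \is d.-homog -> (g \in p) = (ev u g == 0).
  move=> hg; rewrite evE -piE -[RHS]/(g \in dehom_ideal).
  by rewrite (@dehom_idealE d) ?homog_msize_le // homz_id.
have onto (a : K) : exists d g h, [/\ g \is d.-homog, h \is d.-homog,
    mmap (in_alg K) u h != 0 & a = mmap (in_alg K) u g / mmap (in_alg K) u h].
  have [g <-] := pis a; exists (msize g), (homz l (msize g) g), ('X_l ^+ msize g).
  rewrite -!/(ev _ _) rmorphXn /= evX ul expr1n oner_eq0 divr1 ev_homz // evE.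
  split=> //; first exact: homz_homog.
  by have := dhomogMn (msize g) (homogX k l); rewrite mul1n.
exact: (inhabits (ResidueField van onto)).
Qed.

End ResidueField.

(** * The points of intersection *)

Section Intersection.
Variables (k : fieldType) (n : nat) (d : 'I_n -> nat) (f : 'I_n -> {mpoly k[n.+1]}).
Local Notation S := {mpoly k[n.+1]}.
Implicit Types (g s t h : S) (p q : S -> bool).
Hypothesis d0 : forall i, (0 < d i)%N.
Hypothesis hf : forall i, f i \is (d i).-homog.
Hypothesis tr : forall (p : projPoint k n) (K : residueField p) (l : 'I_n.+1),
  intersection_point f p -> in_chart p l -> jac f (affine K l) l != 0.

Let hI : homideal (fideal f) := fideal_homideal d0 hf.

Definition inV p : Prop := closedp p /\ forall i, p (f i).

Lemma inV_point (P : projPoint k n) : inV (pid P) <-> intersection_point f P.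
Proof.
split=> [[[Q cQ E] fP]|[cP fP]]; last by split=> //; exists P.
have PQ : P =i Q by move=> s; rewrite -[LHS]/(pid P s) E.
split=> // R PR s; have QR : {subset Q <= R} by move=> t; rewrite -PQ; exact: PR.
by rewrite (cQ R QR) PQ.
Qed.

Lemma inV_fideal p s : inV p -> fideal f s -> p s.
Proof. by move=> [cp fp]; apply: (fideal_min (cl_homideal cp) fp). Qed.

Lemma isolated p : inV p -> exists l e G, [/\ ~~ p 'X_l, G \is e.-homog, ~~ p G &
    forall c s, s \is c.-homog -> p s -> exists M, fideal f (s * G * 'X_l ^+ M)].
Proof.
move=> Vp; have [[P cP pE] fp] := Vp; rewrite pE in Vp fp *.
have iP : intersection_point f P by apply/inV_point.
have [l lP] := pp_relevant P; have [K] := residue_exists cP lP.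
have [e [G [hG G0 GP]]] := isolating_form d0 hf (affine_coords K lP) fp (tr K iP lP).
by exists l, e, G.
Qed.

(** If a form [s] is in [p] but not in [q], then [s * G * 'X_l ^+ M] is in [(f)], hence in [q], so
    that [q] contains [G * 'X_l]. *)
Lemma isolating_separates p : inV p -> exists G,
  [/\ pform G, ~~ p G & forall q, inV q -> q != p -> q G].
Proof.
move=> Vp; have [l [e [G [lp hG Gp GP]]]] := isolated Vp; have [cp _] := Vp.
exists (G * 'X_l); split.
- by exists (e + 1)%N; [lia | apply: dhomogM => //; exact: homogX].
- by apply/negP => /(cl_prime cp) []; apply/negP.
move=> q Vq qp; have [cq _] := Vq.
have [|c [s [hs ps /negP qs]]] := closed_not_sub cp cq; first by rewrite eq_sym.
have [M] := GP c s hs ps; move/(inV_fideal Vq).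
have hq := cl_homideal cq.
move/(cl_prime cq) => [/(cl_prime cq)[//|qG]|/(cl_pow cq) ql].
  exact: (hiMr hq).
exact: (hiM hq).
Qed.

(* Quasi-compactness: the isolating forms of all points, together with [f],
   have no common zero, so finitely many of them have no common zero. *)
Lemma inV_finite : exists ps : seq (S -> bool),
  uniq ps /\ forall p, (p \in ps) <-> inV p.
Proof.
have ex p : exists G, inV p -> [/\ pform G, ~~ p G & forall q, inV q -> q != p -> q G].
  have [/isolating_separates[G HG]|no] := pselect (inV p); first by exists G.
  by exists 0.
pose G p := sval (cid (ex p)).
have GP p : inV p -> [/\ pform (G p), ~~ p (G p) & forall q, inV q -> q != p -> q (G p)].
  exact: (svalP (cid (ex p))).
pose Vs (r : seq (S -> bool)) := forall p, p \in r -> inV p.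
pose I (r : seq (S -> bool)) := adjoins (fideal f) (map G r).
have forms_r r : Vs r -> forms (map G r).
  elim: r => //= p r IH hr; split; first by have [] := GP p (hr p (mem_head _ _)).
  by apply: IH => q qr; apply: hr; rewrite inE qr orbT.
have hIr r : Vs r -> homideal (I r) by move=> /forms_r; exact: adjoins_homideal.
have Imono r r' s : Vs r' -> {subset r <= r'} -> I r s -> I r' s.
  move=> hr' sub; have hI' := hIr r' hr'; apply: adjoins_min => //.
    by move=> t; apply: adjoins_sub => //; exact: forms_r.
  move=> _ /mapP[p /sub pr ->]; apply: adjoins_gen => //; first exact: forms_r.
  exact: map_f.
have Vcat r r' : Vs r -> Vs r' -> Vs (r ++ r').
  by move=> hr hr' p; rewrite mem_cat => /orP[/hr|/hr'].
pose J s := exists2 r, Vs r & I r s.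
have hJ : homideal J.
  split=> [|a b [r hr Ia] [r' hr' Ib]|c a [r hr Ia]|e a [r hr Ia]].
  - exists [::] => //; exact: (hi0 hI).
  - have hc := Vcat _ _ hr hr'; exists (r ++ r') => //; apply: (hiD (hIr _ hc)).
      by apply: Imono Ia => // p pr; rewrite mem_cat pr.
    by apply: Imono Ib => // p pr; rewrite mem_cat pr orbT.
  - by exists r => //; apply: (hiM (hIr _ hr)).
  - by exists r => //; apply: (hiH (hIr _ hr)).
have [N hN] : cofin J.
  apply: (cl_cofin hJ) => p cp Jp.
  have Vp : inV p by split=> // i; apply: Jp; exists [::] => //; exact: fideal_gen.
  have [_ /negP + _] := GP p Vp; apply; apply: Jp.
  have hp : Vs [:: p] by move=> q; rewrite inE => /eqP ->.
  exists [:: p] => //; apply: adjoins_gen => //; first exact: forms_r.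
  exact: mem_head.
(* The powers of the [n + 1] variables involve finitely many points only; a point of intersection
   outside [L] would contain all variables. *)
have [L hL XL] : exists2 L, Vs L & forall i, I L ('X_i ^+ N).
  have : exists2 L, Vs L & forall i, i \in enum 'I_n.+1 -> I L ('X_i ^+ N).
    elim: (enum _) => [|i r [L hL XL]]; first by exists [::].
    have [|L' hL' XL'] := hN ('X_i ^+ N).
      by have := dhomogMn N (homogX k i); rewrite mul1n.
    have hc := Vcat _ _ hL' hL; exists (L' ++ L) => // j.
    rewrite inE => /predU1P[->|/XL].
      by apply: Imono XL' => // p pr; rewrite mem_cat pr.
    by apply: Imono => // p pr; rewrite mem_cat pr orbT.
  by move=> [L hL XL]; exists L => // i; apply: XL; rewrite mem_enum.
exists (undup L); split=> [|q]; first exact: undup_uniq.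
rewrite mem_undup; split=> [/hL //|Vq]; apply/negPn/negP => nq.
have [cq _] := Vq; have hq := cl_homideal cq.
have [i /negP] := cl_chart cq; apply; apply: (cl_pow (r := N) cq).
apply: (adjoins_min hq _ _ (XL i)) => [s|_ /mapP[p pL ->]].
  exact: inV_fideal.
have [_ _] := GP p (hL p pL); apply=> //.
by apply: contraNneq nq => ->.
Qed.

Lemma enumeration_exists : exists (N : nat) (pt : 'I_N -> projPoint k n),
  enumerates pt (intersection_point f) /\
  forall i, inhabited (residueField (pt i)).
Proof.
have [ps [ups hps]] := inV_finite.
have ex (i : 'I_(size ps)) : exists P : projPoint k n,
    intersection_point f P /\ nth (fun=> false) ps i = pid P.
  have /hps Vp : nth (fun=> false) ps i \in ps by rewrite mem_nth.
  have [[P cP E] fP] := Vp; exists P; split=> //.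
  by apply/inV_point; rewrite -E.
exists (size ps), (fun i => sval (cid (ex i))); split.
  split=> [i|i j e|q iq].
  - by have [] := svalP (cid (ex i)).
  - apply: val_inj; apply/eqP => /=; rewrite -(nth_uniq (fun=> false) _ _ ups) //.
    have [_ ->] := svalP (cid (ex i)); have [_ ->] := svalP (cid (ex j)).
    by apply/eqP/pidE.
  have /hps qps : inV (pid q) by apply/inV_point.
  have lt : (index (pid q) ps < size ps)%N by rewrite index_mem.
  exists (Ordinal lt) => s.
  have E : pid q = pid (sval (cid (ex (Ordinal lt)))).
    exact: etrans (esym (nth_index _ qps)) (svalP (cid (ex (Ordinal lt)))).2.
  exact: (f_equal (fun F : S -> bool => F s) E).
move=> i; have [[cP _] _] := svalP (cid (ex i)).
have [l lP] := pp_relevant (sval (cid (ex i))).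
exact: residue_exists cP lP.
Qed.

Section Enumerated.
Variables (N : nat) (pt : 'I_N -> projPoint k n).
Hypothesis ptP : enumerates pt (intersection_point f).

Let P (i : 'I_N) : S -> bool := pid (pt i).
Let Vs : seq (S -> bool) := [seq P i | i <- enum 'I_N].

Lemma pt_inV i : inV (P i).
Proof. by apply/inV_point; case: ptP. Qed.

Lemma pt_inj : injective P.
Proof.
move=> i j e; case: ptP => _ inj _; apply: inj => s.
by rewrite -[LHS]/(P i s) e.
Qed.

Lemma pt_all p : inV p -> exists i, p = P i.
Proof.
move=> Vp; have [[Q cQ E] _] := Vp; rewrite E in Vp *.
have [_ _ /(_ Q)[|i Qi]] := ptP; first by apply/inV_point.
by exists i; apply: pidE.
Qed.

Lemma mem_Vs i : P i \in Vs.
Proof. by apply: map_f; rewrite mem_enum. Qed.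

Lemma Vs_closed q : q \in Vs -> closedp q.
Proof. by move=> /mapP[i _ ->]; have [] := pt_inV i. Qed.

Lemma avoiding_h : exists E, forall e, (E <= e)%N -> (0 < e)%N -> exists h,
  [/\ h \is e.-homog, forall i, ~~ P i h & cofin (adjoin (fideal f) h)].
Proof.
have [E hE] := avoiding_form Vs_closed.
exists E => e Ee e0; have [h hh hP] := hE e Ee; exists h; split=> //.
  by move=> i; apply/hP/mem_Vs.
apply: (@avoid_adjoin_cofin _ _ _ Vs) => //; first by exists e.
move=> p cp hp; have [|i ->] := @pt_all p; last exact: mem_Vs.
by split=> // i; apply/hp/fideal_gen.
Qed.

(** Each point has a form, nonzero there, that multiplies [s] into [(f)]. Together with [(f)] these
    forms have no common zero, so a power of [h] also does so, and [h] is regular modulo [(f)]. *)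
Lemma saturated h s c : pform h -> nzd (fideal f) h -> s \is c.-homog ->
  (forall i, P i s) -> fideal f s.
Proof.
move=> [e e0 hh] nh hs sP.
have ex i : exists H, [/\ pform H, ~~ P i H & fideal f (H * s)].
  have [l [e' [G [lp hG Gp GP]]]] := isolated (pt_inV i); have [cp _] := pt_inV i.
  have [M HM] := GP c s hs (sP i); exists (G * 'X_l ^+ M * 'X_l); split.
  - exists (e' + M + 1)%N; first lia.
    apply: dhomogM; last exact: homogX.
    by apply: dhomogM => //; have := dhomogMn M (homogX k l); rewrite mul1n.
  - by apply/negP => /(cl_prime cp)[/(cl_prime cp)[|/(cl_pow cp)]|]; apply/negP.
  have -> : G * 'X_l ^+ M * 'X_l * s = s * G * 'X_l ^+ M * 'X_l by ring.
  exact: (hiMr hI).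
pose H i := sval (cid (ex i)); pose hP i := svalP (cid (ex i)).
have fH : forms [seq H i | i <- enum 'I_N].
  by elim: (enum _) => //= i r IH; split=> //; have [] := hP i.
have hA := adjoins_homideal hI fH.
have cA : cofin (adjoins (fideal f) [seq H i | i <- enum 'I_N]).
  apply: (cl_cofin hA) => p cp Ap.
  have [|i pE] := @pt_all p.
    by split=> // i; apply/Ap/adjoins_sub => //; exact: fideal_gen.
  have [_ /negP + _] := hP i; apply; rewrite pE in Ap; apply: Ap.
  by apply: adjoins_gen => //; apply: map_f; rewrite mem_enum.
have [r hr] := cofin_pow hA hh e0 cA.
have : fideal f (h ^+ r * s).
  apply: (adjoins_min (colon_homideal hI hs) _ _ hr) => [t It|_ /mapP[i _ ->]].
    exact: (hiMr hI).
  by have [] := hP i.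
rewrite mulrC; elim: r {hr} => [|r IH]; first by rewrite expr0 mulr1.
by rewrite exprSr mulrA => /nh /IH.
Qed.

Variables (K : forall i, residueField (pt i)) (l : 'I_N -> 'I_n.+1).
Hypothesis lP : forall i, in_chart (pt i) (l i).

Definition pt_affine i : 'I_n.+1 -> K i := affine (K i) (l i).

Lemma pt_coords i : coords (P i) (pt_affine i) (l i).
Proof. exact: affine_coords. Qed.

(** Over a common denominator [H] the basis vectors of [L] have numerators of one degree; the unit
    [ev u H] is absorbed by the coefficients, and ['X_j], of value 1, raises the degree. *)
Lemma ev_surj1 (p : S -> bool) (L : fieldExtType k) (u : 'I_n.+1 -> L) j :
  coords p u j -> exists M0, forall M, (M0 <= M)%N -> forall c : L,
    exists2 g, g \is M.-homog & ev u g = c.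
Proof.
move=> [uj _ onto].
pose e := vbasis {:L}; pose D := \dim {:L}.
have ex (a : 'I_D) : exists x : nat * S * S, [/\ x.1.2 \is x.1.1.-homog,
    x.2 \is x.1.1.-homog, ev u x.2 != 0 & e`_a = ev u x.1.2 / ev u x.2].
  by have [c [g [h [hg hh h0 E]]]] := onto e`_a; exists (c, g, h).
pose x a := sval (cid (ex a)); have xP a := svalP (cid (ex a)).
pose H := \prod_a (x a).2.
pose G a := (x a).1.2 * \prod_(b | b != a) (x b).2.
have H0 : ev u H != 0.
  by rewrite rmorph_prod; apply/prodf_neq0 => a _; have [] := xP a.
have GE a : ev u (G a) = ev u H * e`_a.
  have [_ _ h0 ->] := xP a.
  rewrite -/(x a) /H (bigD1 a) //= /G !rmorphM /=.
  set y := ev u (x a).1.2; set z := ev u (x a).2 in h0 *; set w := ev u _.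
  by rewrite [z * w]mulrC -mulrA [z * _]mulrCA divff // mulr1 mulrC.
have prodh (Q : pred 'I_D) : \prod_(b | Q b) (x b).2 \is (\sum_(b | Q b) (x b).1.1)%N.-homog.
  apply: (big_ind2 (fun (y : S) (c : nat) => y \is c.-homog)) => [|y a z b|b _].
  - exact: dhomog1.
  - exact: dhomogM.
  by have [] := xP b.
exists (\sum_a (x a).1.1)%N => M leM c.
exists (\sum_a (coord e a (c / ev u H) *: G a) * 'X_j ^+ (M - \sum_a (x a).1.1)).
  apply: rpred_sum => a _; rewrite -(subnKC leM) [in X in _ ^+ X](subnKC leM).
  apply: dhomogM; last by have := dhomogMn (M - \sum_a (x a).1.1) (homogX k j); rewrite mul1n.
  apply: rpredZ; rewrite (bigD1 a) //=; apply: dhomogM => //.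
  by have [] := xP a.
rewrite raddf_sum /=.
under eq_bigr => a _ do
  rewrite rmorphM rmorphXn /= evX uj expr1n mulr1 evZ GE scalerAr.
rewrite -mulr_sumr -(coord_vbasis (memvf _)) mulrCA divff ?mulr1 //.
Qed.

(** Chinese remaindering: the separating forms reduce this to one point at a time. *)
Lemma ev_surj : exists M0, forall M, (M0 <= M)%N -> forall c : forall i, K i,
  exists2 g, g \is M.-homog & forall i, ev (pt_affine i) g = c i.
Proof.
have [M1 hM1] := separating_forms Vs_closed.
have sepE i : exists s, [/\ s \is M1.-homog, ev (pt_affine i) s != 0 &
    forall j, j != i -> ev (pt_affine j) s = 0].
  have [s [hs si sj]] := hM1 M1 (leqnn _) _ (mem_Vs i); exists s; split=> //.
    by rewrite -(co_vanish (pt_coords i) hs).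
  move=> j ji; apply/eqP; rewrite -(co_vanish (pt_coords j) hs); apply: sj.
    exact: mem_Vs.
  by apply: contraNneq ji => /pt_inj ->.
have ex i := ev_surj1 (pt_coords i).
pose M2 i := sval (cid (ex i)); have M2P i := svalP (cid (ex i)).
exists (M1 + \sum_i M2 i)%N => M leM c.
pose s i := sval (cid (sepE i)); have sP i := svalP (cid (sepE i)).
have ex2 i : exists g, g \is (M - M1).-homog /\ ev (pt_affine i) g = c i / ev (pt_affine i) (s i).
  have [|g hg E] := M2P i (M - M1)%N _ (c i / ev (pt_affine i) (s i)); last by exists g.
  have : (M2 i <= \sum_i M2 i)%N by rewrite (bigD1 i) //= leq_addr.
  by rewrite /M2 in leM *; lia.
pose t i := sval (cid (ex2 i)); have tP i := svalP (cid (ex2 i)).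
exists (\sum_i s i * t i).
  apply: rpred_sum => i _; have [hs _ _] := sP i; have [ht _] := tP i.
  have M1M : (M1 <= M)%N by apply: leq_trans leM; exact: leq_addr.
  by have := dhomogM hs ht; rewrite subnKC.
move=> i; rewrite raddf_sum /= (bigD1 i) //= big1 ?addr0.
  have [_ s0 _] := sP i; have [_ tE] := tP i.
  by rewrite rmorphM /= -/(t i) -/(s i) tE mulrCA divff ?mulr1.
move=> j ji; have [_ _ sj] := sP j.
by rewrite rmorphM /= sj ?mul0r // eq_sym.
Qed.

End Enumerated.
End Intersection.

(** * The trace form and the Bezoutian *)

Section Kernel.
Variables (k : fieldType) (n : nat).
Local Notation q := n.+1.
Local Notation S := {mpoly k[q]}.
Local Notation R2 := {mpoly k[q + q]}.
Implicit Types (g : S).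
Variables (f : 'I_n -> S) (d : 'I_n -> nat) (h : S) (e m : nat).
Hypothesis d0 : forall i, (0 < d i)%N.
Hypothesis hf : forall i, f i \is (d i).-homog.
Hypothesis hh : h \is e.-homog.
Hypothesis me : (m < e)%N.
Hypothesis sumd : (\sum_(i < n) (d i).-1 = m.*2.+1)%N.

Let e0 : (0 < e)%N. Proof. by apply: leq_ltn_trans me. Qed.

Variable D : 'I_q -> 'I_q -> R2.
Hypothesis Dh : forall r j, D r j \is (sysdeg d e r).-1.-homog.
Hypothesis HD : forall r,
  lx (system f h r) - ly (system f h r) = \sum_j D r j * delta k j.
Hypothesis dD : forall r j, D r j \mPo diag2 n k = (system f h r)^`M(j).

Lemma Delta_homog : bez D \is (m.*2 + e)%N.-homog.
Proof.
have := bez_homog Dh; rewrite big_ord_recl /sysdeg unlift_none.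
under eq_bigr => i _ do rewrite liftK.
by rewrite sumd (_ : e.-1 + m.*2.+1 = m.*2 + e)%N //; lia.
Qed.

Section OnePoint.
Variables (K : fieldExtType k) (u : 'I_q -> K) (l : 'I_q).
Hypothesis ul : u l = 1.
Hypothesis fu : forall i, ev u (f i) = 0.
Hypothesis hu : ev u h != 0.

(* Evaluation at [u / h(u)^(1/e)], restricted to degrees congruent to [m]
   modulo [e] and multiplied by [h(u)^(m/e)]: no root of [h(u)] is needed. *)
Definition amon (t : nat) (c : 'X_{1..q}) : K :=
  if ((mdeg c + t) %% e == m)%N then umon u c / ev u h ^+ ((mdeg c + t) %/ e) else 0.

(** The offset [t] records the degree of the monomials already split off. *)
Lemma amonD t b c : amon t (b + c) = umon u b * amon (mdeg b + t) c.
Proof.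
rewrite /amon mdegD -addnA [(mdeg c + t)%N]addnC addnA [(mdeg b + t + _)%N]addnC.
by case: ifP => _; rewrite ?mulr0 // umonD mulrA.
Qed.

Lemma amon_period s c : amon (e * s) c = (ev u h ^+ s)^-1 * amon 0 c.
Proof.
rewrite /amon addn0 [(mdeg c + _)%N]addnC mulnC modnMDl divnMDl // exprD.
by case: ifP => _; rewrite ?mulr0 // invfM mulrCA.
Qed.

Lemma act_amon t g c (V : lmodType k) (phi : {linear K -> V}) :
  g \is t.-homog -> act g (phi \o amon 0) c = phi (ev u g * amon t c).
Proof.
move=> /dhomogP hg; rewrite /act -ev_lext mulr_suml linear_sum /lext big_seq.
rewrite [RHS]big_seq; apply: eq_bigr => b /hg bt /=.
by rewrite -scalerAl linearZ /= amonD addn0 -bt.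
Qed.

Lemma act_amon_f i c (V : lmodType k) (phi : {linear K -> V}) :
  act (f i) (phi \o amon 0) c = 0.
Proof. by rewrite (act_amon _ _ (hf i)) fu mul0r linear0. Qed.

Lemma act_amon_period g s c (V : lmodType k) (phi : {linear K -> V}) :
  g \is (e * s).-homog ->
  act g (phi \o amon 0) c = phi (ev u g / ev u h ^+ s * amon 0 c).
Proof. by move=> hg; rewrite (act_amon _ _ hg) amon_period mulrA. Qed.

Lemma act_amon_h c (V : lmodType k) (phi : {linear K -> V}) :
  act h (phi \o amon 0) c = phi (amon 0 c).
Proof.
have hh' : h \is (e * 1).-homog by rewrite muln1.
by rewrite (act_amon_period _ _ hh') expr1 divff // mul1r.
Qed.

(* [cls] of [Delta(u X, u)] is the contraction of [Delta], and only depends on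
   the class modulo [X^e - 1]. *)
Definition cls (p : {poly K}) : K := (p %% ('X^e - 1))`_m.

Lemma cls_is_linear : scalar cls.
Proof. by move=> c p r; rewrite /cls modpD modpZl coefD coefZ. Qed.
HB.instance Definition _ := GRing.isLinear.Build K {poly K} K *%R cls cls_is_linear.

Let Xe_size : size ('X^e - 1 : {poly K}) = e.+1.
Proof. exact: size_XnsubC. Qed.

Lemma cls_dvd p r : ('X^e - 1 %| p) -> cls (p + r) = cls r.
Proof. by move=> /eqP h0; rewrite /cls modpD h0 add0r. Qed.

Lemma cls_Xn i : cls 'X^i = (i %% e == m)%N%:R.
Proof.
have dv s : 'X^e - 1 %| ('X^(e * s) - 1 : {poly K}).
  by rewrite exprM (subrX1 ('X^e)) dvdp_mulr.
have -> : 'X^i = ('X^(e * (i %/ e)) - 1) * 'X^(i %% e) + 'X^(i %% e) :> {poly K}.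
  by rewrite mulrBl mul1r subrK -exprD mulnC -divn_eq.
rewrite cls_dvd; last by rewrite dvdp_mulr.
rewrite /cls modp_small; last by rewrite size_polyXn Xe_size ltnS ltn_mod.
by rewrite coefXn eq_sym.
Qed.

(** Modulo [X^e - 1] the product only depends on [p] modulo [X - 1], that is on [p(1)]; the
    geometric sum has coefficient 1 at [X^m] because [m < e]. *)
Lemma cls_geom (p : {poly K}) : cls (p * \sum_(a < e) 'X^a) = p.[1].
Proof.
set G := \sum_(_ < _) _.
have -> : p * G = (p - p.[1]%:P) * G + p.[1] *: G.
  by rewrite mulrBl mul_polyC subrK.
rewrite cls_dvd.
  rewrite linearZ /= /G linear_sum /=.
  rewrite (bigD1 (Ordinal me)) //= cls_Xn modn_small // eqxx big1 ?addr0 ?mulr1 //.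
  move=> i /negP ni; rewrite cls_Xn modn_small //; case: eqP => // E.
  by case: ni; rewrite -val_eqE /= E.
have : root (p - p.[1]%:P) 1 by rewrite /root hornerD hornerN hornerC subrr.
rewrite -dvdp_XsubCl => /dvdpP[r ->].
by rewrite -mulrA polyC1 -(subrX1 'X e) dvdp_mull.
Qed.

Let rf : {rmorphism k -> {poly K}} := polyC \o in_alg K.
Let rh (i : 'I_(q + q)) : {poly K} :=
  match split i with inl j => (u j)%:P * 'X | inr j => (u j)%:P end.
Let rho (P : R2) : {poly K} := mmap rf rh P.
HB.instance Definition _ := GRing.RMorphism.copy rho (mmap rf rh).

Let rho_mon c : mmap1 rh c = (umon u (ml c) * umon u (mr c)) *: 'X^(mdeg (ml c)).
Proof.
rewrite /mmap1 big_split_ord /= -mul_polyC rmorphM /= mulrAC; congr (_ * _).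
  rewrite /umon /mmap1 rmorph_prod /= mdegE -prodrXr -big_split /=.
  by apply: eq_bigr => i _; rewrite mnmE /rh split_lshift exprMn rmorphXn.
rewrite /umon /mmap1 rmorph_prod /=.
by apply: eq_bigr => i _; rewrite mnmE /rh split_rshift rmorphXn.
Qed.

(** As [m < e], total degree [2 m + e] leaves only the bidegrees [(m, m + e)] and [(m + e, m)]; in
    both, exactly one factor is divided by [h(u)], once. *)
Lemma contraction_cls (P : R2) : P \is (m.*2 + e)%N.-homog ->
  lext (fun c => amon 0 (ml c) * amon 0 (mr c)) P = cls (rho P) / ev u h.
Proof.
move=> /dhomogP hP; rewrite /rho /mmap linear_sum /= mulr_suml /lext big_seq.
rewrite [RHS]big_seq; apply: eq_bigr => c cP.
have cd : mdeg c = (m.*2 + e)%N by exact: hP.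
rewrite rho_mon -[rf _ * _]/((P@_c)%:A%:P * _) mul_polyC !linearZ /= cls_Xn.
rewrite -[LHS]mulr_algl -mulrA; congr (_ * _).
rewrite /amon !addn0; case: eqP => [mlE|_]; last by rewrite mul0r mulr0 mul0r.
have := mdeg_split c; rewrite cd => mE.
have mlr := divn_eq (mdeg (ml c)) e; rewrite mlE in mlr.
set x := (mdeg (ml c) %/ e)%N in mlr *.
have [x0|x1] : x = 0%N \/ x = 1%N by nia.
  have -> : mdeg (mr c) = (1 * e + m)%N by nia.
  rewrite modnMDl modn_small // eqxx divnMDl // divn_small // x0.
  by rewrite expr0 divr1 mulr1 expr1 mulrA.
have -> : mdeg (mr c) = m by nia.
by rewrite modn_small // eqxx divn_small // x1 expr0 divr1 expr1 mulr1 mulrAC.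
Qed.

Lemma rho_lx c g : g \is c.-homog -> rho (lx g) = (ev u g)%:P * 'X^c.
Proof.
move=> hg; rewrite /rho mmap_comp mulrC.
rewrite (@mmap_eq _ _ _ _ _ (fun i => 'X * (u i)%:P)).
  rewrite (mmap_homogZ _ _ _ hg); congr (_ * _).
  rewrite /ev /mmap rmorph_sum /=; apply: eq_bigr => b _; rewrite rmorphM /=.
  by congr (_ * _); rewrite /mmap1 rmorph_prod /=; apply: eq_bigr => i _; rewrite rmorphXn.
by move=> i; rewrite tnth_mktuple mmapX mmap1U /rh split_lshift mulrC.
Qed.

Lemma rho_ly g : rho (ly g) = (ev u g)%:P.
Proof.
rewrite /rho mmap_comp (@mmap_eq _ _ _ _ _ (fun i => (u i)%:P)).
  rewrite /ev /mmap rmorph_sum /=; apply: eq_bigr => b _; rewrite rmorphM /=.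
  by congr (_ * _); rewrite /mmap1 rmorph_prod /=; apply: eq_bigr => i _; rewrite rmorphXn.
by move=> i; rewrite tnth_mktuple mmapX mmap1U /rh split_rshift.
Qed.

Lemma rho_at1 P : (rho P).[1] = ev u (P \mPo diag2 n k).
Proof.
rewrite /ev mmap_comp (@mmap_eq _ _ _ _ _ (fun i => (rh i).[1])) => [|i].
  rewrite /rho /mmap horner_sum; apply: eq_bigr => c _.
  rewrite hornerM hornerC; congr (_ * _); rewrite /mmap1 horner_prod.
  by apply: eq_bigr => i _; rewrite horner_exp.
rewrite tnth_mktuple /rh.
by case: (split i) => j; rewrite ?hornerM ?hornerC ?hornerX ?mulr1 mmapX mmap1U.
Qed.

Lemma rho_row r : (\sum_j rho (D r j) * (u j)%:P) * ('X - 1)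
  = (ev u (system f h r))%:P * ('X^(sysdeg d e r) - 1).
Proof.
have hr : system f h r \is (sysdeg d e r).-homog.
  by rewrite /system /sysdeg; case: unliftP.
have := congr1 rho (HD r); rewrite rmorphB /= (rho_lx hr) rho_ly => E.
rewrite [RHS]mulrBr mulr1 E rmorph_sum /= mulr_suml; apply: eq_bigr => j _.
rewrite rmorphM /= -mulrA; congr (_ * _).
rewrite rmorphB /= -lxX -lyX rho_ly (rho_lx (homogX k j)) expr1 evX.
by rewrite mulrBr mulr1.
Qed.

(** Once [X - 1] is cancelled, the matrix sends the column of the [u_j] to a column supported in row
    0, with entry [h(u) (1 + X + ... + X^(e-1))]. Cramer's rule at [l], where [u_l = 1], gives the
    determinant. *)
Lemma rho_Delta : exists c : {poly K}, c.[1] = jac f u l /\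
  rho (bez D) = c * ((ev u h)%:P * \sum_(a < e) 'X^a).
Proof.
pose M := \matrix_(r, j) rho (D r j).
have X1 : 'X - 1 != 0 :> {poly K} by rewrite -polyC1 polyXsubC_eq0.
have row0 : \sum_j M ord0 j * (u j)%:P = (ev u h)%:P * \sum_(a < e) 'X^a.
  apply: (mulIf X1); under eq_bigr do rewrite mxE.
  rewrite rho_row system0 /sysdeg unlift_none subrX1 -mulrA.
  by congr (_ * _); rewrite mulrC.
have rowS i : \sum_j M (lift ord0 i) j * (u j)%:P = 0.
  apply: (mulIf X1); under eq_bigr do rewrite mxE.
  by rewrite rho_row systemS fu mul0r mul0r.
exists (cofactor M ord0 l); split.
  rewrite /cofactor add0n hornerM horner_exp hornerN hornerC /jac; congr (_ * _).
  rewrite -[LHS]/(horner_eval 1 _) -det_map_mx; congr (\det _).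
  by apply/matrixP => i j; rewrite !mxE /= /horner_eval rho_at1 dD systemS.
have -> : rho (bez D) = \det M.
  by rewrite /bez -[LHS](det_map_mx rho); congr (\det _); apply/matrixP => r j; rewrite !mxE.
have E : (\adj M *m (M *m \col_j (u j)%:P)) l 0 = (\det M *: \col_j (u j)%:P) l 0.
  by rewrite mulmxA mul_adj_mx mul_scalar_mx.
rewrite [RHS]mxE [X in _ * X]mxE ul mulr1 [LHS]mxE in E.
rewrite -E big_ord_recl big1 => [|i _].
  rewrite addr0 [X in X * _]mxE; congr (_ * _); rewrite mxE -row0.
  by apply: eq_bigr => j _; rewrite [X in _ * X]mxE.
rewrite [X in _ * X]mxE (_ : \sum__ _ = 0) ?mulr0 // -[RHS](rowS i).
by apply: eq_bigr => j _; rewrite [X in _ * X]mxE.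
Qed.

Lemma contraction :
  lext (fun c => amon 0 (ml c) * amon 0 (mr c)) (bez D) = jac f u l.
Proof.
rewrite (contraction_cls Delta_homog); have [c [<- ->]] := rho_Delta.
rewrite mulrCA mul_polyC linearZ /= cls_geom mulrC mulrA mulVf ?mul1r //.
Qed.

End OnePoint.
End Kernel.

Lemma field_trace_coord (k : fieldType) (L : fieldExtType k) (x : L) :
  field_trace x = \sum_(i < \dim {:L}) coord (vbasis {:L}) i (x * (vbasis {:L})`_i).
Proof. by apply: eq_bigr => i _; rewrite mxE. Qed.

Fact field_trace_scalar (k : fieldType) (L : fieldExtType k) : scalar (@field_trace k L).
Proof. by move=> c x y; rewrite field_traceD field_traceZ. Qed.
HB.instance Definition _ (k : fieldType) (L : fieldExtType k) :=
  GRing.isLinear.Build k L k *%R (@field_trace k L) (@field_trace_scalar k L).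

(** * Contraction at several points and isotropy *)

Section Isotropy.
Variables (k : fieldType) (n : nat).
Local Notation q := n.+1.
Local Notation S := {mpoly k[q]}.
Local Notation R2 := {mpoly k[q + q]}.
Implicit Types (g : S).
Variables (f : 'I_n -> S) (d : 'I_n -> nat) (h : S) (e m : nat).
Hypothesis d0 : forall i, (0 < d i)%N.
Hypothesis hf : forall i, f i \is (d i).-homog.
Hypothesis hh : h \is e.-homog.
Hypothesis me : (m < e)%N.
Hypothesis sumd : (\sum_(i < n) (d i).-1 = m.*2.+1)%N.

Variables (N : nat) (K : 'I_N -> fieldExtType k).
Variables (u : forall i, 'I_q -> K i) (l : 'I_N -> 'I_q).
Hypothesis ul : forall i, u i (l i) = 1.
Hypothesis fu : forall i j, ev (u i) (f j) = 0.
Hypothesis hu : forall i, ev (u i) h != 0.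
Hypothesis surj : exists M0, forall M, (M0 <= M)%N -> forall c : forall i, K i,
  exists2 g, g \is M.-homog & forall i, ev (u i) g = c i.

Lemma surj_unit (c : forall i, K i) : exists s g,
  g \is (e * s).-homog /\ forall i, ev (u i) g / ev (u i) h ^+ s = c i.
Proof.
have [M0 hM0] := surj; have e0 : (0 < e)%N by lia.
have [|g hg gE] := hM0 (e * M0)%N _ (fun i => c i * ev (u i) h ^+ M0).
  by rewrite leq_pmull.
by exists M0, g; split=> // i; rewrite gE mulfK // expf_neq0 ?hu.
Qed.

Variable D : 'I_q -> 'I_q -> R2.
Hypothesis Dh : forall r j, D r j \is (sysdeg d e r).-1.-homog.
Hypothesis HD : forall r,
  lx (system f h r) - ly (system f h r) = \sum_j D r j * delta k j.
Hypothesis dD : forall r j, D r j \mPo diag2 n k = (system f h r)^`M(j).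

Let Delta := bez D.
Let a i := amon h e m (u i) 0.
Let tf i (w : K i) (phi : {scalar K i}) : 'X_{1..q} -> k := fun c => phi (w * a i c).

(** [(g(x) - g(y)) Delta] is a combination of the [F_r(x) - F_r(y)], which contract to 0: on both
    sides the [f_j] act as 0 and [h] as the identity. *)
Lemma bil_shift i j (phi : {scalar K j}) g :
  bil (act g (a i)) (fun c => phi (a j c)) Delta
  = bil (a i) (act g ((fun c => phi (a j c)) : _ -> k^o)) Delta.
Proof.
set b := fun c => phi (a j c).
have same r Q : bil (a i) b (lx (system f h r) * Q) = bil (a i) b (ly (system f h r) * Q).
  rewrite bil_lx bil_ly /system; case: unliftP => [r' _|_].
    rewrite /bil /lext !big1 // => c _.
      by rewrite (@act_amon_f _ _ _ _ h e m hf _ _ (fu j) r' (mr c) k^o phi) scale0r scaler0.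
    by rewrite (@act_amon_f _ _ _ _ h e m hf _ _ (fu i) r' (ml c) (K i) idfun) !scaler0.
  apply: eq_lext => c _.
  rewrite (@act_amon_h _ _ _ _ m hh me _ _ (hu i) (ml c) (K i) idfun).
  by rewrite (@act_amon_h _ _ _ _ m hh me _ _ (hu j) (mr c) k^o phi).
rewrite -bil_lx -bil_ly; apply/eqP; rewrite -subr_eq0 -bilB -mulrBl.
have [A ->] := bez_diff HD g; rewrite bil_sum big1 // => r _.
by rewrite mulrC mulrBl bilB same subrr.
Qed.

Definition bez_pair i j (w : K j) (phi : {scalar K j}) : K i := bil (a i) (tf w phi) Delta.

Lemma bez_pair_shift i j (phi : {scalar K j}) g s : g \is (e * s).-homog ->
  ev (u i) g / ev (u i) h ^+ s * bez_pair i 1 phi = bez_pair i (ev (u j) g / ev (u j) h ^+ s) phi.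
Proof.
move=> hg.
transitivity (bil (act g (a i)) (fun c => phi (a j c)) Delta).
  rewrite /bez_pair /bil /lext mulr_sumr; apply: eq_bigr => c _.
  rewrite (@act_amon_period _ _ _ _ m me _ _ g s (ml c) (K i) idfun) //=.
  by rewrite /tf mul1r -!scalerAr.
rewrite bil_shift; apply: eq_lext => c _; congr (_ *: _).
by rewrite (@act_amon_period _ _ _ _ m me _ _ g s (mr c) k^o phi).
Qed.

(* The shift property makes [w |-> bez_pair i w phi] linear over the product of
   the residue fields, as these are spanned by the values of the fractions
   [g / h ^ s]. *)
Lemma bez_pair_mul i (phi : {scalar K i}) z : z * bez_pair i 1 phi = bez_pair i z phi.
Proof.
have [s [g [hg gE]]] := surj_unit (fun j => if j =P i is ReflectT E then
  ecast x (K x) (esym E) z else 0).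
have := bez_pair_shift i phi hg; rewrite gE; case: eqP => // E.
by rewrite (eq_irrelevance E erefl).
Qed.

(** A fraction that is 0 at [i] and 1 at [j], shifted from one side to the other, shows that
    [bez_pair i 1 phi] is 0. *)
Lemma bez_pair_off i j (phi : {scalar K j}) w : i != j -> bez_pair i w phi = 0.
Proof.
move=> ij.
have [s [g [hg gE]]] := surj_unit (fun x => if x == i then 0 else 1 : K x).
have [s' [g' [hg' gE']]] := surj_unit (fun x => if x =P j is ReflectT E then
  ecast x (K x) (esym E) w else 0).
have h1 : bez_pair i 1 phi = 0.
  have := bez_pair_shift i phi hg; rewrite !gE eqxx mul0r eq_sym (negPf ij).
  by move=> <-.
have := bez_pair_shift i phi hg'; rewrite h1 mulr0 gE'; case: eqP => // E.
by rewrite (eq_irrelevance E erefl) => <-.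
Qed.

Let J i := jac f (u i) (l i).

(** [Tr (w * _)] is the sum over a basis [e_x] of the coordinate functionals of [e_x * w * _]. By
    [bez_pair_mul] the factors come out, and what remains is the contraction of [Delta] at the point
    on both sides. *)
Lemma bez_pair_trace i w : bez_pair i w (@field_trace k (K i)) = J i * w.
Proof.
pose phi x : {scalar K i} := coord (vbasis {:K i}) x.
have cJ : J i = \sum_(x < \dim {:K i}) (vbasis {:K i})`_x * bez_pair i 1 (phi x).
  rewrite /J -(contraction hf hh me sumd Dh HD dD (ul i) (fu i) (hu i)) bil_coord.
  by apply: eq_bigr => x _; congr (_ * _); apply: eq_lext => c _; rewrite /tf mul1r.
rewrite cJ mulr_suml.
have -> : bez_pair i w (@field_trace k (K i))
    = \sum_(x < \dim {:K i}) bez_pair i ((vbasis {:K i})`_x * w) (phi x).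
  rewrite /bez_pair /bil /lext exchange_big /=; apply: eq_bigr => c _.
  rewrite -scaler_sumr -scaler_suml; congr (_ *: (_ *: _)).
  rewrite /tf field_trace_coord; apply: eq_bigr => x _; rewrite /phi.
  by congr (coord _ _ _); rewrite mulrC mulrA.
by apply: eq_bigr => x _; rewrite -bez_pair_mul mulrAC.
Qed.

Lemma field_trace_neq0 i : J i != 0 -> ~ forall x : K i, field_trace x = 0.
Proof.
move=> J0 tr0; case/eqP: J0; rewrite -[J i]mulr1 -bez_pair_trace /bez_pair /bil /lext big1 //.
by move=> c _; rewrite /tf /= tr0 scale0r scaler0.
Qed.

Definition annihilates (w : forall i, K i) :=
  forall g, g \is m.-homog -> \sum_i field_trace (w i * ev (u i) g) = 0.

(* A monomial of [Delta] has bidegree [(r, s)] with [r + s = 2 m + e], and it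
   contributes only if [r] and [s] are congruent to [m] modulo [e], hence only if
   one of them is [m], where [w] or [w'] annihilates it. *)
Lemma annihilates_isotropic w w' : annihilates w -> annihilates w' ->
  \sum_i field_trace (J i * w i * w' i) = 0.
Proof.
move=> hw hw'.
pose A (v : forall i, K i) c := \sum_i field_trace (v i * a i c).
have A0 v c : annihilates v -> (mdeg c < m + e)%N -> A v c = 0.
  move=> hv cme; rewrite /A.
  have [cm|cm] := eqVneq (mdeg c %% e)%N m; last first.
    by rewrite big1 // => i _; rewrite /a /amon addn0 (negPf cm) mulr0 linear0.
  have cE : mdeg c = m.
    by have := divn_eq (mdeg c) e; rewrite cm; case: (_ %/ _)%N => [|x]; nia.
  rewrite -[RHS](hv 'X_[c]); last by rewrite dhomogX; apply/eqP.
  apply: eq_bigr => i _; rewrite /a /amon addn0 cm eqxx ev_mon cE divn_small //.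
  by rewrite expr0 divr1.
have step i : J i * w' i = bil (a i) (A w') Delta.
  rewrite -bez_pair_trace.
  have -> : bil (a i) (A w') Delta = \sum_j bez_pair i (w' j) (@field_trace k (K j)).
    rewrite /bez_pair /bil /lext exchange_big /=; apply: eq_bigr => c _.
    by rewrite -scaler_sumr -scaler_suml.
  by rewrite (bigD1 i) //= big1 ?addr0 // => j ji; rewrite bez_pair_off // eq_sym.
have -> : \sum_i field_trace (J i * w i * w' i) = \sum_i field_trace (w i * bil (a i) (A w') Delta).
  by apply: eq_bigr => i _; rewrite -step mulrAC mulrC.
have -> : \sum_i field_trace (w i * bil (a i) (A w') Delta)
    = bil (A w : _ -> k^o) (A w') Delta.
  rewrite /bil /lext; under eq_bigr => i _ do rewrite mulr_sumr field_trace_sum.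
  rewrite exchange_big /=; apply: eq_bigr => c _.
  rewrite /A !scaler_sumr; apply: eq_bigr => i _.
  by rewrite -!scalerAr !field_traceZ.
rewrite /bil /lext big_seq big1 // => c cD.
have cd : mdeg c = (m.*2 + e)%N.
  by have /dhomogP/(_ c cD) := Delta_homog hh me sumd Dh.
have := mdeg_split c; rewrite cd => cE.
case: (ltnP (mdeg (ml c)) (m + e)) => [ltl|gel]; first by rewrite (A0 w _ hw ltl) !scaler0.
have ltr : (mdeg (mr c) < m + e)%N by lia.
by rewrite (A0 w' _ hw' ltr) scale0r scaler0.
Qed.

End Isotropy.

(** * Metabolic forms in the Grothendieck-Witt group *)

Section GramClass.
Variable k : fieldType.

Definition gram n (A : 'M[k]_n) : Prop := A^T = A /\ A \in unitmx.

(* If [A] is not symmetric and invertible, [sform_of] makes this 0. *)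
Definition gwm n (A : 'M[k]_n) : GW k := gw_class (sform_of A).

Lemma gram_val n (A : 'M[k]_n) : gram A ->
  val (sform_of A) = Tagged (fun n => 'M[k]_n) A.
Proof.
by move=> [sA uA]; rewrite /sform_of insubdK // /in_mem /= /sform_axiom sA eqxx.
Qed.

Lemma gwm_congr m n (A : 'M[k]_m) (B : 'M[k]_n) (P : 'M[k]_(m, n)) (Q : 'M[k]_(n, m)) :
  gram A -> gram B -> P *m Q = 1%:M -> Q *m P = 1%:M -> P *m B *m P^T = A ->
  gwm A = gwm B.
Proof.
move=> gA gB PQ QP E; congr groth_in; apply/iso_classE.
rewrite /isometric /sdim /smx !gram_val //=.
by exists P, Q.
Qed.

Lemma gwm_congr_sq n (A B P : 'M[k]_n) : gram A -> gram B ->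
  P *m B *m P^T = A -> gwm A = gwm B.
Proof.
move=> gA gB E; have uP : P \in unitmx.
  by move: gA.2; rewrite -E !unitmx_mul => /andP[/andP[]].
exact: (gwm_congr (Q := invmx P)) (mulmxV uP) (mulVmx uP) E.
Qed.

Lemma gram_block m n (A : 'M[k]_m) (B : 'M[k]_n) : gram A -> gram B ->
  gram (block_mx A 0 0 B).
Proof.
move=> [sA uA] [sB uB]; split; first by rewrite tr_block_mx !trmx0 sA sB.
by rewrite unitmxE det_ublock unitrM -!unitmxE uA.
Qed.

Lemma gwm_block m n (A : 'M[k]_m) (B : 'M[k]_n) : gram A -> gram B ->
  gwm (block_mx A 0 0 B) = gwm A + gwm B.
Proof.
move=> gA gB; rewrite -groth_inD -iso_classD; congr groth_in; apply/iso_classE.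
have eA := gram_val gA; have eB := gram_val gB; have eAB := gram_val (gram_block gA gB).
move: (sform_of A) (sform_of B) (sform_of (block_mx A 0 0 B)) eA eB eAB.
move=> [vA pA] [vB pB] [vC pC] /= eA eB eC; subst vA vB vC.
rewrite /isometric /sdim /smx /=.
by exists 1%:M, 1%:M; rewrite trmx1 !mulmx1 mul1mx.
Qed.

Lemma gwm0 (A : 'M[k]_0) : gwm A = 0.
Proof.
rewrite -[0]/(groth_in (iso_class (sform0 k))); congr groth_in; apply/iso_classE.
have gA : gram A by split; [apply/matrixP => -[] | rewrite unitmxE det_mx00 unitr1].
by apply: isometric_dim0; rewrite // /sdim gram_val.
Qed.

Lemma gram_cast m n (e : m = n) (A : 'M[k]_m) : gram (castmx (e, e) A) <-> gram A.
Proof. by case: _ / e; rewrite castmx_id. Qed.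

Lemma gwm_cast m n (e : m = n) (A : 'M[k]_m) : gwm (castmx (e, e) A) = gwm A.
Proof. by case: _ / e; rewrite castmx_id. Qed.

Lemma gwm_mxdiag N (m : 'I_N -> nat) (A : forall i, 'M[k]_(m i)) :
  (forall i, gram (A i)) ->
  gram (\mxdiag_i A i) /\ gwm (\mxdiag_i A i) = \sum_i gwm (A i).
Proof.
elim: N m A => [|N IH] m A gA.
  have E : (\sum_i m i = 0)%N by rewrite big_ord0.
  split; last by rewrite -(gwm_cast E) gwm0 big_ord0.
  by apply/(gram_cast E); split; [apply/matrixP => -[] | rewrite unitmxE det_mx00 unitr1].
have [gB wB] := IH _ (fun i => A (lift ord0 i)) (fun i => gA _).
rewrite mxdiag_recl gram_cast gwm_cast big_ord_recl -wB.
by split; [exact: gram_block | exact: gwm_block].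
Qed.

Lemma gram_scalar n (a : k) : a != 0 -> gram (a%:M : 'M[k]_n).
Proof.
move=> a0; split; first by rewrite tr_scalar_mx.
by rewrite unitmxE det_scalar unitrX // unitfE.
Qed.

Lemma gwm_scalar n (a : k) : a != 0 -> gwm (a%:M : 'M[k]_n) = gw_unit a *+ n.
Proof.
move=> a0; elim: n => [|n IH]; first by rewrite gwm0.
rewrite -[LHS]/(@gwm (1 + n) a%:M) scalar_mx_block.
by rewrite gwm_block ?IH ?mulrS //; apply: gram_scalar.
Qed.

Section Metabolic.
Variable q : nat.
Implicit Types (C N : 'M[k]_q).

Definition metab C : 'M[k]_(q + q) := block_mx 0 1%:M 1%:M C.

Lemma metab_gram C : C^T = C -> gram (metab C).
Proof.
move=> sC; split; first by rewrite tr_block_mx !trmx0 trmx1 sC.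
have /mulmx1_unit[] // : metab C *m block_mx (- C) 1%:M 1%:M 0 = 1%:M.
rewrite mulmx_block !mul0mx !mul1mx !mulmx1 !mulmx0 add0r !addr0 addNr.
by rewrite -scalar_mx_block.
Qed.

Lemma sym_diag_upper C : C^T = C -> exists N (c : 'rV[k]_q),
  C = diag_mx c + N + N^T.
Proof.
move=> sC; exists (\matrix_(i, j) if (i < j)%N then C i j else 0), (\row_i C i i).
apply/matrixP => i j; rewrite !mxE.
case: (ltngtP i j) => [ij|ji|/val_inj <-]; rewrite ?eqxx ?mulr1n ?addr0 //.
- by rewrite (negPf (_ : i != j)) ?mulr0n ?add0r // -val_eqE /= neq_ltn ij.
rewrite (negPf (_ : i != j)) ?mulr0n ?add0r; last by rewrite -val_eqE /= neq_ltn ji orbT.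
by rewrite -[in LHS]sC mxE.
Qed.

(** Add [N] times the Lagrangian basis to the complementary one. In characteristic 2 this leaves the
    diagonal of [C] unchanged. *)
Lemma gwm_metab_shift C N : C^T = C -> gwm (metab (C + N + N^T)) = gwm (metab C).
Proof.
move=> sC; apply: (@gwm_congr_sq _ _ _ (block_mx 1%:M 0 N 1%:M)).
- by apply: metab_gram; rewrite !linearD /= trmxK sC addrAC.
- exact: metab_gram.
rewrite tr_block_mx !trmx0 !trmx1 !mulmx_block !mul0mx !mul1mx !mulmx0 !mulmx1.
rewrite !add0r !addr0; congr block_mx.
  by rewrite mul0mx add0r.
by rewrite mul1mx addrC [N + C]addrC.
Qed.

(* Adding an auxiliary form [A] allows one to change [C] by [R A R^T]:
   with [w], [u] the bases of the Lagrangian and of its complement and [e] the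
   basis of [A], replace [u] by [u + R e] and [e] by [e - A R^T w]. *)
Lemma gwm_metab_add C (A R : 'M[k]_q) : C^T = C -> gram A ->
  gwm (metab (C + R *m A *m R^T)) = gwm (metab C).
Proof.
move=> sC gA; have [sA uA] := gA.
have sC' : (C + R *m A *m R^T)^T = C + R *m A *m R^T.
  by rewrite linearD /= !trmx_mul trmxK sA sC mulmxA.
apply: (addIr (gwm A)); rewrite -!gwm_block //; try exact: metab_gram.
pose P : 'M[k]_(q + q + q) :=
  block_mx (1%:M) (col_mx 0 R) (row_mx (- (A *m R^T)) 0) 1%:M.
apply: (@gwm_congr_sq _ _ _ P).
- by apply: gram_block => //; apply: metab_gram.
- by apply: gram_block => //; apply: metab_gram.
rewrite /P tr_block_mx !trmx1 tr_col_mx tr_row_mx !trmx0 linearN /= trmx_mul trmxK sA.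
do 2 rewrite mulmx_block ?(mulmx0, mul0mx, mul1mx, mulmx1, addr0, add0r).
congr block_mx.
- rewrite /metab mul_col_mx mul0mx mul_col_row ?(mul0mx, mulmx0) add_block_mx.
  by rewrite !addr0.
- rewrite /metab mul_block_col ?(mul0mx, mul1mx, mulmx0, add0r, addr0) mul_col_mx mul0mx.
  by rewrite add_col_mx addr0 addNr col_mx0.
- rewrite /metab mul_row_block ?(mul0mx, mulmx1, mulmx0, add0r, addr0) mul_mx_row mulmx0.
  by rewrite add_row_mx addr0 addNr row_mx0.
rewrite /metab mul_row_block ?(mul0mx, mulmx1, mulmx0, add0r, addr0).
by rewrite mul_row_col ?(mul0mx, mulmx0, add0r, addr0).
Qed.

Lemma gwm_metab C : C^T = C -> gwm (metab C) = hyperbolic k *+ q.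
Proof.
move=> sC; have [N [c ->]] := sym_diag_upper sC.
have sD (r : 'rV[k]_q) : (diag_mx r)^T = diag_mx r by rewrite tr_diag_mx.
rewrite gwm_metab_shift //.
(* Chosen so that [c + r^2 a = 1] in each entry, with no entry of [a] zero. *)
pose a : 'rV[k]_q := \row_i if c 0 i == 1 then 1 else 1 - c 0 i.
pose r : 'rV[k]_q := \row_i if c 0 i == 1 then 0 else 1.
have gA : gram (diag_mx a).
  split=> //; rewrite unitmxE det_diag unitfE; apply/prodf_neq0 => i _.
  rewrite mxE; have [ci|ci] := eqVneq (c 0 i) 1; first by rewrite oner_eq0.
  by rewrite subr_eq0 eq_sym.
rewrite -(gwm_metab_add (diag_mx r) (sD c) gA) sD.
have -> : diag_mx c + diag_mx r *m diag_mx a *m diag_mx r = 1%:M.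
  rewrite !mulmx_diag -linearD /= -diag_const_mx; congr diag_mx; apply/rowP => i.
  by rewrite !mxE; case: eqP => [->|_]; rewrite ?mul0r ?addr0 // mul1r mulr1 addrC subrK.
have g1 : gram (metab 1%:M) by apply: metab_gram; rewrite trmx1.
have n1 : (-1 : k) != 0 by rewrite oppr_eq0 oner_eq0.
have gh : gram (block_mx (-1)%:M 0 0 1%:M : 'M[k]_(q + q)).
  by apply: gram_block; apply: gram_scalar; rewrite ?oner_eq0.
(* With [w] a vector of the Lagrangian basis and [u] its dual vector of norm 1, [w - u] and [u] are
   orthogonal of norms -1 and 1. *)
rewrite -(@gwm_congr_sq _ _ _ (block_mx 1%:M (- 1%:M) 0 1%:M) gh g1).
  rewrite gwm_block ?gwm_scalar ?oner_eq0 ?mulrnDl 1?addrC //; apply: gram_scalar => //.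
  exact: oner_neq0.
rewrite tr_block_mx !trmx0 !trmx1 linearN /= trmx1 /metab !mulmx_block.
rewrite !(mul0mx, mul1mx, mulmx0, mulmx1, add0r, addr0, mulNmx, mulmxN, subrr, oppr0).
by rewrite raddfN.
Qed.

End Metabolic.

(** A right inverse of [W *m G], transposed, is a complement dual to the Lagrangian [W]; in the
    resulting basis the Gram matrix is a [metab]. *)
Lemma gwm_lagrangian n q (G : 'M[k]_n) (W : 'M[k]_(q, n)) :
  n = (q + q)%N -> gram G -> row_free W -> W *m G *m W^T = 0 ->
  gwm G = hyperbolic k *+ q.
Proof.
move=> e; subst n => gG fW WG0; have [sG uG] := gG.
have /row_freeP[X WX] : row_free (W *m G).
  by rewrite /row_free mxrankMfree ?row_free_unit.
pose U := X^T; pose C := U *m G *m U^T.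
have sC : C^T = C by rewrite /C !trmx_mul !trmxK sG mulmxA.
have WU : W *m G *m U^T = 1%:M by rewrite trmxK.
have UW : U *m G *m W^T = 1%:M.
  by apply: trmx_inj; rewrite !trmx_mul trmxK sG mulmxA trmx1.
rewrite -(gwm_metab sC); apply/esym.
apply: (gwm_congr_sq (P := col_mx W U) (metab_gram sC) gG).
by rewrite mul_col_mx tr_col_mx mul_col_row WG0 WU UW.
Qed.

End GramClass.

(** * Gram matrices of trace forms *)

Section TraceForm.
Variables (k : fieldType) (L : fieldExtType k).

Definition trace_form (J : L) : 'M[k]_(\dim {:L}) :=
  \matrix_(a, b) field_trace (J * (vbasis {:L})`_a * (vbasis {:L})`_b).

Lemma trace_form_gram J : J != 0 -> trace_gram L \in unitmx -> gram (trace_form J).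
Proof.
move=> J0 uT; split; first by apply/matrixP => a b; rewrite !mxE mulrAC.
rewrite /trace_form -mul_matrix_gram unitmx_mul uT andbT.
suff /mulmx1_unit[] : mul_matrix J *m mul_matrix J^-1 = 1%:M by [].
by rewrite -mul_matrixM divff // mul_matrix1.
Qed.

Lemma transfer_unit J : J != 0 -> trace_gram L \in unitmx ->
  transfer (gw_unit J) = gwm (trace_form J).
Proof.
move=> J0 uT; have gT := trace_form_gram J0 uT.
have gJ : gram (J%:M : 'M[L]_1) by exact: gram_scalar.
rewrite /gw_unit transfer_gw_class; congr groth_in; apply/iso_classE.
have := transfer_form_val (sform_of (J%:M : 'M_1)) uT.
move: (gram_val gJ); case: (sform_of _) => vJ pJ /= eJ; subst vJ.
move: (transfer_form _) (sform_of (trace_form J)) (gram_val gT) => [vA pA] [vB pB] /= eB eA.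
subst vA vB.
pose p_ := fun _ : 'I_1 => \dim {:L}.
apply: (@isometric_reindex _ (SForm pA) (SForm pB)
  (fun i => tagged (@tagnat.sig 1 p_ i)) (fun a => @tagnat.rank 1 p_ (existT _ ord0 a))).
- move=> i; rewrite -[RHS](tagnat.sigK i); congr tagnat.rank.
  by case: (tagnat.sig i) => x a; rewrite (ord1 x).
- by move=> a; rewrite tagnat.rankK.
move=> i j; rewrite /smx /= trace_mx_entry [RHS]mxE.
by rewrite !mxE !ord1 eqxx mulr1n.
Qed.

End TraceForm.

Section Families.
Variables (k : fieldType) (N : nat) (K : 'I_N -> fieldExtType k).
Local Notation dK i := (\dim {:K i}).
Local Notation D := (\sum_i dK i)%N.

Definition fam_row (w : forall i, K i) : 'rV[k]_D :=
  \mxrow_i \row_(a < dK i) coord (vbasis {:K i}) a (w i).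

Definition row_fam (v : 'rV[k]_D) i : K i :=
  \sum_(a < dK i) submxrow v i 0 a *: (vbasis {:K i})`_a.

Definition trace_row (w : forall i, K i) : 'rV[k]_D :=
  \mxrow_i \row_(a < dK i) field_trace ((vbasis {:K i})`_a * w i).

Lemma row_famK v : fam_row (row_fam v) = v.
Proof.
rewrite -[RHS]submxrowK; apply: eq_mxrow => i; apply/rowP => a.
by rewrite mxE coord_sum_free // (basis_free (vbasisP _)).
Qed.

Lemma fam_row_eq0 w : fam_row w = 0 -> forall i, w i = 0.
Proof.
move=> w0 i; rewrite (coord_vbasis (memvf (w i))) big1 // => a _.
have := congr1 (fun v => submxrow v i 0 a) w0; rewrite mxrowK mxE => ->.
by rewrite !mxE scale0r.
Qed.

Lemma trace_row_pair v w : v *m (trace_row w)^T = (\sum_i field_trace (row_fam v i * w i))%:M.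
Proof.
rewrite -{1}(submxrowK v) /trace_row tr_mxrow mul_mxrow_mxcol raddf_sum.
apply: eq_bigr => i _; apply/matrixP => x y; rewrite !ord1 !mxE eqxx mulr1n.
rewrite /row_fam mulr_suml field_trace_sum; apply: eq_bigr => a _.
by rewrite !mxE -scalerAl field_traceZ.
Qed.

Lemma trace_form_pair (J : forall i, K i) v v' :
  v *m (\mxdiag_i trace_form (J i)) *m v'^T
  = (\sum_i field_trace (J i * row_fam v i * row_fam v' i))%:M.
Proof.
rewrite -{1}(submxrowK v) mul_mxrow_mxdiag.
rewrite -{1}(submxrowK v') tr_mxrow mul_mxrow_mxcol raddf_sum.
apply: eq_bigr => i _; apply/matrixP => x y; rewrite !ord1 mxE [RHS]mxE eqxx mulr1n.
rewrite {2}/row_fam mulr_sumr field_trace_sum; apply: eq_bigr => b _.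
rewrite -scalerAr field_traceZ mulrC [in LHS]mxE; congr (_ * _).
rewrite mxE /row_fam mulr_sumr mulr_suml field_trace_sum; apply: eq_bigr => a _.
by rewrite -scalerAr -scalerAl field_traceZ [trace_form _ _ _]mxE.
Qed.

End Families.

(** * Evaluation of forms at all points *)

Section Evaluation.
Variables (k : fieldType) (n N : nat) (K : 'I_N -> fieldExtType k).
Local Notation S := {mpoly k[n.+1]}.
Local Notation SV d := (dhomog n.+1 k d).
Local Notation D := (\sum_i \dim {:K i})%N.
Variables (u : forall i, 'I_n.+1 -> K i) (I : S -> Prop).
Hypothesis hI : homideal I.

Definition ev_row M (g : SV M) : 'rV[k]_D := fam_row (fun i => ev (u i) (g : S)).
Definition ev_trace_row M (g : SV M) : 'rV[k]_D := trace_row (fun i => ev (u i) (g : S)).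

Fact ev_row_linear M : linear (@ev_row M).
Proof.
move=> c g h; rewrite /ev_row /fam_row; apply/rowP => a.
by rewrite !mxE !linearP.
Qed.
HB.instance Definition _ M :=
  GRing.isLinear.Build k (SV M) 'rV[k]_D _ (@ev_row M) (@ev_row_linear M).

Fact ev_trace_row_linear M : linear (@ev_trace_row M).
Proof.
move=> c g h; rewrite /ev_trace_row /trace_row; apply/rowP => a.
by rewrite !mxE !linearP /= mulrDr -scalerAr !linearP.
Qed.
HB.instance Definition _ M :=
  GRing.isLinear.Build k (SV M) 'rV[k]_D _ (@ev_trace_row M) (@ev_trace_row_linear M).

(** In degree [M] evaluation at all points is onto, with the forms in [I] as its kernel. *)
Lemma count_points M :
  (forall g, g \is M.-homog -> (forall i, ev (u i) g = 0) -> I g) ->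
  (forall g, I g -> forall i, ev (u i) g = 0) ->
  (forall c : forall i, K i, exists2 g, g \is M.-homog & forall i, ev (u i) g = c i) ->
  hilb I M = D.
Proof.
move=> sat van surj; pose F := linfun (@ev_row M).
have kF : lker F = hpart I M.
  apply/vspaceP => g; rewrite memv_ker lfunE /=; apply/eqP/idP.
    move=> /fam_row_eq0 h; apply/(mem_hpart hI)/sat; last exact: h.
    exact: dhomog_is_dhomog.
  move=> /(mem_hpart hI) /van h; apply/rowP => a.
  by rewrite !mxE h linear0.
have iF : limg F = fullv.
  apply/vspaceP => v; rewrite memvf.
  have [g hg gE] := surj (row_fam v).
  have -> : v = F (mkH hg).
    rewrite lfunE /= -[LHS]row_famK; apply/rowP => a.
    by rewrite !mxE gE.
  by apply: memv_img; apply: memvf.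
have := limg_ker_dim F fullv; rewrite iF (capv_idPr (subvf _)) kF !dimvf.
rewrite -[dim 'rV[k]_D]/(1 * D)%N mul1n.
by move=> E; apply: (@addnI (\dim (hpart I M))); rewrite E addnC hilbE dimvf.
Qed.

(** Forms in [I] impose no condition, so at most [q] linear conditions cut out the annihilator in a
    space of dimension [2 q]. *)
Lemma annihilator_rows m q : (hilb I m <= q)%N -> D = (q + q)%N ->
  (forall g, I g -> forall i, ev (u i) g = 0) ->
  exists W : 'M[k]_(q, D), row_free W /\
    forall x, annihilates m u (row_fam (row x W)).
Proof.
move=> hq DE van; pose C := (hpart I m)^C%VS.
pose A := \matrix_(x < \dim C) ev_trace_row (vbasis C)`_x.
have rA : (q <= \rank (kermx A^T))%N.
  have dC := dimv_compl (hpart I m).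
  have := rank_leq_row A; rewrite mxrank_ker mxrank_tr.
  by move: (hilbE I m); rewrite /C in A *; lia.
(* The annihilator may have dimension above [q]; [pid_mx] keeps [q] vectors of a basis. *)
exists (pid_mx q *m row_base (kermx A^T)); split.
  by rewrite /row_free mxrankMfree ?row_base_free // rank_pid_mx.
move=> x; set v := row x _ => g hg.
have vA : v *m A^T = 0.
  apply/sub_kermxP; rewrite -(eq_row_base (kermx A^T)).
  exact: submx_trans (row_sub _ _) (submxMl _ _).
have /(congr1 (fun Z : 'M_1 => Z 0 0)) := trace_row_pair v (fun i => ev (u i) g).
rewrite [RHS]mxE eqxx mulr1n => <-.
rewrite -[trace_row _]/(ev_trace_row (mkH hg)).
have : mkH hg \in (hpart I m + C)%VS by rewrite addv_complf memvf.
case/memv_addP => a /(mem_hpart hI) /van a0 [c cC ->].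
have -> : ev_trace_row (a + c) = ev_trace_row c.
  rewrite linearD /= [X in X + _](_ : _ = 0) ?add0r //.
  by apply/rowP => b; rewrite !mxE a0 mulr0 linear0.
rewrite (coord_vbasis cC) linear_sum /= linear_sum /= mulmx_sumr summxE big1 // => y _.
rewrite linearZ /= linearZ /= -scalemxAr mxE.
have := congr1 (fun Z : 'rV_ _ => Z 0 y) vA; rewrite [in RHS]mxE => E.
suff -> : (v *m (ev_trace_row (vbasis C)`_y)^T) 0 0 = 0 by rewrite mulr0.
by rewrite -[RHS]E !mxE; apply: eq_bigr => b _; rewrite !mxE.
Qed.

End Evaluation.

Lemma coords_vanish (n : nat) (k : fieldType) (p : {mpoly k[n.+1]} -> bool)
    (L : fieldExtType k) (u : 'I_n.+1 -> L) l s :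
  homideal p -> coords p u l -> p s -> ev u s = 0.
Proof.
move=> hp [_ van _] ps; rewrite {1}(hc_sum (leqnn (msize s))) raddf_sum big1 // => i _ /=.
by apply/eqP; rewrite -(van _ _ (hc_homog i s)); apply: (hiH hp).
Qed.

(** * The sum of the transferred forms *)

Section Main.
Variables (k : fieldType) (n : nat) (d : 'I_n -> nat) (f : 'I_n -> {mpoly k[n.+1]}).
Hypothesis d0 : forall i, (0 < d i)%N.
Hypothesis hf : forall i, f i \is (d i).-homog.
Hypothesis tr : forall (p : projPoint k n) (K : residueField p) (l : 'I_n.+1),
  intersection_point f p -> in_chart p l -> jac f (affine K l) l != 0.
Variable m : nat.
Hypothesis sumd : (\sum_(i < n) (d i).-1 = m.*2.+1)%N.

Variables (N : nat) (pt : 'I_N -> projPoint k n).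
Variables (K : forall i, residueField (pt i)) (l : 'I_N -> 'I_n.+1).
Hypothesis ptP : enumerates pt (intersection_point f).
Hypothesis lP : forall i, in_chart (pt i) (l i).

Lemma sum_transfer : \sum_(i < N) transfer (gw_unit (jacobian f (K i) (l i)))
  = hyperbolic k *+ ((\prod_(i < n) d i) %/ 2).
Proof.
have [E hE] := avoiding_h d0 hf ptP.
have [e [Ee e0 me]] : exists e, [/\ (E <= e)%N, (0 < e)%N & (m < e)%N].
  by exists (E + m).+1; split; lia.
have {hE} [h [hh hP ch]] := hE e Ee e0.
have ph : pform h by exists e.
have [_ nh] := fideal_regular d0 hf ph ch.
have [D [Dh HD dD]] := system_bez d0 hf e0 hh.
pose F i : fieldExtType k := rf_field (K i).
pose u i : 'I_n.+1 -> F i := pt_affine K l i.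
have uP i : coords (pid (pt i)) (u i) (l i) := pt_coords K lP i.
have ul i : u i (l i) = 1 := co_norm (uP i).
have VP i := pt_inV ptP i.
have van s : fideal f s -> forall i, ev (u i) s = 0.
  move=> Is i; apply: (coords_vanish (cl_homideal (VP i).1) (uP i)).
  exact: (inV_fideal (VP i) Is).
have fu i j : ev (u i) (f j) = 0 by apply/van/fideal_gen.
have hu i : ev (u i) h != 0 by rewrite -(co_vanish (uP i) hh).
have surj := ev_surj ptP K lP.
have hI := fideal_homideal d0 hf.
have J0 i : jac f (u i) (l i) != 0 by apply: tr => //; case: ptP.
have uT i : trace_gram (F i) \in unitmx.
  have [//|t0] := trace_gram_cases (F i).
  by case: (field_trace_neq0 hf hh me sumd ul fu hu surj Dh HD dD (J0 i)).
pose q := hilb (fideal f) m.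
have qE : (q * 2 = \prod_i d i)%N.
  apply/eqP; rewrite -eqz_nat -(box_half d0 sumd) sumrMnl -(hilb_fideal d0 hf ph ch).
  by rewrite PoszM -mulr_natr.
have dimE : (\sum_i \dim {:F i} = q + q)%N.
  (* A degree beyond the surjectivity bound and at least [2 m + 1], from where on the Hilbert
     function is constant. *)
  have [M0 hM] := surj; pose M := (M0 + m.*2.+1)%N.
  rewrite -(count_points hI (M := M) _ van (hM M (leq_addr _ _))).
    apply/eqP; rewrite -eqz_nat (hilb_fideal d0 hf ph ch) (box_large d0); last first.
      by rewrite sumd /M ltnS leq_addl.
    by rewrite -qE eqz_nat addnn muln2.
  move=> g hg g0; apply: (saturated d0 hf tr ptP ph nh hg) => i.
  by rewrite (co_vanish (uP i) hg) g0.
have [W [fW WP]] := annihilator_rows hI (leqnn q) dimE van.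
have gT i : gram (trace_form (jac f (u i) (l i)))
  := trace_form_gram (J0 i) (uT i).
have [gG wG] := gwm_mxdiag gT.
transitivity (gwm (\mxdiag_i trace_form (jac f (u i) (l i)))).
  rewrite wG; apply: eq_bigr => i _; rewrite jacobianE //.
  exact: (transfer_unit (J0 i) (uT i)).
rewrite -qE mulnK //; apply: (gwm_lagrangian dimE gG fW).
apply/matrixP => x y; rewrite [RHS]mxE.
have -> : (W *m (\mxdiag_i trace_form (jac f (u i) (l i))) *m W^T) x y
    = (row x W *m (\mxdiag_i trace_form (jac f (u i) (l i))) *m (row y W)^T) 0 0.
  rewrite -row_mul tr_row [LHS]mxE [RHS]mxE; apply: eq_bigr => a _.
    by rewrite [row _ _ _ _]mxE [col _ _ _ _]mxE.
rewrite trace_form_pair mxE eqxx mulr1n.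
exact: (annihilates_isotropic hf hh me sumd ul fu hu surj Dh HD dD (WP x) (WP y)).
Qed.

End Main.

Theorem theorem1p2 (k : fieldType) (n : nat) (d : 'I_n -> nat)
    (f : 'I_n -> {mpoly k[n.+1]}) :
  perfect_field k ->
  (1 <= n)%N ->
  (forall i, 0 < d i)%N ->
  (\sum_(i < n) d i = n.+1 %[mod 2])%N ->
  (forall i, f i != 0) ->
  (forall i, f i \is (d i).-homog) ->
  (forall (p : projPoint k n) (K : residueField p) (l : 'I_n.+1),
     intersection_point f p -> in_chart p l -> transverse_at f K l) ->
  (exists (N : nat) (pt : 'I_N -> projPoint k n),
     enumerates pt (intersection_point f) /\
     forall i, inhabited (residueField (pt i))) /\
  (forall (N : nat) (pt : 'I_N -> projPoint k n)
          (K : forall i, residueField (pt i)) (l : 'I_N -> 'I_n.+1),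
     enumerates pt (intersection_point f) ->
     (forall i, in_chart (pt i) (l i)) ->
     \sum_(i < N) transfer (gw_unit (jacobian f (K i) (l i)))
     = hyperbolic k *+ ((\prod_(i < n) d i) %/ 2)).
Proof.
move=> _ _ d0 parity _ hf trv.
have tr (p : projPoint k n) (K : residueField p) (l : 'I_n.+1) :
    intersection_point f p -> in_chart p l -> jac f (affine K l) l != 0.
  by move=> ip lp; apply/(transverse_jac lp)/trv.
split; first exact: (enumeration_exists d0 hf tr).
have sumE : (\sum_i (d i).-1 + n = \sum_i d i)%N.
  rewrite [RHS](eq_bigr (fun i => (d i).-1 + 1)%N) => [|i _]; last by rewrite addn1 prednK.
  by rewrite big_split /= sum_nat_const card_ord muln1.
have [m sumd] : exists m, (\sum_i (d i).-1 = m.*2.+1)%N.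
  by exists (\sum_i (d i).-1)./2; move: parity; rewrite -sumE; lia.
by move=> N pt K l ptP lP; apply: (sum_transfer d0 hf tr sumd).
Qed.
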